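(* Let $a>1$, let $\Psi=\{\psi_1,\psi_2,\dots,\psi_L\}$ be a finite subset of $L^2(\mathbb{R}_+)$ with cardinality $L$, and let $\Phi=\{\varphi_1,\varphi_2,\dots,\varphi_L\}\subset L^2(\mathbb{R}_+)$. Assume that $\mathcal{MD}(\Psi,a)$ and $\mathcal{MD}(\Phi,a)$ are Bessel sequences in $L^2(\mathbb{R}_+)$. Then $\mathcal{MD}(\Psi,a)$ and $\mathcal{MD}(\Phi,a)$ form a pair of dual frames for $L^2(\mathbb{R}_+)$ if and only if $$\sum_{l=1}^{L}\Theta_a\varphi_l(x,\xi)\,\overline{\Theta_a\psi_l(x,\xi)}=1\quad\text{for a.e. }(x,\xi)\in[1,a)\times[0,1).$$
   Context: $\mathbb{R}_+=(0,\infty)$, and $L^2(\mathbb{R}_+)$ is the space of complex-valued square-integrable functions on $\mathbb{R}_+$. A measurable function $h$ on $\mathbb{R}_+$ is $a$-dilation periodic if $h(ax)=h(x)$ for a.e. $x\in\mathbb{R}_+$. For $m\in\mathbb{Z}$, $\Lambda_m$ is the $a$-dilation periodic function on $\mathbb{R}_+$ determined by $\Lambda_m(x)=\frac{1}{\sqrt{a-1}}e^{\frac{2\pi i m x}{a-1}}$ for $x\in[1,a)$. For $c>0$, $D_c f(x)=\sqrt{c}\,f(cx)$. The dilation-and-modulation system is $\mathcal{MD}(\Psi,a)=\{\Lambda_m D_{a^j}\psi_l:\ m,j\in\mathbb{Z},\ 1\le l\le L\}$ (indexed by $(m,j,l)$), and $\mathcal{MD}(\Phi,a)$ is defined in the same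 way. The $\Theta_a$-transform of $f\in L^2(\mathbb{R}_+)$ is $\Theta_a f(x,\xi)=\sum_{l\in\mathbb{Z}}a^{l/2}f(a^l x)e^{-2\pi i l\xi}$ for a.e. $(x,\xi)\in\mathbb{R}_+\times\mathbb{R}$ (for a.e. $x$ the coefficient sequence is in $\ell^2(\mathbb{Z})$, so the series is a Fourier series converging in $L^2([0,1))$ in $\xi$). $\mathcal{MD}(\Psi,a)$ is a frame for $L^2(\mathbb{R}_+)$ if there are $0<C_1\le C_2<\infty$ with $C_1\|f\|^2\le\sum_{l=1}^{L}\sum_{m,j\in\mathbb{Z}}|\langle f,\Lambda_m D_{a^j}\psi_l\rangle|^2\le C_2\|f\|^2$ for all $f\in L^2(\mathbb{R}_+)$; it is a Bessel sequence if the right-hand inequality holds for some $C_2<\infty$. The systems $\mathcal{MD}(\Psi,a)$ and $\mathcal{MD}(\Phi,a)$ form a pair of dual frames for $L^2(\mathbb{R}_+)$ if both are frames for $L^2(\mathbb{R}_+)$ and $f=\sum_{l=1}^{L}\sum_{m,j\in\mathbb{Z}}\langle f,\Lambda_m D_{a^j}\varphi_l\rangle_{L^2(\mathbb{R}_+)}\Lambda_m D_{a^j}\psi_l$ for all $f\in L^2(\mathbb{R}_+)$. *)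

(* Defs.v *)
From HB Require Import structures.
From mathcomp Require Import all_boot all_order all_algebra.
From mathcomp Require Import finmap.
From mathcomp Require Import all_classical all_reals all_analysis.
From mathcomp Require Import complex.

Set Implicit Arguments.
Unset Strict Implicit.
Unset Printing Implicit Defensive.

Import Order.TTheory GRing.Theory Num.Theory.
Import numFieldNormedType.Exports.

Local Open Scope classical_set_scope.
Local Open Scope ring_scope.

(* Elements of L^2(R_+) are represented by functions R -> R[i]; only their
   restriction to R_+ = ]0, +oo[ matters, and only up to a null set. *)
Definition Rplus {R : realType} : set R := `]0, +oo[%classic.

Definition expi {R : realType} (t : R) : R[i] := (cos t +i* sin t)%C.

Definition cmeasurable {R : realType} {d : measure_display}
    {T : measurableType d} (D : set T) (f : T -> R[i]) : Prop :=
  measurable_fun D (fun x => complex.Re (f x)) /\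
  measurable_fun D (fun x => complex.Im (f x)).

Definition sqnorm {R : realType} (D : set R) (f : R -> R[i]) : \bar R :=
  (\int[lebesgue_measure]_(x in D) ((Normc.normc (f x) ^+ 2)%:E))%E.

Definition inL2 {R : realType} (D : set R) (f : R -> R[i]) : Prop :=
  cmeasurable D f /\ (sqnorm D f < +oo)%E.

Definition cintegral {R : realType} (D : set R) (f : R -> R[i]) : R[i] :=
  (Rintegral lebesgue_measure D (fun x => complex.Re (f x)) +i*
   Rintegral lebesgue_measure D (fun x => complex.Im (f x)))%C.

Definition inner {R : realType} (f g : R -> R[i]) : R[i] :=
  cintegral Rplus (fun x => f x * conjc (g x)).

(* Unconditional convergence of \sum_i u_i to f in L^2(D): convergence of the
   net of finite partial sums. *)
Definition L2_sum {R : realType} (D : set R) {I : choiceType}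
    (u : I -> R -> R[i]) (f : R -> R[i]) : Prop :=
  forall e : R, 0 < e ->
  exists F0 : {fset I}, forall F : {fset I}, (F0 `<=` F)%fset ->
    (sqnorm D (fun x => (f x - \sum_(i <- F) u i x)%R) < (e ^+ 2)%:E)%E.

Definition coef_energy {R : realType} {I : choiceType}
    (g : I -> R -> R[i]) (f : R -> R[i]) : \bar R :=
  (\esum_(i in [set: I]) ((Normc.normc (inner f (g i)) ^+ 2)%:E))%E.

Definition is_bessel {R : realType} {I : choiceType}
    (g : I -> R -> R[i]) : Prop :=
  exists C2 : R, forall f : R -> R[i], inL2 Rplus f ->
    (coef_energy g f <= C2%:E * sqnorm Rplus f)%E.

Definition is_frame {R : realType} {I : choiceType}
    (g : I -> R -> R[i]) : Prop :=
  exists C1 C2 : R, [/\ 0 < C1, C1 <= C2 &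
    forall f : R -> R[i], inL2 Rplus f ->
      (C1%:E * sqnorm Rplus f <= coef_energy g f)%E /\
      (coef_energy g f <= C2%:E * sqnorm Rplus f)%E].

Definition dual_frames {R : realType} {I : choiceType}
    (g h : I -> R -> R[i]) : Prop :=
  [/\ is_frame g, is_frame h &
    forall f : R -> R[i], inL2 Rplus f ->
      L2_sum Rplus (fun i x => inner f (h i) * g i x) f].

(* For x > 0, the integer k with a ^ k <= x < a ^ (k + 1). *)
Definition dil_index {R : realType} (a x : R) : int :=
  Num.floor (ln x / ln a).

(* x * a ^ (- dil_index a x) is the representative of x in [1, a) modulo
   dilation by a (see Lambda_dilation and Lambda_base below). *)
Definition Lambda {R : realType} (a : R) (m : int) (x : R) : R[i] :=
  ((Num.sqrt (a - 1))^-1)%:C%C *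
  expi (2 * pi * m%:~R * (x * a ^ (- dil_index a x)) / (a - 1)).

Definition dilation {R : realType} (c : R) (f : R -> R[i]) (x : R) : R[i] :=
  (Num.sqrt c)%:C%C * f (c * x).

Definition MD {R : realType} (L : nat) (psi : 'I_L -> R -> R[i]) (a : R)
    (i : int * int * 'I_L) (x : R) : R[i] :=
  let: (m, j, l) := i in Lambda a m x * dilation (a ^ j) (psi l) x.

Definition Theta_term {R : realType} (a : R) (f : R -> R[i]) (x : R)
    (l : int) (xi : R) : R[i] :=
  (a `^ (l%:~R / 2))%:C%C * f (a ^ l * x) * expi (- (2 * pi * l%:~R * xi)).

(* The Fourier series converges in L^2([0, 1)) in xi for a.e. x, so the
   transform is determined only up to a null set of R_+ x R; F is a jointly
   measurable, 1-periodic in xi, version of it. *)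
Definition is_Theta {R : realType} (a : R) (f : R -> R[i])
    (F : R * R -> R[i]) : Prop :=
  [/\ cmeasurable (Rplus `*` [set: R]) F,
      forall x xi : R, 0 < x -> F (x, xi + 1) = F (x, xi) &
      {ae lebesgue_measure, forall x : R, 0 < x ->
        L2_sum `[0, 1[%classic (Theta_term a f x) (fun xi => F (x, xi))}].

Definition Theta {R : realType} (a : R) (f : R -> R[i]) : R * R -> R[i] :=
  xget (fun=> 0) [set F | is_Theta a f F].

Lemma dil_indexM {R : realType} (a x : R) : 1 < a -> 0 < x ->
  dil_index a (a * x) = dil_index a x + 1.
Proof.
move=> a1 x0; have a0 : 0 < a by exact: lt_trans a1.
rewrite /dil_index lnM ?posrE// mulrDl divff; last by rewrite gt_eqF// ln_gt0.
by rewrite addrC floorDrz ?int_num1// floor1.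
Qed.

Lemma Lambda_dilation {R : realType} (a : R) (m : int) (x : R) :
  1 < a -> 0 < x -> Lambda a m (a * x) = Lambda a m x.
Proof.
move=> a1 x0; have a0 : a != 0 by rewrite gt_eqF// (lt_trans _ a1).
rewrite /Lambda dil_indexM// opprD expfzDr//.
suff -> : a * x * (a ^ (- dil_index a x) * a ^ (-1)) = x * a ^ (- dil_index a x)
  by [].
by rewrite (mulrC a) -mulrA (mulrCA a) -[a ^ (-1)]/(a^-1) divff// mulr1.
Qed.

Lemma Lambda_base {R : realType} (a : R) (m : int) (x : R) :
  1 < a -> 1 <= x -> x < a ->
  Lambda a m x = ((Num.sqrt (a - 1))^-1)%:C%C *
                 expi (2 * pi * m%:~R * x / (a - 1)).
Proof.
move=> a1 x1 xa; rewrite /Lambda.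
suff -> : dil_index a x = 0 by rewrite oppr0 expr0z mulr1.
have x0 : 0 < x by exact: lt_le_trans x1.
apply: floor_def; rewrite add0r; apply/andP; split.
  by rewrite divr_ge0 ?ln_ge0// ltW.
by rewrite ltr_pdivrMr ?ln_gt0// mul1r ltr_ln ?posrE// (lt_trans x0).
Qed.

(* Main.v *)
Require Import Defs.
From mathcomp Require Import all_boot all_order all_algebra.
From mathcomp Require Import finmap.
From mathcomp Require Import all_classical all_reals all_analysis.
From mathcomp Require Import measurable_realfun complex ring lra zify.

Set Implicit Arguments.
Unset Strict Implicit.
Unset Printing Implicit Defensive.

Import Order.TTheory GRing.Theory Num.Theory.
Import numFieldNormedType.Exports.

Local Open Scope classical_set_scope.
Local Open Scope ring_scope.

(** Write [atom a (m, j) f] for [Lambda_m] times the dilate of [f] by [a ^ j],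
    so that the two systems consist of the shifts [atom a r (psi l)] and
    [atom a r (phi l)], with [r] in Z x Z.  The [Lambda_m] multiply like
    characters and are invariant under dilation by [a], hence these shifts
    behave, up to the constant [lnorm a] = (a - 1)^(-1/2), like a unitary
    representation of Z x Z: in an inner product of two shifts only the
    difference of the indices matters ([gip_atom]).  The proof puts two
    criteria for duality side by side.

    The first criterion ([dual_frames_MD_iff]) is duality as a relation between
    shifts: the systems are dual iff, for every [r], the sum over [l] of
    <atom r psi_l, phi_l>, multiplied by [lnorm a], is 1 for [r = 0] and 0
    otherwise.  Testing the reconstruction formula for [f] against [k] gives the
    bilinear identity [weak_identity]; conversely, for Bessel families that
    identity implies both the lower frame bounds and the unconditional L^2
    convergence ([dual_frames_of_weak_identity]).  Since the Bessel bounds make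
    it stable under limits, it is enough to check it on a total family
    ([weak_identity_total]).  The shifts of the indicator of [1, a) form an
    orthonormal total family, and on it the mixed frame sums are Parseval sums
    for <atom (p - q) psi_l, phi_l> ([nlim_frame_sum_batom]).

    The second ingredient is that the Theta transform is unitary in the
    appropriate sense ([gip_Theta]).  For fixed [x] the series is a Fourier
    series in [xi], so Parseval turns the integral of |Theta f|^2 over
    [1, a) x [0, 1) into the integral over [1, a) of the energies
    sum_l a^l |f(a^l x)|^2, which is the squared norm of [f].  The transform
    intertwines the shift by [(m, j)] with multiplication by
    [Lambda_m (x) e^(2 pi i j xi)] ([is_Theta_atom]).  The sums of the first
    criterion are therefore the double Fourier coefficients on the rectangle
    of the conjugate of sum_l Theta phi_l conj(Theta psi_l)
    ([sum_gip_atom]), and the relation says that these are the coefficients of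
    the constant function 1.  An integrable function on the rectangle is
    determined almost everywhere by its Fourier coefficients
    ([fourier_uniqueness2]), which is the claim.

    Fourier uniqueness is proved for integrable functions, because the product
    of two square-integrable transforms is only integrable.  In one variable,
    explicit trigonometric polynomials converge boundedly to indicators of
    intervals; the pi-lambda theorem and dominated convergence then make the
    integral over every Borel set vanish ([bounded_class_indic],
    [fourier_uniqueness]).  The same approximation gives totality of the
    orthonormal family ([batom_total]).  That the transform exists as a jointly
    measurable function ([Theta_is_Theta]) is obtained from partial sums whose
    length depends on [x], chosen to converge at a geometric rate. *)

(** * Complex numbers and complex-valued integrals *)

Section ComplexNumbers.
Context {R : realType}.
Implicit Types (z w : R[i]) (t : R).

Lemma complex_eq z w :
  complex.Re z = complex.Re w -> complex.Im z = complex.Im w -> z = w.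
Proof. by case: z w => [a b] [c d] /= -> ->. Qed.

Lemma ReD z w : complex.Re (z + w) = complex.Re z + complex.Re w.
Proof. by case: z w => [a b] [c d]. Qed.

Lemma ImD z w : complex.Im (z + w) = complex.Im z + complex.Im w.
Proof. by case: z w => [a b] [c d]. Qed.

Lemma ReM z w : complex.Re (z * w) =
  complex.Re z * complex.Re w - complex.Im z * complex.Im w.
Proof. by case: z w => [a b] [c d]. Qed.

Lemma ImM z w : complex.Im (z * w) =
  complex.Re z * complex.Im w + complex.Im z * complex.Re w.
Proof. by case: z w => [a b] [c d]. Qed.

Lemma ReN z : complex.Re (- z) = - complex.Re z.
Proof. by case: z. Qed.

Lemma ImN z : complex.Im (- z) = - complex.Im z.
Proof. by case: z. Qed.

Lemma ReJ z : complex.Re (conjc z) = complex.Re z.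
Proof. by case: z. Qed.

Lemma ImJ z : complex.Im (conjc z) = - complex.Im z.
Proof. by case: z. Qed.

Definition cE := (ReD, ImD, ReM, ImM, ReN, ImN, ReJ, ImJ).

Lemma conjcD z w : conjc (z + w) = conjc z + conjc w.
Proof. exact: rmorphD. Qed.

Lemma conjcM z w : conjc (z * w) = conjc z * conjc w.
Proof. exact: rmorphM. Qed.

Lemma conjcN z : conjc (- z) = - conjc z.
Proof. exact: rmorphN. Qed.

Lemma conjcR t : conjc t%:C%C = t%:C%C.
Proof. by rewrite /conjc /= oppr0. Qed.

Lemma conjc_sum (I : Type) (r : seq I) (P : pred I) (f : I -> R[i]) :
  conjc (\sum_(i <- r | P i) f i) = \sum_(i <- r | P i) conjc (f i).
Proof. exact: rmorph_sum. Qed.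

Lemma normc_sqr z :
  Normc.normc z ^+ 2 = complex.Re z ^+ 2 + complex.Im z ^+ 2.
Proof. by case: z => a b /=; rewrite sqr_sqrtr// addr_ge0// sqr_ge0. Qed.

Lemma normc_ge0 z : 0 <= Normc.normc z.
Proof. by case: z => a b /=; rewrite sqrtr_ge0. Qed.

Lemma normcD_le z w :
  Normc.normc (z + w) <= Normc.normc z + Normc.normc w.
Proof. exact: le_normcD. Qed.

Lemma normcNE z : Normc.normc (- z) = Normc.normc z.
Proof. exact: normcN. Qed.

Lemma normcJ z : Normc.normc (conjc z) = Normc.normc z.
Proof. by case: z => a b /=; rewrite sqrrN. Qed.

Lemma normcR t : Normc.normc t%:C%C = `|t|.
Proof. by rewrite /= expr0n addr0 sqrtr_sqr. Qed.

Lemma normc_Re z : `|complex.Re z| <= Normc.normc z.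
Proof.
by rewrite -ler_sqr ?nnegrE ?normc_ge0// normc_sqr real_normK ?num_real//
  lerDl sqr_ge0.
Qed.

Lemma normc_Im z : `|complex.Im z| <= Normc.normc z.
Proof.
by rewrite -ler_sqr ?nnegrE ?normc_ge0// normc_sqr real_normK ?num_real//
  lerDr sqr_ge0.
Qed.

Lemma normc_ReIm z : Normc.normc z <= `|complex.Re z| + `|complex.Im z|.
Proof.
rewrite -ler_sqr ?nnegrE ?normc_ge0 ?addr_ge0// normc_sqr sqrrD.
by rewrite !real_normK ?num_real// lerD2r lerDl mulrn_wge0// mulr_ge0.
Qed.

Lemma mulJ_normc z : z * conjc z = (Normc.normc z ^+ 2)%:C%C.
Proof.
by rewrite normc_sqr; case: z => a b; apply: complex_eq; rewrite /=; ring.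
Qed.

Lemma normc_eq0P z : Normc.normc z = 0 -> z = 0.
Proof. exact: Normc.eq0_normc. Qed.

Lemma normc_sum (I : Type) (r : seq I) (f : I -> R[i]) :
  Normc.normc (\sum_(i <- r) f i) <= \sum_(i <- r) Normc.normc (f i).
Proof.
elim: r => [|i r ih]; first by rewrite !big_nil Normc.normc0.
by rewrite !big_cons (le_trans (normcD_le _ _))// lerD2l.
Qed.

Lemma normc_sqrD z w :
  Normc.normc (z + w) ^+ 2 <=
  2 * Normc.normc z ^+ 2 + 2 * Normc.normc w ^+ 2.
Proof.
rewrite !normc_sqr !cE; set a := complex.Re z; set b := complex.Im z.
set c := complex.Re w; set d := complex.Im w.
have := sqr_ge0 (a - c); have := sqr_ge0 (b - d).
by rewrite !expr2; nra.
Qed.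

Lemma normc_mul_le z w :
  Normc.normc (z * w) <= Normc.normc z ^+ 2 + Normc.normc w ^+ 2.
Proof.
rewrite Normc.normcM; have := sqr_ge0 (Normc.normc z - Normc.normc w).
have := sqr_ge0 (Normc.normc z + Normc.normc w).
by rewrite !expr2; nra.
Qed.

(** The discriminant form of the Cauchy-Schwarz argument: a nonnegative
    real quadratic has nonpositive discriminant, including in the degenerate
    case of a vanishing leading coefficient. *)
Lemma discr_le (A B P : R) : 0 <= B ->
  (forall t, 0 <= A - 2 * t * P + t ^+ 2 * B) -> P ^+ 2 <= A * B.
Proof.
move=> B0 h; have [B00|Bn0] := eqVneq B 0.
  have [->|Pn0] := eqVneq P 0; first by rewrite B00 mulr0 expr0n.
  have := h ((A + 1) / (2 * P)); rewrite B00 mulr0 addr0.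
  have -> : 2 * ((A + 1) / (2 * P)) * P = A + 1 by field.
  by lra.
have Bp : 0 < B by rewrite lt_neqAle eq_sym Bn0.
have := h (P / B).
have -> : A - 2 * (P / B) * P + (P / B) ^+ 2 * B = (A * B - P ^+ 2) / B
  by field.
by rewrite pmulr_lge0 ?invr_gt0// subr_ge0.
Qed.

(** The sums of squares of |f i| - t |g i| form a nonnegative quadratic in
    t. *)
Lemma sum_cauchy_schwarz (I : Type) (r : seq I) (f g : I -> R[i]) :
  Normc.normc (\sum_(i <- r) f i * g i) ^+ 2 <=
  (\sum_(i <- r) Normc.normc (f i) ^+ 2) *
  (\sum_(i <- r) Normc.normc (g i) ^+ 2).
Proof.
apply: (@le_trans _ _
  ((\sum_(i <- r) Normc.normc (f i) * Normc.normc (g i)) ^+ 2)).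
  rewrite ler_sqr ?nnegrE ?normc_ge0//; last first.
    by apply: sumr_ge0 => i _; rewrite mulr_ge0 ?normc_ge0.
  rewrite (le_trans (normc_sum _ _))//.
  by apply: ler_sum => i _; rewrite Normc.normcM.
apply: discr_le; first by apply: sumr_ge0 => i _; exact: sqr_ge0.
move=> t; have : 0 <= \sum_(i <- r)
    (Normc.normc (f i) - t * Normc.normc (g i)) ^+ 2.
  by apply: sumr_ge0 => i _; exact: sqr_ge0.
suff -> : \sum_(i <- r) (Normc.normc (f i) - t * Normc.normc (g i)) ^+ 2 =
  \sum_(i <- r) Normc.normc (f i) ^+ 2 -
  2 * t * (\sum_(i <- r) Normc.normc (f i) * Normc.normc (g i)) +
  t ^+ 2 * \sum_(i <- r) Normc.normc (g i) ^+ 2 by [].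
rewrite !mulr_sumr -sumrB -big_split/=; apply: eq_bigr => i _; ring.
Qed.

End ComplexNumbers.

Section ComplexIntegral.
Context d (T : measurableType d) (R : realType).
Variable mu : {measure set T -> \bar R}.
Implicit Types (D : set T) (f g : T -> R[i]).

Lemma cmeasurableD D f g : cmeasurable D f -> cmeasurable D g ->
  cmeasurable D (fun x => f x + g x).
Proof.
move=> [f1 f2] [g1 g2]; split.
  under eq_fun do rewrite ReD; exact: measurable_funD.
by under eq_fun do rewrite ImD; exact: measurable_funD.
Qed.

Lemma cmeasurableM D f g : cmeasurable D f -> cmeasurable D g ->
  cmeasurable D (fun x => f x * g x).
Proof.
move=> [f1 f2] [g1 g2]; split.
  under eq_fun do rewrite ReM.
  by apply: measurable_funB; exact: measurable_funM.
under eq_fun do rewrite ImM.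
by apply: measurable_funD; exact: measurable_funM.
Qed.

Lemma cmeasurable_cst D (c : R[i]) : cmeasurable D (fun=> c).
Proof. by split; exact: measurable_cst. Qed.

Lemma cmeasurableZ D (c : R[i]) f : cmeasurable D f ->
  cmeasurable D (fun x => c * f x).
Proof. by apply: cmeasurableM; exact: cmeasurable_cst. Qed.

Lemma cmeasurableJ D f : cmeasurable D f -> cmeasurable D (fun x => conjc (f x)).
Proof.
move=> [f1 f2]; split; first by under eq_fun do rewrite ReJ.
by under eq_fun do rewrite ImJ; exact: measurable_funN.
Qed.

Lemma cmeasurable_sum D (I : Type) (r : seq I) (u : I -> T -> R[i]) :
  (forall i, cmeasurable D (u i)) ->
  cmeasurable D (fun x => \sum_(i <- r) u i x).
Proof.
move=> mu_; elim: r => [|i r ih].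
  by under eq_fun do rewrite big_nil; exact: cmeasurable_cst.
under eq_fun do rewrite big_cons.
exact: cmeasurableD.
Qed.

Lemma cmeasurableS D (E : set T) f : measurable D -> E `<=` D ->
  cmeasurable D f -> cmeasurable E f.
Proof. by move=> mD ED [f1 f2]; split; apply: measurable_funS; eassumption. Qed.

Lemma eq_cmeasurable D f g : (forall x, D x -> f x = g x) ->
  cmeasurable D f -> cmeasurable D g.
Proof.
move=> fg [f1 f2]; split.
  by apply: eq_measurable_fun f1 => x /set_mem/fg ->.
by apply: eq_measurable_fun f2 => x /set_mem/fg ->.
Qed.

Lemma measurable_normc_sqr D f : cmeasurable D f ->
  measurable_fun D (fun x => Normc.normc (f x) ^+ 2).
Proof.
move=> [f1 f2]; under eq_fun do rewrite normc_sqr.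
by apply: measurable_funD; exact: measurable_funX.
Qed.

Lemma measurable_normc D f : cmeasurable D f ->
  measurable_fun D (fun x => Normc.normc (f x)).
Proof.
move=> mf.
have -> : (fun x => Normc.normc (f x)) =
    (fun x => Num.sqrt (Normc.normc (f x) ^+ 2)).
  by apply/funext => x; rewrite sqrtr_sqr ger0_norm ?normc_ge0.
apply: measurableT_comp (measurable_normc_sqr mf).
by apply: continuous_measurable_fun; exact: sqrt_continuous.
Qed.

Definition cintegrable D f :=
  mu.-integrable D (EFin \o (fun x => complex.Re (f x))) /\
  mu.-integrable D (EFin \o (fun x => complex.Im (f x))).

Definition cint D f : R[i] :=
  (Rintegral mu D (fun x => complex.Re (f x)) +i*
   Rintegral mu D (fun x => complex.Im (f x)))%C.

Lemma cintegrable_measurable D f : cintegrable D f -> cmeasurable D f.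
Proof.
by move=> [f1 f2]; split; apply/measurable_EFinP; apply: measurable_int;
  eassumption.
Qed.

Lemma cintegrable_le D f (h : T -> R) : measurable D -> cmeasurable D f ->
  mu.-integrable D (EFin \o h) -> (forall x, D x -> Normc.normc (f x) <= h x) ->
  cintegrable D f.
Proof.
move=> mD [f1 f2] ih fh; split.
  apply: (le_integrable mD _ _ ih); first exact/measurable_EFinP.
  move=> x Dx /=; rewrite lee_fin (le_trans (normc_Re _))//.
  by rewrite (le_trans (fh _ Dx))// ler_norm.
apply: (le_integrable mD _ _ ih); first exact/measurable_EFinP.
move=> x Dx /=; rewrite lee_fin (le_trans (normc_Im _))//.
by rewrite (le_trans (fh _ Dx))// ler_norm.
Qed.

Lemma cintegrable_normc D f : measurable D -> cintegrable D f ->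
  mu.-integrable D (EFin \o (fun x => Normc.normc (f x))).
Proof.
move=> mD cf; have [f1 f2] := cf.
apply: (le_integrable mD _ _ (integrableD mD (integrable_norm f1)
  (integrable_norm f2))).
  by apply/measurable_EFinP/measurable_normc/cintegrable_measurable.
move=> x Dx /=; rewrite lee_fin ger0_norm ?normc_ge0//.
by rewrite ger0_norm ?addr_ge0// normc_ReIm.
Qed.

Lemma cintegrableD D f g : measurable D -> cintegrable D f ->
  cintegrable D g -> cintegrable D (fun x => f x + g x).
Proof.
move=> mD [f1 f2] [g1 g2]; split.
  apply: eq_integrable (integrableD mD f1 g1) => //.
  by move=> x _; rewrite /= ReD.
apply: eq_integrable (integrableD mD f2 g2) => //.
by move=> x _; rewrite /= ImD.
Qed.

Lemma cintegrableZ D (c : R[i]) f : measurable D -> cintegrable D f ->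
  cintegrable D (fun x => c * f x).
Proof.
move=> mD cf; apply: (@cintegrable_le _ _
  (fun x => Normc.normc c * Normc.normc (f x))) => //.
- exact/cmeasurableZ/cintegrable_measurable.
- apply: eq_integrable (integrableZl mD (Normc.normc c)
    (cintegrable_normc mD cf)) => //.
- by move=> x _; rewrite Normc.normcM.
Qed.

Lemma eq_cintegrable D f g : measurable D -> (forall x, D x -> f x = g x) ->
  cintegrable D f -> cintegrable D g.
Proof.
by move=> mD fg [f1 f2]; split; [apply: eq_integrable f1|
  apply: eq_integrable f2] => // x /set_mem/fg /= ->.
Qed.

Lemma cintegrable_sum D (I : Type) (r : seq I) (u : I -> T -> R[i]) :
  measurable D -> (forall i, cintegrable D (u i)) ->
  cintegrable D (fun x => \sum_(i <- r) u i x).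
Proof.
move=> mD iu; elim: r => [|i r ih].
  apply: (@eq_cintegrable D (fun=> 0)) => //; first by move=> x _; rewrite big_nil.
  by split; apply: eq_integrable (integrable0 _ _).
apply: (eq_cintegrable mD _ (cintegrableD mD (iu i) ih)) => x _.
by rewrite big_cons.
Qed.

Lemma eq_cint D f g : (forall x, D x -> f x = g x) -> cint D f = cint D g.
Proof.
by move=> fg; apply: complex_eq; apply: eq_Rintegral => x /set_mem/fg ->.
Qed.

Lemma cintD D f g : measurable D -> cintegrable D f -> cintegrable D g ->
  cint D (fun x => f x + g x) = cint D f + cint D g.
Proof.
move=> mD [f1 f2] [g1 g2]; apply: complex_eq => /=.
  by rewrite ?ReD -RintegralD//; apply: eq_Rintegral => x _; rewrite ReD.
by rewrite ?ImD -RintegralD//; apply: eq_Rintegral => x _; rewrite ImD.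
Qed.

Lemma cintZ D (c : R[i]) f : measurable D -> cintegrable D f ->
  cint D (fun x => c * f x) = c * cint D f.
Proof.
move=> mD [f1 f2]; apply: complex_eq => /=; rewrite ?ReM ?ImM /=.
  rewrite -!RintegralZl// -RintegralB//.
  - by apply: eq_Rintegral => x _; rewrite ReM.
  - exact: (integrableZl mD (complex.Re c) f1).
  - exact: (integrableZl mD (complex.Im c) f2).
rewrite -!RintegralZl// -RintegralD//.
- by apply: eq_Rintegral => x _; rewrite ImM.
- exact: (integrableZl mD (complex.Re c) f2).
- exact: (integrableZl mD (complex.Im c) f1).
Qed.

Lemma cintJ D f : measurable D -> cintegrable D f ->
  cint D (fun x => conjc (f x)) = conjc (cint D f).
Proof.
move=> mD [f1 f2]; apply: complex_eq; rewrite ?ReJ ?ImJ /=.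
  by apply: eq_Rintegral => x _; rewrite ReJ.
rewrite -mulN1r -RintegralZl//.
by apply: eq_Rintegral => x _; rewrite ImJ mulN1r.
Qed.

Lemma cintegrableJ D f : measurable D -> cintegrable D f ->
  cintegrable D (fun x => conjc (f x)).
Proof.
move=> mD cf; apply: (cintegrable_le mD _ (cintegrable_normc mD cf)).
  exact: cmeasurableJ (cintegrable_measurable cf).
by move=> x _; rewrite normcJ.
Qed.

Lemma cint_sum D (I : Type) (r : seq I) (u : I -> T -> R[i]) :
  measurable D -> (forall i, cintegrable D (u i)) ->
  cint D (fun x => \sum_(i <- r) u i x) = \sum_(i <- r) cint D (u i).
Proof.
move=> mD iu; elim: r => [|i r ih].
  rewrite big_nil; apply: complex_eq => /=.
    by rewrite (@eq_Rintegral _ _ _ _ _ (cst 0)) ?Rintegral_cst ?mul0r// => x _;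
      rewrite big_nil.
  by rewrite (@eq_Rintegral _ _ _ _ _ (cst 0)) ?Rintegral_cst ?mul0r// => x _;
    rewrite big_nil.
rewrite big_cons -ih -cintD//; last exact: cintegrable_sum.
by apply: eq_cint => x _; rewrite big_cons.
Qed.

End ComplexIntegral.

(** * Square-integrable functions *)

Section L2space.
Context d (T : measurableType d) (R : realType).
Variables (mu : {measure set T -> \bar R}) (D : set T).
Hypothesis mD : measurable D.
Implicit Types (f g h k : T -> R[i]) (c : R[i]).

(** Square integrability is set up over an arbitrary measure and domain,
    since both the half line and a rectangle in the plane are needed. On the
    real line [gsq], [gL2] and [gip] are convertible to [sqnorm], [inL2] and
    [inner]. *)
Definition gsq f : \bar R :=
  (\int[mu]_(x in D) ((Normc.normc (f x) ^+ 2)%:E))%E.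

Definition gL2 f := cmeasurable D f /\ (gsq f < +oo)%E.

Definition gip f g : R[i] := cint mu D (fun x => f x * conjc (g x)).

Definition sqn f : R := fine (gsq f).

Lemma gsq_ge0 f : (0 <= gsq f)%E.
Proof. by apply: integral_ge0 => x _; rewrite lee_fin sqr_ge0. Qed.

Lemma sqn_ge0 f : 0 <= sqn f.
Proof. exact/fine_ge0/gsq_ge0. Qed.

Lemma gsqE f : gL2 f -> gsq f = (sqn f)%:E.
Proof. by case=> _ fo; rewrite fineK// ge0_fin_numE ?gsq_ge0. Qed.

Lemma gL2_integrable f : gL2 f ->
  mu.-integrable D (EFin \o (fun x => Normc.normc (f x) ^+ 2)).
Proof.
move=> [mf fo]; apply/integrableP; split.
  exact/measurable_EFinP/measurable_normc_sqr.
rewrite (le_lt_trans _ fo)// le_eqVlt; apply/orP; left; apply/eqP.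
by apply: eq_integral => x _ /=; rewrite ger0_norm ?sqr_ge0.
Qed.

Lemma gL2_le f (h : T -> R) : cmeasurable D f ->
  mu.-integrable D (EFin \o h) ->
  (forall x, D x -> Normc.normc (f x) ^+ 2 <= h x) -> gL2 f.
Proof.
move=> mf /integrableP[mh hoo] fh; split => //.
apply: le_lt_trans hoo; apply: ge0_le_integral => //.
- by move=> x _; rewrite lee_fin sqr_ge0.
- exact/measurable_EFinP/measurable_normc_sqr.
- exact: measurableT_comp.
- by move=> x Dx /=; rewrite lee_fin (le_trans (fh _ Dx))// ler_norm.
Qed.

Lemma eq_gsq f g : (forall x, D x -> f x = g x) -> gsq f = gsq g.
Proof. by move=> fg; apply: eq_integral => x /set_mem/fg ->. Qed.

Lemma eq_gL2 f g : (forall x, D x -> f x = g x) -> gL2 f -> gL2 g.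
Proof.
by move=> fg [mf fo]; split; [exact: eq_cmeasurable mf|rewrite -(eq_gsq fg)].
Qed.

Lemma eq_gip f g f' g' : (forall x, D x -> f x = f' x) ->
  (forall x, D x -> g x = g' x) -> gip f g = gip f' g'.
Proof. by move=> ff gg; apply: eq_cint => x Dx; rewrite ff ?gg. Qed.

Lemma gL2D f g : gL2 f -> gL2 g -> gL2 (fun x => f x + g x).
Proof.
move=> Lf Lg; apply: (@gL2_le _ (fun x =>
  2 * Normc.normc (f x) ^+ 2 + 2 * Normc.normc (g x) ^+ 2)).
- exact: cmeasurableD Lf.1 Lg.1.
- exact: (integrableD mD (integrableZl mD 2 (gL2_integrable Lf))
    (integrableZl mD 2 (gL2_integrable Lg))).
- by move=> x _; exact: normc_sqrD.
Qed.

Lemma gL2M (b : T -> R[i]) (K : R) f : cmeasurable D b ->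
  (forall x, D x -> Normc.normc (b x) ^+ 2 <= K) -> gL2 f ->
  gL2 (fun x => b x * f x).
Proof.
move=> mb bK Lf; apply: (@gL2_le _ (fun x => K * Normc.normc (f x) ^+ 2)).
- exact: cmeasurableM mb Lf.1.
- exact: (integrableZl mD K (gL2_integrable Lf)).
- by move=> x Dx; rewrite Normc.normcM exprMn ler_wpM2r ?sqr_ge0// bK.
Qed.

Lemma gL2Z c f : gL2 f -> gL2 (fun x => c * f x).
Proof. by apply: gL2M => //; exact: cmeasurable_cst. Qed.

Lemma gL2_0 : gL2 (fun=> 0).
Proof.
split; first exact: cmeasurable_cst.
by rewrite /gsq integral0_eq// => x _; rewrite Normc.normc0 expr0n.
Qed.

Lemma gL2B f g : gL2 f -> gL2 g -> gL2 (fun x => f x - g x).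
Proof.
move=> Lf Lg; have := gL2D Lf (gL2Z (- 1) Lg).
by apply: eq_gL2 => x _; rewrite mulN1r.
Qed.

Lemma gL2_sum (I : Type) (r : seq I) (u : I -> T -> R[i]) :
  (forall i, gL2 (u i)) -> gL2 (fun x => \sum_(i <- r) u i x).
Proof.
move=> Lu; elim: r => [|i r ih].
  by apply: eq_gL2 gL2_0 => x _; rewrite big_nil.
by apply: eq_gL2 (gL2D (Lu i) ih) => x _; rewrite big_cons.
Qed.

Lemma cintegrable_mulJ f g : gL2 f -> gL2 g ->
  cintegrable mu D (fun x => f x * conjc (g x)).
Proof.
move=> Lf Lg; apply: (@cintegrable_le _ _ _ _ _ _ (fun x =>
  Normc.normc (f x) ^+ 2 + Normc.normc (g x) ^+ 2)) => //.
- exact: cmeasurableM Lf.1 (cmeasurableJ Lg.1).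
- exact: (integrableD mD (gL2_integrable Lf) (gL2_integrable Lg)).
- by move=> x _; rewrite (le_trans (normc_mul_le _ _))// normcJ.
Qed.

Lemma gipDl f g k : gL2 f -> gL2 g -> gL2 k ->
  gip (fun x => f x + g x) k = gip f k + gip g k.
Proof.
move=> Lf Lg Lk; rewrite /gip -cintD//; last 2 first.
- exact: cintegrable_mulJ.
- exact: cintegrable_mulJ.
by apply: eq_cint => x _; rewrite mulrDl.
Qed.

Lemma gipZl c f k : gL2 f -> gL2 k ->
  gip (fun x => c * f x) k = c * gip f k.
Proof.
move=> Lf Lk; rewrite /gip -cintZ//; last exact: cintegrable_mulJ.
by apply: eq_cint => x _; rewrite mulrA.
Qed.

Lemma gipJ f g : gL2 f -> gL2 g -> gip g f = conjc (gip f g).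
Proof.
move=> Lf Lg; rewrite /gip -cintJ//; last exact: cintegrable_mulJ.
by apply: eq_cint => x _; rewrite conjcM conjcK mulrC.
Qed.

Lemma gipDr f g k : gL2 f -> gL2 g -> gL2 k ->
  gip k (fun x => f x + g x) = gip k f + gip k g.
Proof.
move=> Lf Lg Lk; rewrite (gipJ (gL2D Lf Lg) Lk) gipDl// conjcD.
by rewrite -!gipJ.
Qed.

Lemma gipZr c f k : gL2 f -> gL2 k ->
  gip k (fun x => c * f x) = conjc c * gip k f.
Proof.
by move=> Lf Lk; rewrite (gipJ (gL2Z c Lf) Lk) gipZl// conjcM -gipJ.
Qed.

Lemma gipBl f g k : gL2 f -> gL2 g -> gL2 k ->
  gip (fun x => f x - g x) k = gip f k - gip g k.
Proof.
move=> Lf Lg Lk; rewrite -mulN1r -gipZl// -gipDl//; last exact: gL2Z.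
by apply: eq_gip => x _; rewrite ?mulN1r.
Qed.

Lemma gipBr f g k : gL2 f -> gL2 g -> gL2 k ->
  gip k (fun x => f x - g x) = gip k f - gip k g.
Proof.
move=> Lf Lg Lk; rewrite (gipJ (gL2B Lf Lg) Lk) gipBl// conjcD conjcN.
by rewrite -!gipJ.
Qed.

Lemma gip_suml (I : Type) (r : seq I) (u : I -> T -> R[i]) k :
  (forall i, gL2 (u i)) -> gL2 k ->
  gip (fun x => \sum_(i <- r) u i x) k = \sum_(i <- r) gip (u i) k.
Proof.
move=> Lu Lk; rewrite /gip -cint_sum//.
  by apply: eq_cint => x _; rewrite mulr_suml.
by move=> i; exact: cintegrable_mulJ.
Qed.

Lemma gip_sqn f : gL2 f -> gip f f = (sqn f)%:C%C.
Proof.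
move=> Lf; apply: complex_eq => /=.
  rewrite /sqn/Rintegral; congr fine; apply: eq_integral => x _.
  by rewrite mulJ_normc.
rewrite (@eq_Rintegral _ _ _ _ _ (cst 0)) ?Rintegral_cst ?mul0r// => x _.
by rewrite mulJ_normc.
Qed.

Lemma sqnZ c f : gL2 f -> sqn (fun x => c * f x) = Normc.normc c ^+ 2 * sqn f.
Proof.
move=> Lf; apply: complexI; rewrite rmorphM/= -!gip_sqn//; last exact: gL2Z.
by rewrite gipZl// ?gipZr// ?mulrA ?mulJ_normc//; exact: gL2Z.
Qed.

Lemma sqnD f g : gL2 f -> gL2 g ->
  sqn (fun x => f x + g x) = sqn f + sqn g + 2 * complex.Re (gip f g).
Proof.
move=> Lf Lg; have LD := gL2D Lf Lg.
have := gip_sqn LD; rewrite gipDl// !gipDr// !gip_sqn// (gipJ Lf Lg).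
by case: (gip f g) => u v /(congr1 (@complex.Re R)) /= <-; ring.
Qed.

Lemma sqnB f g : gL2 f -> gL2 g ->
  sqn (fun x => f x - g x) = sqn f + sqn g - 2 * complex.Re (gip f g).
Proof.
move=> Lf Lg; have LB := gL2B Lf Lg.
have := gip_sqn LB; rewrite gipBl// !gipBr// !gip_sqn// (gipJ Lf Lg).
by case: (gip f g) => u v /(congr1 (@complex.Re R)) /= <-; ring.
Qed.

(** The function f - t <f, g> g has nonnegative squared norm for every real
    t; the discriminant of this quadratic is the inequality, up to a factor
    that cancels unless <f, g> vanishes. *)
Lemma gip_cauchy_schwarz f g : gL2 f -> gL2 g ->
  Normc.normc (gip f g) ^+ 2 <= sqn f * sqn g.
Proof.
move=> Lf Lg; set p := Normc.normc (gip f g) ^+ 2.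
have p0 : 0 <= p by exact: sqr_ge0.
suff : p ^+ 2 <= sqn f * (p * sqn g).
  have [->|pn0] := eqVneq p 0; first by rewrite mulr_ge0 ?sqn_ge0.
  by rewrite mulrCA expr2 ler_pM2l// lt_neqAle eq_sym pn0.
apply: discr_le; first by rewrite mulr_ge0 ?sqn_ge0.
move=> t; set c := t%:C%C * gip f g.
have := sqn_ge0 (fun x => f x - c * g x).
rewrite sqnB//; last exact: gL2Z.
rewrite sqnZ// gipZr// Normc.normcM normcR exprMn -/p real_normK ?num_real//.
rewrite conjcM conjcR -mulrA (mulrC (conjc _)) mulJ_normc -/p !cE /= mul0r subr0.
by move=> h; apply: le_trans h _; rewrite le_eqVlt; apply/orP; left; apply/eqP; ring.
Qed.

Lemma sqnD_le f g : gL2 f -> gL2 g ->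
  sqn (fun x => f x + g x) <= 2 * sqn f + 2 * sqn g.
Proof.
move=> Lf Lg; have := sqn_ge0 (fun x => f x - g x).
by rewrite sqnB// sqnD//; lra.
Qed.

Lemma eq_sqn f g : (forall x, D x -> f x = g x) -> sqn f = sqn g.
Proof. by move=> fg; rewrite /sqn (eq_gsq fg). Qed.

End L2space.

Section NetLimit.
Context {R : realType} {I : choiceType}.
Implicit Types (u v : {fset I} -> R[i]) (s t : R[i]).

(** Limits along the directed set of finite subsets; with [u] the finite
    partial sums of a family this is unconditional summation. *)
Definition nlim u s := forall e : R, 0 < e ->
  exists F0 : {fset I}, forall F : {fset I}, (F0 `<=` F)%fset ->
    Normc.normc (s - u F) < e.

Lemma nlim_cst s : nlim (fun=> s) s.
Proof.
by move=> e e0; exists fset0 => F _; rewrite subrr Normc.normc0.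
Qed.

Lemma eq_nlim u v s : (forall F, u F = v F) -> nlim u s -> nlim v s.
Proof. by move=> uv us e /us[F0 h]; exists F0 => F /h; rewrite uv. Qed.

Lemma nlimD u v s t : nlim u s -> nlim v t ->
  nlim (fun F => u F + v F) (s + t).
Proof.
move=> us vt e e0; have e2 : 0 < e / 2 by rewrite divr_gt0.
have [F h] := us _ e2; have [G h'] := vt _ e2; exists (F `|` G)%fset => H FGH.
rewrite opprD addrACA (le_lt_trans (normcD_le _ _))// [e]splitr ltrD//.
  by apply: h; apply: fsubset_trans FGH; exact: fsubsetUl.
by apply: h'; apply: fsubset_trans FGH; exact: fsubsetUr.
Qed.

Lemma nlimZ c u s : nlim u s -> nlim (fun F => c * u F) (c * s).
Proof.
move=> us e e0; have c0 : 0 < Normc.normc c + 1 by rewrite ltr_wpDl ?normc_ge0.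
have [F h] := us _ (divr_gt0 e0 c0); exists F => G /h; rewrite ltr_pdivlMr//.
rewrite -mulrBr Normc.normcM => h'; apply: le_lt_trans h'.
by rewrite mulrDr mulr1 mulrC lerDl normc_ge0.
Qed.

Lemma nlim_norm_le u s (B : R) (F0 : {fset I}) :
  (forall F : {fset I}, (F0 `<=` F)%fset -> Normc.normc (u F) <= B) ->
  nlim u s -> Normc.normc s <= B.
Proof.
move=> uB us; apply/ler_addgt0Pr => e /us[F h].
rewrite -[s](subrK (u (F0 `|` F)%fset)) addrC.
rewrite (le_trans (normcD_le _ _))// lerD//; first exact/uB/fsubsetUl.
exact/ltW/h/fsubsetUr.
Qed.

Lemma nlim_unique u s t : nlim u s -> nlim u t -> s = t.
Proof.
move=> us ut; apply/eqP; rewrite -subr_eq0; apply/eqP/normc_eq0P/le_anti.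
rewrite normc_ge0 andbT.
have := nlimD us (nlimZ (-1) ut); rewrite mulN1r.
by apply: (@nlim_norm_le _ _ _ fset0) => F _; rewrite mulN1r subrr Normc.normc0.
Qed.

End NetLimit.

Section Duality.
Context d (T : measurableType d) (R : realType).
Variables (mu : {measure set T -> \bar R}) (D : set T).
Hypothesis mD : measurable D.
Implicit Types (f g h k : T -> R[i]) (c : R[i]).
Local Notation L2 := (gL2 mu D).
Local Notation ip := (gip mu D).
Local Notation N := (sqn mu D).

(** The last clause is closedness under mean-square limits; applied to a
    constant sequence it also makes membership insensitive to changes on a
    null set or off the domain. *)
Definition closed_subspace (V : (T -> R[i]) -> Prop) :=
  [/\ forall f g, V f -> V g -> V (fun x => f x + g x),
      forall c f, V f -> V (fun x => c * f x) &
      forall f, L2 f ->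
        (forall e : R, 0 < e -> exists g, [/\ V g, L2 g &
           N (fun x => f x - g x) < e]) -> V f].

(** Density of the linear span, phrased as the extension principle in which
    it is used: a closed condition that holds on the family holds on all of
    L^2. *)
Definition total_family {J : Type} (b : J -> T -> R[i]) :=
  forall V, closed_subspace V -> (forall j, V (b j)) -> forall f, L2 f -> V f.

(** Over finite subsets only, so that no summability is presupposed. *)
Definition bessel_bound {I : choiceType} (C : R) (g : I -> T -> R[i]) :=
  forall (F : {fset I}) f, L2 f ->
    \sum_(i <- F) Normc.normc (ip f (g i)) ^+ 2 <= C * N f.

Section Frames.
Context {I : choiceType} (g h : I -> T -> R[i]) (Cg Ch : R).
Hypotheses (Lg : forall i, L2 (g i)) (Lh : forall i, L2 (h i)).
Hypotheses (Bg : bessel_bound Cg g) (Bh : bessel_bound Ch h).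
Hypotheses (Cg0 : 0 <= Cg) (Ch0 : 0 <= Ch).

Definition frame_sum f k (F : {fset I}) : R[i] :=
  \sum_(i <- F) ip f (h i) * ip (g i) k.

Lemma frame_sumE f k F : L2 f -> L2 k ->
  frame_sum f k F = ip (fun x => \sum_(i <- F) ip f (h i) * g i x) k.
Proof.
move=> Lf Lk; rewrite gip_suml//; last by move=> i; exact: gL2Z.
by apply: eq_bigr => i _; rewrite gipZl.
Qed.

Lemma frame_sum_le f k F : L2 f -> L2 k ->
  Normc.normc (frame_sum f k F) ^+ 2 <=
  (\sum_(i <- F) Normc.normc (ip f (h i)) ^+ 2) * (Cg * N k).
Proof.
move=> Lf Lk; rewrite (le_trans (sum_cauchy_schwarz _ _ _))//.
rewrite ler_wpM2l//; first by apply: sumr_ge0 => i _; exact: sqr_ge0.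
apply: le_trans (Bg F Lk).
by apply: ler_sum => i _; rewrite (gipJ mD Lk (Lg i)) normcJ.
Qed.

Lemma frame_sum_bound f k F : L2 f -> L2 k ->
  Normc.normc (frame_sum f k F) ^+ 2 <= (Ch * N f) * (Cg * N k).
Proof.
move=> Lf Lk; apply: le_trans (frame_sum_le F Lf Lk) _.
by rewrite ler_wpM2r ?Bh// mulr_ge0// sqn_ge0.
Qed.

(** The reconstruction of [f] from the coefficients along [h], tested
    against a single [k]. *)
Definition weak_identity f k := nlim (frame_sum f k) (ip f k).

Lemma weak_identityDl f f' k : L2 f -> L2 f' -> L2 k ->
  weak_identity f k -> weak_identity f' k ->
  weak_identity (fun x => f x + f' x) k.
Proof.
move=> Lf Lf' Lk w w'; rewrite /weak_identity gipDl//.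
apply: eq_nlim (nlimD w w') => F; rewrite -big_split /=.
by apply: eq_bigr => i _; rewrite gipDl// mulrDl.
Qed.

Lemma weak_identityZl c f k : L2 f -> L2 k ->
  weak_identity f k -> weak_identity (fun x => c * f x) k.
Proof.
move=> Lf Lk w; rewrite /weak_identity gipZl//.
apply: eq_nlim (nlimZ c w) => F; rewrite mulr_sumr.
by apply: eq_bigr => i _; rewrite gipZl// mulrA.
Qed.

Lemma weak_identityDr f k k' : L2 f -> L2 k -> L2 k' ->
  weak_identity f k -> weak_identity f k' ->
  weak_identity f (fun x => k x + k' x).
Proof.
move=> Lf Lk Lk' w w'; rewrite /weak_identity gipDr//.
apply: eq_nlim (nlimD w w') => F; rewrite -big_split /=.
by apply: eq_bigr => i _; rewrite gipDr// mulrDr.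
Qed.

Lemma weak_identityZr c f k : L2 f -> L2 k ->
  weak_identity f k -> weak_identity f (fun x => c * k x).
Proof.
move=> Lf Lk w; rewrite /weak_identity gipZr//.
apply: eq_nlim (nlimZ (conjc c) w) => F; rewrite mulr_sumr.
by apply: eq_bigr => i _; rewrite gipZr// mulrCA.
Qed.

(** Both sides of the identity are bounded sesquilinear forms: the left one
    uniformly over finite partial sums, thanks to the two Bessel bounds, so the
    identity survives limits in either argument. *)
Lemma weak_identity_small f k : L2 f -> L2 k -> forall e : R, 0 < e ->
  N f * N k < e ^+ 2 / (1 + (Ch * Cg)) ->
  (forall F, Normc.normc (frame_sum f k F) < e) /\ Normc.normc (ip f k) < e.
Proof.
move=> Lf Lk e e0; have CC : 0 <= Ch * Cg by rewrite mulr_ge0.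
have C1 : 0 < 1 + Ch * Cg by rewrite ltr_pwDl.
rewrite ltr_pdivlMr// => h0.
have NN : 0 <= N f * N k by rewrite mulr_ge0 ?sqn_ge0.
split=> [F|]; rewrite -ltr_sqr ?nnegrE ?normc_ge0 ?(ltW e0)//.
  apply: le_lt_trans (frame_sum_bound F Lf Lk) _; apply: le_lt_trans h0.
  by rewrite mulrACA [Ch * _ * _]mulrC ler_wpM2l// lerDr.
apply: le_lt_trans (gip_cauchy_schwarz mD Lf Lk) _; apply: le_lt_trans h0.
by rewrite ler_peMr// lerDl.
Qed.

Lemma weak_identity_closel f k : L2 f -> L2 k ->
  (forall e, 0 < e -> exists f', [/\ weak_identity f' k, L2 f' &
     N (fun x => f x - f' x) < e]) -> weak_identity f k.
Proof.
move=> Lf Lk H e e0; have e3 : 0 < e / 3 by rewrite divr_gt0.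
set A := (e / 3) ^+ 2 / (1 + Ch * Cg).
have A0 : 0 < A by rewrite divr_gt0 ?exprn_gt0// ltr_pwDl// mulr_ge0.
have K0 : 0 < 1 + N k by rewrite ltr_pwDl// sqn_ge0.
have [f' [w' Lf' ff']] := H _ (divr_gt0 A0 K0).
have [F0 hF] := w' _ e3; exists F0 => F /hF w.
set r := fun x => f x - f' x in ff'.
have Lr : L2 r by exact: gL2B.
have rk : N r * N k < A.
  move: ff'; rewrite ltr_pdivlMr//; apply: le_lt_trans.
  by rewrite ler_wpM2l ?sqn_ge0// lerDr.
have [s1 s2] := weak_identity_small Lr Lk e3 rk.
have E1 : ip f k = ip r k + ip f' k by rewrite /r gipBl// subrK.
have E2 : frame_sum f k F = frame_sum r k F + frame_sum f' k F.
  rewrite /frame_sum -big_split /=; apply: eq_bigr => i _.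
  by rewrite /r gipBl// -mulrDl subrK.
rewrite E1 E2 opprD addrACA (le_lt_trans (normcD_le _ _))//.
have -> : e = (e / 3 + e / 3) + e / 3 by field.
rewrite ltrD//; apply: le_lt_trans (normcD_le _ _) _.
by rewrite ltrD// normcNE.
Qed.

Lemma weak_identity_closer f k : L2 f -> L2 k ->
  (forall e, 0 < e -> exists k', [/\ weak_identity f k', L2 k' &
     N (fun x => k x - k' x) < e]) -> weak_identity f k.
Proof.
move=> Lf Lk H e e0; have e3 : 0 < e / 3 by rewrite divr_gt0.
set A := (e / 3) ^+ 2 / (1 + Ch * Cg).
have A0 : 0 < A by rewrite divr_gt0 ?exprn_gt0// ltr_pwDl// mulr_ge0.
have K0 : 0 < 1 + N f by rewrite ltr_pwDl// sqn_ge0.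
have [k' [w' Lk' kk']] := H _ (divr_gt0 A0 K0).
have [F0 hF] := w' _ e3; exists F0 => F /hF w.
set r := fun x => k x - k' x in kk'.
have Lr : L2 r by exact: gL2B.
have rk : N f * N r < A.
  move: kk'; rewrite ltr_pdivlMr// mulrC; apply: le_lt_trans.
  by rewrite ler_wpM2r ?sqn_ge0// lerDr.
have [s1 s2] := weak_identity_small Lf Lr e3 rk.
have E1 : ip f k = ip f r + ip f k' by rewrite /r gipBr// subrK.
have E2 : frame_sum f k F = frame_sum f r F + frame_sum f k' F.
  rewrite /frame_sum -big_split /=; apply: eq_bigr => i _.
  by rewrite /r gipBr// -mulrDr subrK.
rewrite E1 E2 opprD addrACA (le_lt_trans (normcD_le _ _))//.
have -> : e = (e / 3 + e / 3) + e / 3 by field.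
rewrite ltrD//; apply: le_lt_trans (normcD_le _ _) _.
by rewrite ltrD// normcNE.
Qed.

(** Extension in two steps, first in the right argument with the left one in
    the family, then in the left argument. *)
Lemma weak_identity_total {J : Type} (b : J -> T -> R[i]) :
  (forall j, L2 (b j)) -> total_family b ->
  (forall p q, weak_identity (b p) (b q)) ->
  forall f k, L2 f -> L2 k -> weak_identity f k.
Proof.
move=> Lb tb wb.
have step f : L2 f -> (forall q, weak_identity f (b q)) ->
    forall k, L2 k -> weak_identity f k.
  move=> Lf wf k Lk.
  suff : L2 k /\ weak_identity f k by case.
  apply: (tb (fun k => L2 k /\ weak_identity f k)) => //; split.
  - move=> k1 k2 [? ?] [? ?]; split; first exact: gL2D.
    exact: weak_identityDr.
  - by move=> c k1 [? ?]; split; [exact: gL2Z|exact: weak_identityZr].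
  - move=> k1 Lk1 H; split => //; apply: weak_identity_closer => // e /H.
    by move=> [k' [[? ?] ? ?]]; exists k'.
move=> f k Lf Lk; apply: step => // q.
suff : L2 f /\ weak_identity f (b q) by case.
apply: (tb (fun f => L2 f /\ weak_identity f (b q))) => //; split.
- move=> k1 k2 [? ?] [? ?]; split; first exact: gL2D.
  exact: weak_identityDl.
- by move=> c k1 [? ?]; split; [exact: gL2Z|exact: weak_identityZl].
- move=> k1 Lk1 H; split => //; apply: weak_identity_closel => // e /H.
  by move=> [k' [[? ?] ? ?]]; exists k'.
Qed.

End Frames.
End Duality.

(** * Dual frames from the weak identity *)

Section FiniteSets.
Context {R : realType} {I : choiceType}.

Lemma fset_sum_split (V : nmodType) (u : I -> V) (F G : {fset I}) :
  (F `<=` G)%fset ->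
  \sum_(i <- G) u i = \sum_(i <- F) u i + \sum_(i <- (G `\` F)%fset) u i.
Proof.
move=> FG; rewrite (bigID (fun i => i \in F)) /=; congr (_ + _);
  rewrite -big_filter; apply: perm_big; apply: uniq_perm => //;
  rewrite ?filter_uniq// => i; rewrite mem_filter ?inE//.
by case: (boolP (i \in F)) => //= /(fsubsetP FG) ->.
Qed.

Lemma esum_fset_ge (u : I -> R) (F : {fset I}) :
  ((\sum_(i <- F) u i)%:E <= \esum_(i in [set: I]) (u i)%:E)%E.
Proof.
apply: esum_ge; exists [set` F]; first by split.
by rewrite fsbig_finite//= set_fsetK sumEFin.
Qed.

Lemma esum_le_fset (u : I -> R) (B : \bar R) :
  (forall F : {fset I}, ((\sum_(i <- F) u i)%:E <= B)%E) ->
  (\esum_(i in [set: I]) (u i)%:E <= B)%E.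
Proof.
move=> uB; apply: ge_ereal_sup => _ [X [finX _] <-].
by rewrite fsbig_finite//= sumEFin.
Qed.

Lemma esum_adherent (u : I -> R) (E e : R) : 0 < e ->
  (\esum_(i in [set: I]) (u i)%:E)%E = E%:E ->
  exists F : {fset I}, E - e < \sum_(i <- F) u i.
Proof.
move=> e0 uE.
have [|_ [X [finX _] <-]] := @ub_ereal_sup_adherent R
  [set \sum_(x \in A) (u x)%:E | A in fsets [set: I]]%E e e0.
  by rewrite -/(esum _ _) uE.
rewrite -/(esum _ _) uE fsbig_finite//= sumEFin -EFinB lte_fin => h.
by exists (fset_set X).
Qed.

End FiniteSets.

Section DualFrames.
Context {R : realType} {I : choiceType}.
Implicit Types (f k : R -> R[i]) (g h : I -> R -> R[i]).
Local Notation L2 := (@gL2 _ _ R lebesgue_measure Rplus).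
Local Notation ip := (@gip _ _ R lebesgue_measure Rplus).
Local Notation N := (@sqn _ _ R lebesgue_measure Rplus).
Local Notation bessel := (@bessel_bound _ _ R lebesgue_measure Rplus).

Lemma mRplus : measurable (@Rplus R : set (measurableTypeR R)).
Proof. exact: measurable_itv. Qed.

Lemma is_bessel_bound g : is_bessel g -> exists2 C, 0 <= C & bessel C g.
Proof.
move=> [C HC]; exists (Num.max C 0); first by rewrite le_max lexx orbT.
move=> F f Lf; rewrite -lee_fin.
apply: le_trans (esum_fset_ge _ F) _; apply: le_trans (HC f Lf) _.
have -> : sqnorm Rplus f = (N f)%:E by exact: gsqE.
by rewrite -EFinM lee_fin ler_wpM2r ?sqn_ge0// le_max lexx.
Qed.

Lemma coef_energyE g C f : bessel C g -> L2 f ->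
  exists2 E : R, coef_energy g f = E%:E & E <= C * N f.
Proof.
move=> Bg Lf.
have le : (coef_energy g f <= (C * N f)%:E)%E.
  by apply: esum_le_fset => F; rewrite lee_fin; exact: Bg.
have ge : (0 <= coef_energy g f)%E.
  by apply: esum_ge0 => i _; rewrite lee_fin sqr_ge0.
move: le ge; case: (coef_energy g f) => [E|//|//]; rewrite !lee_fin => le _.
by exists E.
Qed.

(** Inner products with a fixed [k] are continuous in mean square. *)
Lemma weak_identity_of_L2_sum g h : (forall i, L2 (g i)) ->
  (forall f, inL2 Rplus f -> L2_sum Rplus (fun i x => inner f (h i) * g i x) f) ->
  forall f k, L2 f -> L2 k -> weak_identity lebesgue_measure Rplus g h f k.
Proof.
move=> Lg H f k Lf Lk e e0; have K0 : 0 < 1 + N k by rewrite ltr_pwDl// sqn_ge0.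
have [F0 hF] := H f Lf _ (divr_gt0 e0 K0); exists F0 => F /hF {hF}.
set r := (fun x => f x - _).
have LS : L2 (fun x => \sum_(i <- F) inner f (h i) * g i x).
  by apply: gL2_sum => [|i]; [exact: mRplus|apply: gL2Z; [exact: mRplus|]].
have Lr : L2 r by apply: gL2B => //; exact: mRplus.
have -> : sqnorm Rplus r = (N r)%:E by exact: gsqE.
rewrite lte_fin => Nr; rewrite frame_sumE//; last exact: mRplus.
rewrite -gipBl//; last exact: mRplus.
rewrite -/r -ltr_sqr ?nnegrE ?normc_ge0 ?(ltW e0)//.
have CS := gip_cauchy_schwarz mRplus Lr Lk; apply: le_lt_trans CS _.
apply: (@le_lt_trans _ _ (N r * (1 + N k))).
  by rewrite ler_wpM2l ?sqn_ge0// lerDr.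
move: Nr; rewrite expr_div_n ltr_pdivlMr ?exprn_gt0//; apply: le_lt_trans.
by rewrite ler_wpM2l ?sqn_ge0// ler_eXnr// lerDl sqn_ge0.
Qed.

Section Sufficiency.
Variables (g h : I -> R -> R[i]) (Cg Ch : R).
Hypotheses (Lg : forall i, L2 (g i)) (Lh : forall i, L2 (h i)).
Hypotheses (Bg : bessel Cg g) (Bh : bessel Ch h).
Hypotheses (Cg0 : 0 <= Cg) (Ch0 : 0 <= Ch).
Hypothesis W : forall f k, L2 f -> L2 k ->
  weak_identity lebesgue_measure Rplus g h f k.

(** Testing the identity against [f] itself bounds the norm by the coefficient
    energy of either family, by the Cauchy-Schwarz inequality. *)
Lemma energy_lower_bound (u : I -> R -> R[i]) (C E : R) f : 0 <= C -> L2 f ->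
  (forall F : {fset I}, Normc.normc
     (frame_sum lebesgue_measure Rplus g h f f F) ^+ 2 <=
     (\sum_(i <- F) Normc.normc (ip f (u i)) ^+ 2) * (C * N f)) ->
  coef_energy u f = E%:E -> N f <= C * E.
Proof.
move=> C0 Lf HF uE; have E0 : 0 <= E.
  by rewrite -lee_fin -uE; apply: esum_ge0 => i _; rewrite lee_fin sqr_ge0.
have N0 : 0 <= N f by exact: sqn_ge0.
have ECN : 0 <= E * (C * N f) by rewrite !mulr_ge0.
have : Normc.normc (ip f f) <= Num.sqrt (E * (C * N f)).
  apply: (nlim_norm_le (F0 := fset0) _ (W Lf Lf)) => F _.
  rewrite -ler_sqr ?nnegrE ?normc_ge0 ?sqrtr_ge0// sqr_sqrtr//.
  apply: le_trans (HF F) _; rewrite ler_wpM2r ?mulr_ge0//.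
  by rewrite -lee_fin -uE; exact: esum_fset_ge.
rewrite (gip_sqn mRplus Lf) normcR ger0_norm// -ler_sqr ?nnegrE ?sqrtr_ge0//.
rewrite sqr_sqrtr//; have [->|n0] := eqVneq (N f) 0; first by rewrite mulr_ge0.
rewrite mulrA expr2 ler_pM2r; first by rewrite mulrC.
by rewrite lt_neqAle eq_sym n0.
Qed.

(** The constants are increased by 1 because a Bessel bound may vanish, and
    a lower frame bound has to be positive. *)
Lemma frames_of_weak_identity (u : I -> R -> R[i]) (Cu C : R) :
  bessel Cu u -> 0 <= Cu -> 0 <= C ->
  (forall f, L2 f -> forall F : {fset I}, Normc.normc
     (frame_sum lebesgue_measure Rplus g h f f F) ^+ 2 <=
     (\sum_(i <- F) Normc.normc (ip f (u i)) ^+ 2) * (C * N f)) ->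
  is_frame u.
Proof.
move=> Bu Cu0 C0 HF; have C1 : 0 < C + 1 by rewrite ltr_wpDl.
exists (C + 1)^-1, (Cu + 1); split; first by rewrite invr_gt0.
  by rewrite (@le_trans _ _ 1)// ?invf_le1// ?lerDr.
move=> f Lf; have [E uE EN] := coef_energyE Bu Lf.
have -> : sqnorm Rplus f = (N f)%:E by exact: gsqE.
have NE := energy_lower_bound C0 Lf (HF f Lf) uE.
have N0 : 0 <= N f by exact: sqn_ge0.
have E0 : 0 <= E.
  by rewrite -lee_fin -uE; apply: esum_ge0 => i _; rewrite lee_fin sqr_ge0.
rewrite uE -!EFinM !lee_fin mulrC ler_pdivrMr//; split.
  by rewrite mulrDr mulr1 mulrC (le_trans NE)// lerDl.
by rewrite (le_trans EN)// mulrDl mul1r lerDl.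
Qed.

(** Let [r] be the residual of a partial sum. By the weak identity <r, r> is
    the limit of later increments of the frame sums tested against [r];
    these are controlled by the tail of the coefficient energy and by the
    norm of [r] itself, so the norm of [r] is at most a multiple of the
    tail. *)
Lemma L2_sum_of_weak_identity f : inL2 Rplus f ->
  L2_sum Rplus (fun i x => inner f (h i) * g i x) f.
Proof.
move=> Lf e e0; have [E hE _] := coef_energyE Bh Lf.
set dl := e ^+ 2 / (Cg + 1); have C1 : 0 < Cg + 1 by rewrite ltr_wpDl.
have dl0 : 0 < dl by rewrite divr_gt0// exprn_gt0.
have [F0 hF0] := esum_adherent dl0 hE; exists F0 => F F0F.
set r := (fun x => f x - _).
have LS : L2 (fun x => \sum_(i <- F) inner f (h i) * g i x).
  by apply: gL2_sum => [|i]; [exact: mRplus|apply: gL2Z; [exact: mRplus|]].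
have Lr : L2 r by apply: gL2B => //; exact: mRplus.
have -> : sqnorm Rplus r = (N r)%:E by exact: gsqE.
have N0 : 0 <= N r by exact: sqn_ge0.
have B0 : 0 <= dl * (Cg * N r) by apply: mulr_ge0; [exact: ltW|exact: mulr_ge0].
(* The tail of the energy outside F0 is below dl, and it controls all later
   increments of the partial sums tested against r. *)
have tail G : (F `<=` G)%fset ->
    Normc.normc (frame_sum lebesgue_measure Rplus g h f r G -
                 frame_sum lebesgue_measure Rplus g h f r F) <=
    Num.sqrt (dl * (Cg * N r)).
  move=> FG; rewrite /frame_sum (fset_sum_split _ FG) addrC addKr.
  rewrite -ler_sqr ?nnegrE ?normc_ge0 ?sqrtr_ge0// sqr_sqrtr//.
  have FL := frame_sum_le mRplus h Lg Bg _ Lf Lr; apply: le_trans (FL _) _.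
  rewrite ler_wpM2r ?mulr_ge0//.
  have := esum_fset_ge (fun i => Normc.normc (ip f (h i)) ^+ 2) G.
  rewrite -/(coef_energy h f) hE lee_fin (fset_sum_split _ FG).
  have F0FG : \sum_(i <- F0) Normc.normc (ip f (h i)) ^+ 2 <=
      \sum_(i <- F) Normc.normc (ip f (h i)) ^+ 2.
    rewrite (fset_sum_split _ F0F) lerDl.
    by apply: sumr_ge0 => i _; exact: sqr_ge0.
  move: hF0 F0FG; rewrite /inner -/(ip _ _); set a := \sum_(i <- F0) _.
  set b := \sum_(i <- F) _; set c := \sum_(i <- (G `\` F)%fset) _.
  by move: a b c => a b c; lra.
have : Normc.normc (ip r r) <= Num.sqrt (dl * (Cg * N r)).
  have -> : ip r r = ip f r - frame_sum lebesgue_measure Rplus g h f r F.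
    rewrite frame_sumE//; last exact: mRplus.
    by rewrite -gipBl//; exact: mRplus.
  apply: (@nlim_norm_le _ _ (fun G =>
    frame_sum lebesgue_measure Rplus g h f r G -
    frame_sum lebesgue_measure Rplus g h f r F) _ _ F) => //.
  apply: nlimD; first exact: W.
  exact: nlim_cst.
rewrite (gip_sqn mRplus Lr) normcR ger0_norm// -ler_sqr ?nnegrE ?sqrtr_ge0//.
rewrite sqr_sqrtr// lte_fin; have [->|n0] := eqVneq (N r) 0.
  by rewrite exprn_gt0.
have Np : 0 < N r by rewrite lt_neqAle eq_sym n0.
rewrite mulrA expr2 ler_pM2r// => /le_lt_trans; apply.
rewrite /dl mulrAC ltr_pdivrMr// ltr_pM2l ?exprn_gt0//.
by rewrite ltrDl.
Qed.

(** One identity serves both families: in the Cauchy-Schwarz estimate of the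
    frame sum either factor may be bounded by its Bessel bound, leaving the
    coefficient energy along the other family. *)
Lemma dual_frames_of_weak_identity : dual_frames g h.
Proof.
split; last exact: L2_sum_of_weak_identity.
  apply: (frames_of_weak_identity Bg Cg0 Ch0) => f Lf F.
  rewrite mulrC; apply: le_trans (sum_cauchy_schwarz _ _ _) _.
  apply: ler_pM; try by apply: sumr_ge0 => i _; exact: sqr_ge0.
  - exact: Bh.
  - by apply: ler_sum => i _; rewrite (gipJ mRplus Lf (Lg i)) normcJ.
apply: (frames_of_weak_identity Bh Ch0 Cg0) => f Lf F.
have FL := frame_sum_le mRplus h Lg Bg F Lf Lf; exact: FL.
Qed.

End Sufficiency.
End DualFrames.

(** * Exponentials and indicators of Borel sets *)

Section AlmostEverywhere.
Context d (T : measurableType d) (R : realType).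
Variable mu : {measure set T -> \bar R}.
Implicit Types P Q S : T -> Prop.

Lemma ae_imp P Q : (forall x, P x -> Q x) ->
  {ae mu, forall x, P x} -> {ae mu, forall x, Q x}.
Proof. by move=> PQ; apply: filterS. Qed.

Lemma ae_imp2 P Q S : (forall x, P x -> Q x -> S x) ->
  {ae mu, forall x, P x} -> {ae mu, forall x, Q x} -> {ae mu, forall x, S x}.
Proof. by move=> PQ; apply: filterS2. Qed.

End AlmostEverywhere.

Section Expi.
Context {R : realType}.
Implicit Types (x y t : R) (m n : int).

Lemma expiD x y : expi (x + y) = expi x * expi y.
Proof.
apply: complex_eq; rewrite ?ReM ?ImM /= ?cosD ?sinD//.
by rewrite addrC.
Qed.

Lemma expi0 : expi (0 : R) = 1.
Proof. by rewrite /expi cos0 sin0. Qed.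

Lemma conjc_expi x : conjc (expi x) = expi (- x).
Proof. by rewrite /expi cosN sinN. Qed.

Lemma normc_expi x : Normc.normc (expi x) = 1.
Proof. by rewrite /expi /= cos2Dsin2 sqrtr1. Qed.

Lemma expi2pi_nat (n : nat) : expi (2 * pi * n%:R : R) = 1.
Proof.
elim: n => [|n ih]; first by rewrite mulr0 expi0.
have -> : n.+1%:R = n%:R + 1 :> R by rewrite natr1.
rewrite mulrDr expiD ih mul1r mulr1.
by rewrite /expi [2 * pi]mulrC mulr_natr cos2pi sin2pi.
Qed.

Lemma expi2pi m : expi (2 * pi * m%:~R : R) = 1.
Proof.
case: m => n; first by rewrite -pmulrn expi2pi_nat.
rewrite NegzE mulrNz -pmulrn mulrN -conjc_expi expi2pi_nat.
exact: conjc1.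
Qed.

Lemma cmeasurable_expi d (T : measurableType d) (D : set T) (g : T -> R) :
  measurable_fun D g -> cmeasurable D (fun w => expi (g w)).
Proof.
move=> mg; split.
  apply: (measurableT_comp _ mg) => /=; apply: continuous_measurable_fun.
  exact: continuous_cos.
apply: (measurableT_comp _ mg) => /=; apply: continuous_measurable_fun.
exact: continuous_sin.
Qed.

Definition fexp (T : R) m x : R[i] := expi (2 * pi * m%:~R * x / T).

Lemma fexpD T m n x : fexp T (m + n) x = fexp T m x * fexp T n x.
Proof. by rewrite /fexp -expiD intrD mulrDr !mulrDl. Qed.

Lemma fexp0 T x : fexp T 0 x = 1.
Proof. by rewrite /fexp mulr0 !mul0r expi0. Qed.

Lemma fexpN T m x : fexp T (- m) x = conjc (fexp T m x).
Proof. by rewrite /fexp conjc_expi intrN mulrN !mulNr. Qed.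

Lemma normc_fexp T m x : Normc.normc (fexp T m x) = 1.
Proof. exact: normc_expi. Qed.

Lemma cmeasurable_fexp T m (D : set R) : cmeasurable D (fexp T m).
Proof.
by apply: cmeasurable_expi; apply: measurable_funM.
Qed.

Lemma fexp_periodic T m n x : T != 0 -> fexp T m (x + T * n%:~R) = fexp T m x.
Proof.
move=> T0; rewrite /fexp.
have -> : 2 * pi * m%:~R * (x + T * n%:~R) / T =
    2 * pi * m%:~R * x / T + 2 * pi * (m * n)%:~R.
  by rewrite intrM; field.
by rewrite expiD expi2pi mulr1.
Qed.

End Expi.

Section BernsteinStep.
Context {R : realType}.
Implicit Types (t y : R).

Lemma bernoulli_ge t (n : nat) : 0 <= t <= 1 -> 1 - n%:R * t <= (1 - t) ^+ n.
Proof.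
move=> /andP[t0 t1]; elim: n => [|n ih]; first by rewrite mul0r subr0 expr0.
rewrite exprS; have t10 : 0 <= 1 - t by rewrite subr_ge0.
apply: le_trans (ler_wpM2l t10 ih).
have : 0 <= n%:R * t * t by rewrite !mulr_ge0.
by rewrite -natr1; nra.
Qed.

Lemma bernoulli_le t (n : nat) : 0 <= t -> 1 + n%:R * t <= (1 + t) ^+ n.
Proof.
move=> t0; elim: n => [|n ih]; first by rewrite mul0r addr0 expr0.
rewrite exprS; have t10 : 0 <= 1 + t by rewrite addr_ge0.
apply: le_trans (ler_wpM2l t10 ih).
have : 0 <= n%:R * t * t by rewrite !mulr_ge0.
by rewrite -natr1; nra.
Qed.

(** A sequence of polynomials that converges on [0, 1], away from 1/2, to the
    indicator of [y < 1/2]. *)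
Definition step (n : nat) y : R := (1 - y ^+ n) ^+ (2 ^ n).

Lemma step01 n y : 0 <= y <= 1 -> 0 <= step n y <= 1.
Proof.
move=> /andP[y0 y1]; have h : 0 <= 1 - y ^+ n <= 1.
  by rewrite subr_ge0 exprn_ile1//= gerBl exprn_ge0.
by rewrite /step exprn_ge0 ?exprn_ile1//; case/andP: h.
Qed.

(** Bernoulli's inequality gives 1 - (2 y)^n <= step n y <= 1. *)
Lemma step_cvg1 y : 0 <= y < 1 / 2 -> step n y @[n --> \oo] --> (1 : R).
Proof.
move=> /andP[y0 y2].
have y1 : y <= 1 by lra.
apply: (@squeeze_cvgr _ _ _ _ (fun n => 1 - (2 * y) ^+ n) (fun=> 1)).
- apply: nearW => n; have [y01 yn1] : 0 <= y ^+ n /\ y ^+ n <= 1.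
    by rewrite exprn_ge0// exprn_ile1.
  have /andP[_ ->] : 0 <= step n y <= 1 by apply: step01; rewrite y0.
  rewrite andbT.
  have := @bernoulli_ge (y ^+ n) (2 ^ n); rewrite y01 yn1 => /(_ isT).
  by rewrite natrX -exprMn.
- rewrite -[X in _ --> X]subr0; apply: cvgB; first exact: cvg_cst.
  by apply: cvg_expr; rewrite ger0_norm ?mulr_ge0//; lra.
- exact: cvg_cst.
Qed.

(** Multiplying by (1 + y^n)^(2^n) >= (2 y)^n turns step n y into (1 -
    y^(2n))^(2^n) <= 1. *)
Lemma step_cvg0 y : 1 / 2 < y <= 1 -> step n y @[n --> \oo] --> (0 : R).
Proof.
move=> /andP[y2 y1]; have y0 : 0 < y by lra.
apply: (@squeeze_cvgr _ _ _ _ (fun=> 0) (fun n => ((2 * y)^-1) ^+ n)).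
- apply: nearW => n; have [y01 yn1] : 0 <= y ^+ n /\ y ^+ n <= 1.
    by rewrite exprn_ge0 ?exprn_ile1// ltW.
  have /andP[s0 _] : 0 <= step n y <= 1 by apply: step01; rewrite y1 ltW.
  rewrite s0 /= exprVn.
  rewrite -div1r ler_pdivlMr ?exprn_gt0 ?mulr_gt0//.
  apply: (@le_trans _ _ (step n y * (1 + (y ^+ n)) ^+ (2 ^ n))).
    rewrite ler_wpM2l//.
    apply: le_trans (bernoulli_le _ y01); rewrite natrX -exprMn.
    by rewrite lerDr.
  rewrite /step -exprMn exprn_ile1//.
    by apply: mulr_ge0; [rewrite subr_ge0|rewrite addr_ge0].
  have := sqr_ge0 (y ^+ n); rewrite expr2; move: (y ^+ n) => z; nra.
- exact: cvg_cst.
- apply: cvg_expr; rewrite ger0_norm ?invr_ge0 ?mulr_ge0 ?(ltW y0)//.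
  by rewrite invf_lt1 ?mulr_gt0//; lra.
Qed.

End BernsteinStep.

Section TrigonometricPolynomials.
Context {R : realType} (T : R).
Implicit Types (p q : R -> R[i]).

Definition linear_class (W : (R -> R[i]) -> Prop) :=
  (forall p q, W p -> W q -> W (fun x => p x + q x)) /\
  (forall c p, W p -> W (fun x => c * p x)).

(** The linear span of the exponentials, given by its universal property. *)
Definition trig p :=
  forall W, linear_class W -> (forall m, W (fexp T m)) -> W p.

Lemma trigD p q : trig p -> trig q -> trig (fun x => p x + q x).
Proof. by move=> tp tq W LW We; apply: LW.1; [exact: tp|exact: tq]. Qed.

Lemma trigZ c p : trig p -> trig (fun x => c * p x).
Proof. by move=> tp W LW We; apply: LW.2; exact: tp. Qed.

Lemma trig_fexp m : trig (fexp T m).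
Proof. by move=> W _; exact. Qed.

Lemma trig_cst c : trig (fun=> c).
Proof.
have -> : (fun=> c) = (fun x => c * fexp T 0 x).
  by apply/funext => x; rewrite fexp0 mulr1.
by apply: trigZ; exact: trig_fexp.
Qed.

Lemma trigM p q : trig p -> trig q -> trig (fun x => p x * q x).
Proof.
move=> tp tq; apply: (tp (fun p => trig (fun x => p x * q x))).
  split=> [p1 p2 t1 t2|c p1 t1].
    by under eq_fun do rewrite mulrDl; exact: trigD.
  by under eq_fun do rewrite -mulrA; exact: trigZ.
move=> m; apply: (tq (fun q => trig (fun x => fexp T m x * q x))).
  split=> [p1 p2 t1 t2|c p1 t1].
    by under eq_fun do rewrite mulrDr; exact: trigD.
  by under eq_fun do rewrite mulrCA; exact: trigZ.
by move=> n; under eq_fun do rewrite -fexpD; exact: trig_fexp.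
Qed.

Lemma trigX n p : trig p -> trig (fun x => p x ^+ n).
Proof.
move=> tp; elim: n => [|n ih]; first exact: trig_cst.
by under eq_fun do rewrite exprS; exact: trigM.
Qed.

(** Euler's formula; [k] is 1 / (2 i). *)
Lemma trig_sin (c : R) : trig (fun x => (sin (2 * pi * (x - c) / T))%:C%C).
Proof.
pose k : R[i] := (0 +i* (- (1 / 2)))%C.
have -> : (fun x => (sin (2 * pi * (x - c) / T))%:C%C) =
  (fun x => (k * expi (- (2 * pi * c / T))) * fexp T 1 x +
            (- k * expi (2 * pi * c / T)) * fexp T (-1) x).
  apply/funext => x; rewrite /fexp -!mulrA -!expiD.
  set t := 2 * pi * (x - c) / T.
  have -> : - (2 * (pi * (c / T))) + 2 * (pi * (1%:~R * (x / T))) = t :> R.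
    by rewrite /t; ring.
  have -> : 2 * (pi * (c / T)) + 2 * (pi * ((-1)%:~R * (x / T))) = - t :> R.
    by rewrite /t; ring.
  have -> : 2 * (pi * ((x - c) / T)) = t by rewrite /t; ring.
  by apply: complex_eq; rewrite !cE /expi/= ?cosN ?sinN; field.
by apply: trigD; apply: trigZ; exact: trig_fexp.
Qed.

Lemma trig_step n (f : R -> R) : trig (fun x => (f x)%:C%C) ->
  trig (fun x => (step n (f x))%:C%C).
Proof.
move=> tf; have -> : (fun x => (step n (f x))%:C%C) =
    (fun x => (1 + (- 1) * (f x)%:C%C ^+ n) ^+ (2 ^ n)).
  apply/funext => x.
  by rewrite /step rmorphXn/= rmorphB/= rmorphXn/= mulN1r.
by apply: trigX; apply: trigD; [exact: trig_cst|apply: trigZ; exact: trigX].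
Qed.

End TrigonometricPolynomials.

Section BoundedClass.
Context {R : realType} (u0 T : R).
Hypothesis T0 : 0 < T.
Local Notation mu := (@lebesgue_measure R).
Local Notation I := (`[u0, u0 + T[%classic : set R).
Variable W : (R -> R[i]) -> Prop.
Hypothesis LW : linear_class W.
Hypothesis eW : forall m, W (fexp T m).

(** Asked for [0, 1]-valued functions only, which suffices for indicators
    and makes every sequence involved dominated; convergence is required
    almost everywhere on one period. *)
Definition bounded_closed := forall (p : nat -> R -> R) (q : R -> R),
  (forall n, W (fun x => (p n x)%:C%C)) ->
  (forall n, measurable_fun setT (p n)) -> measurable_fun setT q ->
  (forall n x, 0 <= p n x <= 1) -> (forall x, 0 <= q x <= 1) ->
  {ae mu, forall x, I x -> p n x @[n --> \oo] --> q x} ->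
  W (fun x => (q x)%:C%C).

Hypothesis cW : bounded_closed.

Lemma ae_off_seq (P : R -> Prop) (s : seq R) :
  (forall x, x \notin s -> P x) -> {ae mu, forall x, P x}.
Proof.
move=> sP; have mes : mu.-negligible ([set` s] : set R).
  apply/negligibleP; first exact: countable_measurable (finite_set_countable (finite_seq s)).
  by apply: countable_lebesgue_measure0; exact: finite_set_countable (finite_seq s).
apply: negligibleS mes => x /= nP; apply: contrapT => /negP xs.
by apply: nP; exact: sP.
Qed.

Lemma bounded_class_ae (p q : R -> R) : W (fun x => (p x)%:C%C) ->
  measurable_fun setT p -> measurable_fun setT q ->
  (forall x, 0 <= p x <= 1) -> (forall x, 0 <= q x <= 1) ->
  {ae mu, forall x, I x -> p x = q x} -> W (fun x => (q x)%:C%C).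
Proof.
move=> Wp mp mq p01 q01 pq; apply: (cW (p := fun=> p)) => //.
by apply: (ae_imp _ pq) => x xpq /xpq ->; exact: cvg_cst.
Qed.

Let sn (z : R) : R := sin (2 * pi * z / T).

Lemma sn_pos z : 0 < z < T / 2 -> 0 < sn z.
Proof.
move=> /andP[z0 zT]; apply: sin_gt0_pi; have p0 := @pi_gt0 R.
rewrite divr_gt0 ?mulr_gt0//= ltr_pdivrMr//.
by rewrite (mulrC 2) -mulrA ltr_pM2l//; lra.
Qed.

Lemma sn_neg z : - (T / 2) < z < 0 -> sn z < 0.
Proof.
move=> h; have := @sn_pos (- z); rewrite /sn mulrN mulNr sinN oppr_gt0.
by rewrite oppr_gt0; apply; rewrite ltrNl andbC.
Qed.

Lemma sn_neg2 z : T / 2 < z < T -> sn z < 0.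
Proof.
move=> h; have -> : sn z = sn (z - T); last by apply: sn_neg; lra.
rewrite /sn; have -> : 2 * pi * z / T = 2 * pi * (z - T) / T + pi *+ 2.
  by rewrite mulr2n; field; rewrite gt_eqF.
by rewrite sinD2pi.
Qed.

(** Along the period these two lie in [0, 1]; [yf c] is below 1/2 exactly on
    the half period following [c], and [yb c] on the half period preceding
    [c]. *)
Let yf (c x : R) : R := (1 - sn (x - c)) / 2.
Let yb (c x : R) : R := (1 - sn (c - x)) / 2.

Lemma half01 (t : R) : 0 <= (1 - sin t) / 2 <= 1.
Proof. by have := sin_geN1 t; have := sin_le1 t; lra. Qed.

Lemma trig_yf c : trig T (fun x => (yf c x)%:C%C).
Proof.
have -> : (fun x => (yf c x)%:C%C) = (fun x => (1 / 2)%:C%C +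
    (- (1 / 2))%:C%C * (sin (2 * pi * (x - c) / T))%:C%C).
  apply/funext => x; rewrite -rmorphM -rmorphD /=; congr (_%:C%C).
  by rewrite /yf /sn; field.
by apply: trigD; [exact: trig_cst|apply: trigZ; exact: trig_sin].
Qed.

Lemma trig_yb c : trig T (fun x => (yb c x)%:C%C).
Proof.
have -> : (fun x => (yb c x)%:C%C) = (fun x => (1 / 2)%:C%C +
    (1 / 2)%:C%C * (sin (2 * pi * (x - c) / T))%:C%C).
  apply/funext => x; rewrite -rmorphM -rmorphD /=; congr (_%:C%C).
  by rewrite /yb /sn -[c - x]opprB mulrN mulNr sinN; field.
by apply: trigD; [exact: trig_cst|apply: trigZ; exact: trig_sin].
Qed.

Lemma measurable_step n (f : R -> R) : measurable_fun setT f ->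
  measurable_fun setT (fun x => step n (f x)).
Proof.
move=> mf; apply: measurable_funX; apply: measurable_funB => //.
exact: measurable_funX.
Qed.

Lemma measurable_half (f : R -> R) : measurable_fun setT f ->
  measurable_fun setT (fun x => (1 - sn (f x)) / 2).
Proof.
move=> mf; apply: measurable_funM => //; apply: measurable_funB => //.
have ms : measurable_fun setT (@sin R).
  by apply: continuous_measurable_fun; exact: continuous_sin.
apply: (measurableT_comp ms).
by apply: measurable_funM => //; exact: measurable_funM.
Qed.

(** An arc no longer than half a period is, up to its endpoints, the
    intersection of two half circles, each the limit of polynomials in a sine. *)
Lemma bounded_class_short (u v : R) : u0 <= u -> u < v -> v <= u0 + T ->
  v - u <= T / 2 -> W (fun x => (\1_(`]u, v[%classic : set R) x)%:C%C).
Proof.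
move=> u0u uv vT short.
apply: (cW (p := fun n x => step n (yf u x) * step n (yb v x))).
- move=> n.
  have tp : trig T (fun x => (step n (yf u x) * step n (yb v x))%:C%C).
    have -> : (fun x => (step n (yf u x) * step n (yb v x))%:C%C) =
      (fun x => (step n (yf u x))%:C%C * (step n (yb v x))%:C%C).
      by apply/funext => x; rewrite rmorphM.
    by apply: trigM; apply: trig_step; [exact: trig_yf|exact: trig_yb].
  exact: tp.
- move=> n; apply: measurable_funM; apply: measurable_step;
    apply: measurable_half; exact: measurable_funB.
- by apply: (@measurable_indic _ _ R setT); exact: measurable_itv.
- move=> n x; have /andP[h1 h2] := @step01 R n _ (half01 (2 * pi * (x - u) / T)).
  have /andP[h3 h4] := @step01 R n _ (half01 (2 * pi * (v - x) / T)).
  by rewrite mulr_ge0//= mulr_ile1.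
- by move=> x; rewrite indicE; case: (_ \in _); rewrite ?lexx ?ler01.
- apply: (@ae_off_seq _ [:: u0; u; v]) => x.
  rewrite !inE !negb_or => /and3P[xu0 xu xv] /=; rewrite in_itv/= => /andP[x0 xT].
  have {}x0 : u0 < x by rewrite lt_neqAle eq_sym xu0.
  have yy c : 0 <= (1 - sn c) / 2 <= 1 by exact: half01.
  have [xltu|uxle] := ltP x u.
  + have -> : \1_(`]u, v[%classic : set R) x = 0 * 0 + 0 :> R.
      rewrite indicE memNset ?mul0r ?addr0//= in_itv/= => /andP[].
      by rewrite ltNge ltW.
    rewrite mul0r addr0; have [h|h] := ltP (- (T / 2)) (x - u).
      have s0 : sn (x - u) < 0 by apply: sn_neg; lra.
      apply: (@squeeze_cvgr _ _ _ _ (fun=> 0) (fun n => step n (yf u x))).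
      * apply: nearW => n; have /andP[h1 h2] := step01 n (yy (x - u)).
        have /andP[h3 h4] := step01 n (yy (v - x)).
        by rewrite mulr_ge0//= ler_piMr.
      * exact: cvg_cst.
      * by apply: step_cvg0; have := yy (x - u); rewrite /yf; lra.
    have s0 : sn (v - x) < 0 by apply: sn_neg2; lra.
    apply: (@squeeze_cvgr _ _ _ _ (fun=> 0) (fun n => step n (yb v x))).
    * apply: nearW => n; have /andP[h1 h2] := step01 n (yy (x - u)).
      have /andP[h3 h4] := step01 n (yy (v - x)).
      by rewrite mulr_ge0//= ler_piMl.
    * exact: cvg_cst.
    * by apply: step_cvg0; have := yy (v - x); rewrite /yb; lra.
  have {}uxle : u < x by rewrite lt_neqAle eq_sym xu.
  have [vltx|xlev] := ltP v x.
  + have -> : \1_(`]u, v[%classic : set R) x = 0 :> R.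
      rewrite indicE memNset//= in_itv/= => /andP[_].
      by rewrite ltNge ltW.
    have [h|h] := ltP (- (T / 2)) (v - x).
      have s0 : sn (v - x) < 0 by apply: sn_neg; lra.
      apply: (@squeeze_cvgr _ _ _ _ (fun=> 0) (fun n => step n (yb v x))).
      * apply: nearW => n; have /andP[h1 h2] := step01 n (yy (x - u)).
        have /andP[h3 h4] := step01 n (yy (v - x)).
        by rewrite mulr_ge0//= ler_piMl.
      * exact: cvg_cst.
      * by apply: step_cvg0; have := yy (v - x); rewrite /yb; lra.
    have s0 : sn (x - u) < 0 by apply: sn_neg2; lra.
    apply: (@squeeze_cvgr _ _ _ _ (fun=> 0) (fun n => step n (yf u x))).
    * apply: nearW => n; have /andP[h1 h2] := step01 n (yy (x - u)).
      have /andP[h3 h4] := step01 n (yy (v - x)).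
      by rewrite mulr_ge0//= ler_piMr.
    * exact: cvg_cst.
    * by apply: step_cvg0; have := yy (x - u); rewrite /yf; lra.
  have {}xlev : x < v by rewrite lt_neqAle xv.
  have -> : \1_(`]u, v[%classic : set R) x = 1 * 1 :> R.
    by rewrite indicE mem_set ?mulr1//= in_itv/= uxle xlev.
  have s1 : 0 < sn (x - u) by apply: sn_pos; lra.
  have s2 : 0 < sn (v - x) by apply: sn_pos; lra.
  apply: cvgM; apply: step_cvg1.
    by have := yy (x - u); rewrite /yf; lra.
  by have := yy (v - x); rewrite /yb; lra.
Qed.

Lemma indic01 (A : set R) (x : R) : 0 <= (\1_A x : R) <= 1.
Proof. by rewrite indicE; case: (_ \in _); rewrite ?lexx ?ler01. Qed.

(** Halving the interval reduces to arcs of at most half a period. *)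
Lemma bounded_class_itv (u v : R) : u0 <= u -> u < v -> v <= u0 + T ->
  W (fun x => (\1_(`]u, v[%classic : set R) x)%:C%C).
Proof.
move=> u0u uv vT; set w := (u + v) / 2.
have uw : u < w by rewrite /w; lra.
have wv : w < v by rewrite /w; lra.
have W1 := @bounded_class_short u w u0u uw (ltac:(lra)) (ltac:(rewrite /w; lra)).
have W2 := @bounded_class_short w v (ltac:(lra)) wv vT (ltac:(rewrite /w; lra)).
pose f x : R := \1_(`]u, w[%classic : set R) x + \1_(`]w, v[%classic : set R) x.
have fE x : x != w -> f x = \1_(`]u, v[%classic : set R) x.
  move=> xw; rewrite /f !indicE !mem_setE !in_itv/=.
  have [xlt|wx] := ltP x w.
    by rewrite [w < x]ltNge (ltW xlt) /= addr0 andbT (lt_trans xlt wv) andbT.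
  have {}wx : w < x by rewrite lt_neqAle eq_sym xw.
  by rewrite andbF add0r wx /= (lt_trans uw wx).
have mf : measurable_fun setT f.
  by apply: measurable_funD; apply: (@measurable_indic _ _ R setT); exact: measurable_itv.
apply: (bounded_class_ae (p := f)) => //.
- have -> : (fun x => (f x)%:C%C) = (fun x =>
    (\1_(`]u, w[%classic : set R) x)%:C%C + (\1_(`]w, v[%classic : set R) x)%:C%C).
    by apply/funext => x; rewrite rmorphD.
  exact: LW.1.
- move=> x; have [->|xw] := eqVneq x w; last by rewrite fE// indic01.
  by rewrite /f !indicE !mem_setE !in_itv/= ltxx andbF addr0 lexx ler01.
- exact: indic01.
- by apply: (@ae_off_seq _ [:: w]) => x; rewrite inE => /fE.
Qed.

Lemma bounded_class0 : W (fun=> 0).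
Proof.
have -> : (fun=> 0) = (fun x => 0 * fexp T 0 x) :> (R -> R[i]).
  by apply/funext => x; rewrite mul0r.
exact: LW.2.
Qed.

(** The half-open intervals are the generators of the Borel sets from which
    the measurable structure on the line is built. *)
Lemma bounded_class_ocitv (s t : R) :
  W (fun x => (\1_(`]s, t]%classic `&` I) x)%:C%C).
Proof.
have mst : measurable (`]s, t]%classic `&` I).
  by apply: measurableI; exact: measurable_itv.
set u := Num.max s u0; set v := Num.min t (u0 + T).
have [vu|uv] := leP v u.
  apply: (bounded_class_ae (p := fun=> 0)) => //.
  - exact: bounded_class0.
  - by move=> x; rewrite lexx ler01.
  - exact: indic01.
  - apply: (@ae_off_seq _ [:: u]) => x; rewrite inE => xu _.
    rewrite indicE memNset// => -[] /=; rewrite !in_itv/= => /andP[sx xt].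
    move=> /andP[ux xT]; move: vu; rewrite leNgt => /negP; apply.
    apply: (@lt_le_trans _ _ x); last by rewrite le_min xt ltW.
    by rewrite lt_neqAle eq_sym xu /= ge_max ux ltW.
have u0u : u0 <= u by rewrite le_max lexx orbT.
have vT : v <= u0 + T by rewrite ge_min lexx orbT.
apply: (bounded_class_ae (bounded_class_itv u0u uv vT)) => //.
- exact: indic01.
- exact: indic01.
apply: (@ae_off_seq _ [:: u0; v]) => x; rewrite !inE negb_or => /andP[xu0 xv] Ix.
rewrite !indicE in_setI [x \in I]mem_set// andbT !mem_setE !in_itv/=.
move: Ix; rewrite /= in_itv/= => /andP[ux xT].
rewrite /u gt_max /v; have -> : u0 < x by rewrite lt_neqAle eq_sym xu0.
rewrite andbT; congr ((_ && _)%:R).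
by rewrite -[RHS]andbT -(ltW xT) -le_min lt_neqAle xv.
Qed.

(** Closure under bounded a.e. limits passes from the exponentials to the
    indicators of all Borel subsets of one period, by the pi-lambda theorem. *)
Lemma bounded_class_indic (E : set R) : measurable E ->
  W (fun x => (\1_(E `&` I) x)%:C%C).
Proof.
have mI : measurable I by exact: measurable_itv.
pose H : set (set R) := [set A | measurable A /\ W (fun x => (\1_(A `&` I) x)%:C%C)].
suff : <<s (@ocitv R)>> `<=` H by move=> h mE; have [] := h E mE.
have WI : W (fun x => (\1_I x)%:C%C).
  apply: (bounded_class_ae (@bounded_class_itv u0 (u0 + T) _ _ _)) => //.
  - by rewrite ltrDl.
  - exact: indic01.
  - exact: indic01.
  - apply: (@ae_off_seq _ [:: u0]) => x; rewrite !inE => xu0 Ix.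
    rewrite !indicE [x \in I]mem_set// mem_set//=.
    move: Ix; rewrite /= !in_itv/= => /andP[ux ->]; rewrite andbT.
    by rewrite lt_neqAle [u0 == x]eq_sym xu0.
apply: lambda_system_subset => //; first exact: ocitvI.
  split => //=.
  - by split => //; rewrite setTI.
  - move=> A B BA [mA WA] [mB WB]; split; first exact: measurableD.
    have -> : (fun x => (\1_((A `\` B) `&` I) x)%:C%C) = (fun x =>
      (\1_(A `&` I) x)%:C%C + (- 1) * (\1_(B `&` I) x)%:C%C) :> (R -> R[i]).
      apply/funext => x; rewrite mulN1r -rmorphN -rmorphD /=; congr (_%:C%C).
      rewrite !indicE setDE !in_setI in_setC.
      case: (boolP (x \in B)) => xB; last by rewrite andbT subr0.
      by rewrite (mem_set (BA _ (set_mem xB))) /= subrr.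
    by apply: LW.1 => //; exact: LW.2.
  - move=> F ndF HF; split.
      by apply: bigcup_measurable => k _; have [] := HF k.
    apply: (cW (p := fun n => \1_(F n `&` I))).
    + by move=> n; have [] := HF n.
    + by move=> n; apply: (@measurable_indic _ _ R setT); apply: measurableI => //; have [] := HF n.
    + apply: (@measurable_indic _ _ R setT); apply: measurableI => //.
      by apply: bigcup_measurable => k _; have [] := HF k.
    + by move=> n x; exact: indic01.
    + exact: indic01.
    + apply: (@ae_off_seq _ [::]) => x _ Ix.
      rewrite indicE in_setI [x \in I]mem_set// andbT.
      case: (boolP (x \in _)) => [/set_mem[k _ Fk]|xF].
        apply: cvg_near_cst; exists k => // n /= kn.
        rewrite indicE mem_set//; split => //.
        by have /subsetPset := ndF _ _ kn; apply.
      apply: cvg_near_cst; apply: nearW => n; rewrite indicE memNset// => -[Fn _].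
      by move/negP: xF; apply; rewrite inE; exists n.
move=> _ [[s t] _ <-]; split; last exact: bounded_class_ocitv.
exact: measurable_itv.
Qed.

End BoundedClass.

(** * Uniqueness of Fourier coefficients *)

Lemma cvg_sqr_dist {R : realType} (u : nat -> R) (l : R) :
  u n @[n --> \oo] --> l -> (l - u n) ^+ 2 @[n --> \oo] --> (0 : R).
Proof.
move=> ul; have d0 : l - u n @[n --> \oo] --> (0 : R).
  by rewrite -[X in _ --> X](subrr l); apply: cvgB; [exact: cvg_cst|].
rewrite -[X in _ --> X](mulr0 0).
by under eq_fun do rewrite expr2; exact: cvgM.
Qed.

Section FourierUniqueness.
Context {R : realType} (u0 T : R).
Hypothesis T0 : 0 < T.
Local Notation mu := (@lebesgue_measure R).
Local Notation I := (`[u0, u0 + T[%classic : set (measurableTypeR R)).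

Let mI : measurable I. Proof. exact: measurable_itv. Qed.

Lemma integral_bounded_cvg0 (h : R -> R) (p : nat -> R -> R) (q : R -> R) :
  mu.-integrable I (EFin \o h) ->
  (forall n, measurable_fun setT (p n)) -> measurable_fun setT q ->
  (forall n x, 0 <= p n x <= 1) ->
  {ae mu, forall x, I x -> p n x @[n --> \oo] --> q x} ->
  (forall n, (\int[mu]_(x in I) (h x * p n x)%:E)%E = 0%E) ->
  (\int[mu]_(x in I) (h x * q x)%:E)%E = 0%E.
Proof.
move=> ih mp mq p01 pq hp.
have mh : measurable_fun I h by have /integrableP[/measurable_EFinP] := ih.
have mE (f : R -> R) : measurable_fun setT f ->
    measurable_fun I (fun x => (h x * f x)%:E).
  move=> mf; apply/measurable_EFinP; apply: measurable_funM => //.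
  exact: measurable_funTS.
have lim : {ae mu, forall x, I x ->
    (h x * p n x)%:E @[n --> \oo] --> (h x * q x)%:E}.
  apply: (ae_imp _ pq) => x xpq Ix; apply: cvg_EFin; first exact: nearW.
  by apply: cvgM; [exact: cvg_cst|exact: xpq].
have dom : {ae mu, forall x n, I x ->
    (`|(h x * p n x)%:E| <= `|h x|%:E)%E}.
  apply: aeW => x n _ /=; rewrite lee_fin normrM.
  by have /andP[p0 p1] := p01 n x; rewrite (ger0_norm p0) ler_piMr.
have [_ _] := dominated_convergence mI (fun n => mE _ (mp n)) (mE _ mq) lim
  (integrable_norm ih) dom.
have -> : [sequence (\int[mu]_(x in I) (h x * p n x)%:E)%E]_n = cst 0%E.
  by apply/funext => n /=; exact: hp.
by move=> /(cvg_lim (@ereal_hausdorff R)) <-; rewrite lim_cst.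
Qed.

(** The functions [p] for which [g * p] has integral zero form a linear
    class that contains the exponentials and is closed under bounded limits.
    It therefore contains the indicators of Borel sets, so that the
    integrals of the real and imaginary parts of [g] over all Borel sets
    vanish. *)
Lemma fourier_uniqueness (g : R -> R[i]) : cintegrable mu I g ->
  (forall m, cint mu I (fun x => g x * fexp T m x) = 0) ->
  {ae mu, forall x, I x -> g x = 0}.
Proof.
move=> ig g0; have mg := cintegrable_measurable ig.
pose W p := cintegrable mu I (fun x => g x * p x) /\
  cint mu I (fun x => g x * p x) = 0.
have LW : linear_class W.
  split=> [p q [ip p0] [iq q0]|c p [ip p0]]; split.
  - by apply: eq_cintegrable (cintegrableD mI ip iq) => // x _; rewrite mulrDr.
  - under eq_cint do rewrite mulrDr.
    by rewrite cintD// p0 q0 addr0.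
  - by apply: eq_cintegrable (cintegrableZ c mI ip) => // x _; rewrite mulrCA.
  - under eq_cint do rewrite mulrCA.
    by rewrite cintZ// p0 mulr0.
have eW m : W (fexp T m).
  split; last exact: g0.
  apply: (cintegrable_le mI _ (cintegrable_normc mI ig)).
    by apply: cmeasurableM => //; exact: cmeasurable_fexp.
  by move=> x _; rewrite Normc.normcM normc_fexp mulr1.
have mulRe (f : R -> R) x : complex.Re (g x * (f x)%:C%C) = complex.Re (g x) * f x.
  by rewrite ReM /= mulr0 subr0.
have mulIm (f : R -> R) x : complex.Im (g x * (f x)%:C%C) = complex.Im (g x) * f x.
  by rewrite ImM /= mulr0 add0r.
have int0 (f : R -> R) : W (fun x => (f x)%:C%C) ->
    (\int[mu]_(x in I) (complex.Re (g x) * f x)%:E)%E = 0%E /\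
    (\int[mu]_(x in I) (complex.Im (g x) * f x)%:E)%E = 0%E.
  move=> [[i1 i2] /eqP]; rewrite eq_complex /= => /andP[/eqP h1 /eqP h2]; split.
    under eq_integral do rewrite -mulRe.
    rewrite -[LHS]fineK; last exact: integrable_fin_num.
    by congr EFin.
  under eq_integral do rewrite -mulIm.
  rewrite -[LHS]fineK; last exact: integrable_fin_num.
  by congr EFin.
have cW : bounded_closed u0 T W.
  move=> p q Wp mp mq p01 q01 pq.
  have iq : cintegrable mu I (fun x => g x * (q x)%:C%C).
    apply: (cintegrable_le mI _ (cintegrable_normc mI ig)).
      apply: cmeasurableM => //; split => /=; last exact: measurable_cst.
      exact: measurable_funTS.
    move=> x _; rewrite Normc.normcM normcR; have /andP[q0 q1] := q01 x.
    by rewrite ger0_norm// ler_piMr// normc_ge0.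
  split => //; apply: complex_eq; rewrite /= /Rintegral.
    under eq_integral do rewrite mulRe.
    rewrite (integral_bounded_cvg0 ig.1 mp mq p01 pq)// => n.
    by have [] := int0 _ (Wp n).
  under eq_integral do rewrite mulIm.
  rewrite (integral_bounded_cvg0 ig.2 mp mq p01 pq)// => n.
  by have [] := int0 _ (Wp n).
have WE E : measurable E -> W (fun x => (\1_(E `&` I) x)%:C%C).
  exact: (bounded_class_indic T0 LW eW cW).
have zero (h : R -> R) : mu.-integrable I (EFin \o h) ->
    (forall E, measurable E ->
       (\int[mu]_(x in I) (h x * \1_(E `&` I) x)%:E)%E = 0%E) ->
    ae_eq mu I (EFin \o h) (cst 0%E).
  move=> ih hE; apply: integral_ae_eq => // E EI mE.
  rewrite integral0 -(hE E mE) (setIidl EI).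
  rewrite -[in LHS](setIidr EI) integral_mkcondr.
  apply: eq_integral => x _; rewrite /= patchE indicE.
  by case: ifPn => _; rewrite ?mulr1 ?mulr0.
have h1 := zero _ ig.1 (fun E mE => (int0 _ (WE E mE)).1).
have h2 := zero _ ig.2 (fun E mE => (int0 _ (WE E mE)).2).
apply: (ae_imp2 _ h1 h2) => x e1 e2 Ix.
by apply: complex_eq; [have [] := e1 Ix|have [] := e2 Ix].
Qed.

End FourierUniqueness.

Section ClosedSubspaces.
Context d (T : measurableType d) (R : realType).
Variables (mu : {measure set T -> \bar R}) (D : set T).
Hypothesis mD : measurable D.
Variable V : (T -> R[i]) -> Prop.
Hypothesis cV : closed_subspace mu D V.
Local Notation L2 := (gL2 mu D).
Local Notation N := (sqn mu D).

(** Pointwise limits that are dominated in mean square are mean-square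
    limits. *)
Lemma closed_subspace_dominated (s : nat -> T -> R[i]) (f : T -> R[i])
    (G : T -> R) :
  (forall n, V (s n)) -> (forall n, cmeasurable D (s n)) -> L2 f ->
  mu.-integrable D (EFin \o G) ->
  (forall n x, D x -> Normc.normc (f x - s n x) ^+ 2 <= G x) ->
  {ae mu, forall x, D x -> Normc.normc (f x - s n x) ^+ 2 @[n --> \oo] --> (0 : R)} ->
  V f.
Proof.
move=> Vs ms Lf iG fG f0; have [_ _ cl] := cV; apply: cl => // e e0.
have mr n : cmeasurable D (fun x => f x - s n x).
  apply: cmeasurableD Lf.1 _.
  have := cmeasurableZ (-1) (ms n); apply: eq_cmeasurable => x _.
  by rewrite mulN1r.
have Lr n : L2 (fun x => f x - s n x) by exact: (gL2_le mD (mr n) iG (fG n)).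
have Ls n : L2 (s n).
  by apply: eq_gL2 (gL2B mD Lf (Lr n)) => x _; rewrite subKr.
have mE n : measurable_fun D (fun x => (Normc.normc (f x - s n x) ^+ 2)%:E).
  by apply/measurable_EFinP; exact: measurable_normc_sqr.
have lim : {ae mu, forall x, D x ->
    (Normc.normc (f x - s n x) ^+ 2)%:E @[n --> \oo] --> (0 : R)%:E}.
  by apply: (ae_imp _ f0) => x h Dx; apply: cvg_EFin; [exact: nearW|exact: h].
have dom : {ae mu, forall x n, D x ->
    (`|(Normc.normc (f x - s n x) ^+ 2)%:E| <= (EFin \o G) x)%E}.
  by apply: aeW => x n Dx; rewrite /= lee_fin ger0_norm ?sqr_ge0// fG.
have [_ _] := dominated_convergence mD mE (measurable_cst _) lim iG dom.
have -> : [sequence (\int[mu]_(x in D) (Normc.normc (f x - s n x) ^+ 2)%:E)%E]_n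
    = EFin \o (fun n => N (fun x => f x - s n x)).
  by apply/funext => n /=; exact: gsqE.
rewrite integral0 => /fine_cvgP[_] /cvgr0Pnorm_lt/(_ _ e0)[n _ /(_ n (leqnn n))].
rewrite /= ger0_norm ?sqn_ge0// => h.
by exists (s n); split.
Qed.

Lemma closed_subspace_sum (J : Type) (r : seq J) (u : J -> T -> R[i]) :
  V (fun=> 0) -> (forall j, V (u j)) -> V (fun x => \sum_(j <- r) u j x).
Proof.
move=> V0 Vu; have [A _ _] := cV; elim: r => [|j r ih].
  by under eq_fun do rewrite big_nil.
by under eq_fun do rewrite big_cons; exact: A.
Qed.

Section Exhaustion.
Variable U : nat -> set T.
Hypothesis mU : forall n, measurable (U n).
Hypothesis covU : forall x, D x -> exists N, forall n, (N <= n)%N -> U n x.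
Hypothesis VU : forall n E, measurable E ->
  V (fun x => (\1_(E `&` U n) x)%:C%C).

Import HBNNSimple.

(** The simple functions increasing to [h] are combinations of indicators;
    cutting the [n]-th one down to [U n] brings it into [V] without
    affecting the pointwise limit. *)
Lemma closed_subspace_ge0 (h : T -> R) : (forall x, 0 <= h x) ->
  measurable_fun setT h -> L2 (fun x => (h x)%:C%C) -> V (fun x => (h x)%:C%C).
Proof.
move=> h0 mh Lh; have mh' : measurable_fun setT (EFin \o h).
  exact/measurable_EFinP.
pose g n := nnsfun_approx measurableT mh' n.
have gc x : g n x @[n --> \oo] --> h x.
  have := @cvg_nnsfun_approx _ _ _ _ measurableT _ mh' (fun x _ => h0 x) x Logic.I.
  by move=> /fine_cvgP[].
have gh n x : g n x <= h x.
  rewrite -(cvg_lim (@Rhausdorff R) (gc x)).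
  apply: (@nondecreasing_cvgn_le _ (fun n => g n x)); last first.
    by apply/cvg_ex; exists (h x); exact: gc.
  by move=> i j ij; have /lefP/(_ x) := nd_nnsfun_approx measurableT mh' ij.
have [A Z _] := cV.
have V0 : V (fun=> 0).
  have := VU 0 measurable0; rewrite set0I; congr V.
  by apply/funext => x; rewrite indic0.
pose s n x : R[i] := (g n x * \1_(U n) x)%:C%C.
have sh n x : 0 <= g n x * \1_(U n) x <= h x.
  by rewrite mulr_ge0//= (le_trans _ (gh n x))// ler_piMr.
apply: (@closed_subspace_dominated s _ (fun x => h x ^+ 2)) => //.
- move=> n; rewrite /s.
  have -> : (fun x => (g n x * \1_(U n) x)%:C%C) =
    (fun x => \sum_(y <- fset_set (range (g n)))
       y%:C%C * (\1_((g n @^-1` [set y]) `&` U n) x)%:C%C).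
    apply/funext => x; rewrite [in LHS]fimfunE fsbig_finite//= mulr_suml rmorph_sum/=.
    by apply: eq_bigr => y _; rewrite -rmorphM/= -mulrA indicI.
  by apply: closed_subspace_sum => // y; apply: Z; exact: VU.
- move=> n; split; last exact: measurable_cst.
  by apply: measurable_funTS; exact: measurable_funM.
- have := gL2_integrable Lh; apply: eq_integrable => // x _ /=.
  by rewrite expr0n addr0 sqrtr_sqr real_normK ?num_real.
- move=> n x _; rewrite /s -rmorphB normcR /=.
  have /andP[s0 s1] := sh n x; rewrite ger0_norm ?subr_ge0//.
  by rewrite ler_sqr ?nnegrE ?subr_ge0// gerBl.
- apply: aeW => x Dx; rewrite /s.
  have -> : (fun n => Normc.normc ((h x)%:C%C - (g n x * \1_(U n) x)%:C%C) ^+ 2) =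
      (fun n => (h x - g n x * \1_(U n) x) ^+ 2).
    by apply/funext => n; rewrite -rmorphB normcR real_normK ?num_real.
  have c0 : (fun n => (h x - g n x) ^+ 2) @ \oo --> (0 : R).
    exact: cvg_sqr_dist.
  apply: cvg_trans c0; apply: near_eq_cvg; have [M HM] := covU Dx.
  exists M => // n /= /HM Ux; rewrite indicE mem_set// mulr1.
  by [].
Qed.

(** An arbitrary function is a combination of the positive and negative
    parts of its real and imaginary parts. *)
Lemma closed_subspace_full f : L2 f -> V f.
Proof.
move=> Lf; have [A Z cl] := cV; have [mf1 mf2] := Lf.1.
have part0 (h : T -> R) : measurable_fun D h ->
    (forall x, 0 <= h x) -> (forall x, D x -> h x <= Normc.normc (f x)) ->
    exists2 k : T -> R[i], V k & forall x, D x -> k x = (h x)%:C%C.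
  move=> mh h0 hf; exists (fun x => ((h \_ D) x)%:C%C); last first.
    by move=> x Dx; rewrite patchE mem_set.
  have mh' : measurable_fun setT (h \_ D) by apply/(measurable_restrictT _ mD).
  apply: closed_subspace_ge0 => //.
    by move=> x; rewrite patchE; case: ifP.
  apply: (gL2_le mD _ (gL2_integrable Lf)).
    by split => /=; [exact: measurable_funTS|exact: measurable_cst].
  move=> x Dx; rewrite normcR patchE mem_set// ger0_norm//.
  by rewrite ler_sqr ?nnegrE ?normc_ge0// hf.
have part (h : T -> R) : measurable_fun D h ->
    (forall x, D x -> `|h x| <= Normc.normc (f x)) ->
    exists2 k : T -> R[i], V k & forall x, D x -> k x = (h x)%:C%C.
  move=> mh hf.
  have [k1 V1 E1] : exists2 k : T -> R[i], V k &
      forall x, D x -> k x = (Num.max (h x) 0)%:C%C.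
    apply: part0 => [|x|x Dx]; first exact: measurable_maxr.
      by rewrite le_max lexx orbT.
    by rewrite ge_max normc_ge0 andbT (le_trans (ler_norm _))// hf.
  have [k2 V2 E2] : exists2 k : T -> R[i], V k &
      forall x, D x -> k x = (Num.max (- h x) 0)%:C%C.
    apply: part0 => [|x|x Dx].
    - by apply: measurable_maxr => //; exact: measurable_funN.
    - by rewrite le_max lexx orbT.
    - by rewrite ge_max normc_ge0 andbT (le_trans (ler_norm _))// normrN hf.
  exists (fun x => k1 x + (- 1) * k2 x); first by apply: A => //; exact: Z.
  move=> x Dx; rewrite E1// E2// mulN1r -rmorphB /=; congr (_%:C%C).
  by rewrite /Num.max; case: ltP => h1; case: ltP => h2; lra.
have [k1 V1 E1] := part _ mf1 (fun x _ => normc_Re (f x)).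
have [k2 V2 E2] := part _ mf2 (fun x _ => normc_Im (f x)).
have V5 := A _ _ V1 (Z 'i%C _ V2).
set k5 := (fun x => _) in V5.
have E5 x : D x -> f x = k5 x.
  by move=> Dx; rewrite /k5 E1// E2// -complexE.
apply: cl => // e e0; exists k5; split => //.
  exact: eq_gL2 Lf.
rewrite (@eq_sqn _ _ _ _ _ _ (fun=> 0)); last first.
  by move=> x Dx; rewrite -E5// subrr.
suff -> : N (fun=> 0) = 0 by [].
rewrite /sqn /gsq integral0_eq//.
by move=> x _; rewrite Normc.normc0 expr0n.
Qed.

End Exhaustion.
End ClosedSubspaces.

Section PeriodIndicators.
Context {R : realType} (D : set (measurableTypeR R)) (u0 T : R).
Hypothesis T0 : 0 < T.
Hypothesis mD : measurable D.
Local Notation mu := (@lebesgue_measure R).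
Local Notation I := (`[u0, u0 + T[%classic : set (measurableTypeR R)).

(** The functions whose restriction to the period lies in [V] form a class
    to which the approximation of indicators by exponentials applies; the
    indicator of the period is a square-integrable dominating function. *)
Lemma closed_subspace_period (V : (R -> R[i]) -> Prop) :
  closed_subspace mu D V ->
  (forall m, V (fun x => fexp T m x * (\1_I x)%:C%C)) ->
  forall E, measurable E -> V (fun x => (\1_(E `&` I) x)%:C%C).
Proof.
move=> cV Ve E mE; have [A Z _] := cV.
pose W p := V (fun x => p x * (\1_I x)%:C%C).
have mI : measurable I by exact: measurable_itv.
have LW : linear_class W.
  split=> [p q Wp Wq|c p Wp]; rewrite /W.
    by under eq_fun do rewrite mulrDl; exact: A.
  by under eq_fun do rewrite -mulrA; exact: Z.
have cW : bounded_closed u0 T W.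
  move=> p q Wp mp mq p01 q01 pq.
  have m1I : measurable_fun setT (\1_I : measurableTypeR R -> R).
    exact: measurable_indic.
  have mX (f : R -> R) : measurable_fun setT f ->
      cmeasurable D (fun x => (f x)%:C%C * (\1_I x)%:C%C).
    move=> mf; under eq_fun do rewrite -rmorphM.
    split => /=; last exact: measurable_cst.
    by apply: measurable_funTS; exact: measurable_funM.
  have iI : mu.-integrable D (EFin \o (\1_I : R -> R)).
    apply: (@integrableS _ _ _ _ setT) => //.
    by apply: integrable_indic_itv.
  have le1 (t : R) x : -1 <= t <= 1 -> Normc.normc (t%:C%C * (\1_I x)%:C%C) ^+ 2
      <= \1_I x.
    move=> /andP[t0 t1]; rewrite -rmorphM normcR real_normK ?num_real//.
    rewrite indicE; case: (_ \in _); rewrite ?mulr1 ?mulr0 ?expr0n//.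
    by rewrite /= -real_normK ?num_real// exprn_ile1// ler_norml t0.
  apply: (@closed_subspace_dominated _ _ _ mu D mD V cV
    (fun n x => (p n x)%:C%C * (\1_I x)%:C%C) _ (fun x => \1_I x)) => //.
  - by move=> n; exact: mX.
  - apply: (gL2_le mD (mX _ mq) iI) => x _; apply: le1.
    by have := q01 x; lra.
  - move=> n x _; rewrite -mulrBl -rmorphB; apply: le1.
    by have := q01 x; have := p01 n x; lra.
  - apply: (ae_imp _ pq) => x xpq Dx.
    have [Ix|nIx] := boolP (x \in I).
      under eq_fun do rewrite indicE Ix mulr1 mulr1 -rmorphB normcR real_normK ?num_real//.
      by apply: cvg_sqr_dist; apply: xpq; exact: set_mem.
    under eq_fun do rewrite indicE (negbTE nIx) !mulr0 subrr Normc.normc0 expr0n.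
    exact: cvg_cst.
have := bounded_class_indic T0 LW Ve cW mE; rewrite /W; congr V.
apply/funext => x; rewrite -rmorphM /= !indicE in_setI.
by case: (x \in E); case: (x \in I); rewrite ?mulr1 ?mulr0 ?mul0r.
Qed.

End PeriodIndicators.

(** * Integrals of exponentials, orthonormal families and scaling *)

Section ExponentialIntegral.
Context {R : realType} (u0 T : R).
Hypothesis T0 : 0 < T.
Local Notation mu := (@lebesgue_measure R).
Local Notation I := (`[u0, u0 + T[%classic : set (measurableTypeR R)).

Lemma measure_period : mu I = T%:E.
Proof.
rewrite lebesgue_measure_itv /= lte_fin ltrDl T0.
by rewrite -EFinD addrC addKr.
Qed.

Lemma integrable_bounded_period (f : R -> R[i]) (K : R) :
  cmeasurable I f -> (forall x, I x -> Normc.normc (f x) <= K) ->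
  cintegrable mu I f.
Proof.
have mI : measurable I by exact: measurable_itv.
move=> mf fK; apply: (cintegrable_le mI mf _ fK).
apply/integrableP; split; first exact: measurable_cst.
rewrite integral_cst//= [X in (_ * X)%E]measure_period -EFinM.
by rewrite ltry.
Qed.

(** The antiderivatives take equal values at the two ends of the interval. *)
Lemma integral_trig (k : R) : k != 0 -> sin (k * (u0 + T)) = sin (k * u0) ->
  cos (k * (u0 + T)) = cos (k * u0) ->
  Rintegral mu I (fun x => cos (k * x)) = 0 /\
  Rintegral mu I (fun x => sin (k * x)) = 0.
Proof.
move=> k0 hs hc; have uT : u0 < u0 + T by rewrite ltrDl.
have ck : continuous (fun x : R => k * x) by move=> x; exact: mulrl_continuous.
have cc : continuous (fun x : R => cos (k * x)).
  by move=> x; apply: continuous_comp; [exact: ck|exact: continuous_cos].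
have cs : continuous (fun x : R => sin (k * x)).
  by move=> x; apply: continuous_comp; [exact: ck|exact: continuous_sin].
have ds (x : R) : is_derive x 1 (fun x => k^-1 * sin (k * x)) (cos (k * x)).
  apply: is_derive_eq; rewrite /GRing.scale /= mulr1; field.
  exact: k0.
have dc (x : R) : is_derive x 1 (fun x => - k^-1 * cos (k * x)) (sin (k * x)).
  apply: is_derive_eq; rewrite /GRing.scale /= mulr1; field.
  exact: k0.
have FTC (F f : R -> R) : continuous f -> (forall x : R, is_derive x 1 F (f x)) ->
    F (u0 + T) = F u0 -> Rintegral mu I f = 0.
  move=> cf dF FF; rewrite /Rintegral.
  have cF : continuous F.
    by move=> x; apply: differentiable_continuous; apply/derivable1_diffP; case: (dF x).
  rewrite integral_itv_bndo_bndc; last first.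
    apply/measurable_EFinP/measurable_funTS.
    exact: continuous_measurable_fun.
  rewrite (@continuous_FTC2 R f F)//.
  - by rewrite FF subee.
  - exact: continuous_subspaceT.
  - split => [x _||]; first by case: (dF x).
      by apply: cvg_at_right_filter; exact: cF.
    by apply: cvg_at_left_filter; exact: cF.
  - by move=> x _; rewrite derive1E; case: (dF x).
by split; [apply: (FTC _ _ cc ds)|apply: (FTC _ _ cs dc)]; rewrite ?hs ?hc.
Qed.

Lemma fexp_integral (m : int) :
  cint mu I (fexp T m) = if m == 0 then T%:C%C else 0.
Proof.
have mI : measurable I by exact: measurable_itv.
case: eqVneq => [->|m0].
  rewrite (@eq_cint _ _ _ _ _ _ (fun=> 1)); last by move=> x _; rewrite fexp0.
  apply: complex_eq; rewrite /= Rintegral_cst//; last by rewrite mul0r.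
  by rewrite [X in fine X]measure_period mul1r.
pose k : R := 2 * pi * m%:~R / T.
have k0 : k != 0.
  rewrite mulf_neq0 ?invr_eq0 ?(gt_eqF T0)//.
  by rewrite !mulf_neq0 ?intr_eq0 ?(gt_eqF (pi_gt0 R)).
have fE (x : R) : fexp T m x = expi (k * x).
  by rewrite /fexp /k; congr expi; field; rewrite gt_eqF.
have := @fexp_periodic R T m 1 u0; rewrite gt_eqF// mulr1 => /(_ isT).
rewrite !fE => -[hc hs]; have [h1 h2] := integral_trig k0 hs hc.
have -> : cint mu I (fexp T m) =
    cint mu I (fun x : measurableTypeR R => expi (k * x)).
  by apply: eq_cint => x _; exact: fE.
exact: complex_eq.
Qed.

End ExponentialIntegral.

Section Isometries.
Context d (T : measurableType d) d' (T' : measurableType d') (R : realType).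
Variables (mu : {measure set T -> \bar R}) (D : set T).
Variables (mu' : {measure set T' -> \bar R}) (D' : set T').
Hypotheses (mD : measurable D) (mD' : measurable D').

(** The norms of [c f + g] for [c = 1] and [c = - i] contain the real and
    imaginary parts of the inner product. *)
Lemma gip_polarization (f g : T -> R[i]) (f' g' : T' -> R[i]) :
  gL2 mu D f -> gL2 mu D g -> gL2 mu' D' f' -> gL2 mu' D' g' ->
  (forall c, sqn mu D (fun x => c * f x + g x) =
             sqn mu' D' (fun x => c * f' x + g' x)) ->
  sqn mu D f = sqn mu' D' f' -> gip mu D f g = gip mu' D' f' g'.
Proof.
move=> Lf Lg Lf' Lg' H Hf.
have Hg : sqn mu D g = sqn mu' D' g'.
  rewrite (@eq_sqn _ _ _ _ _ _ (fun x => 0 * f x + g x)) ?H.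
    by apply: eq_sqn => x _; rewrite mul0r add0r.
  by move=> x _; rewrite mul0r add0r.
have ReE c : complex.Re (c * gip mu D f g) = complex.Re (c * gip mu' D' f' g').
  have := H c; rewrite !sqnD//; try exact: gL2Z.
  by rewrite !gipZl// !sqnZ// Hf Hg; lra.
apply: complex_eq; first by have := ReE 1; rewrite !mul1r.
by have := ReE (0 +i* (-1))%C; rewrite !ReM /=; lra.
Qed.

End Isometries.

Section OrthonormalFamilies.
Context d (T : measurableType d) (R : realType).
Variables (mu : {measure set T -> \bar R}) (D : set T).
Hypothesis mD : measurable D.
Context {I : choiceType} (e : I -> T -> R[i]).
Hypothesis Le : forall i, gL2 mu D (e i).
Hypothesis oe : forall i j, gip mu D (e i) (e j) = (i == j)%:R.

Lemma orthonormal_coef (c : I -> R[i]) (F : {fset I}) j :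
  gip mu D (fun x => \sum_(i <- F) c i * e i x) (e j) =
  if j \in F then c j else 0.
Proof.
rewrite gip_suml// => [|i]; last exact: gL2Z.
under eq_bigr => i _ do rewrite gipZl// oe.
case: ifPn => jF.
  rewrite (big_fsetD1 j)//= eqxx mulr1 big_seq big1 ?addr0// => i.
  by rewrite !inE => /andP[/negbTE-> _]; rewrite mulr0.
rewrite big_seq big1// => i iF; case: eqP => [ij|_]; last by rewrite mulr0.
by move: jF; rewrite -ij iF.
Qed.

Lemma orthonormal_sqn (c : I -> R[i]) (F : {fset I}) :
  sqn mu D (fun x => \sum_(i <- F) c i * e i x) =
  \sum_(i <- F) Normc.normc (c i) ^+ 2.
Proof.
set S := (fun x => _); have LS : gL2 mu D S.
  by apply: gL2_sum => // i; exact: gL2Z.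
apply: complexI; rewrite -gip_sqn// {1}/S gip_suml// => [|i]; last exact: gL2Z.
rewrite rmorph_sum/= !big_seq; apply: eq_bigr => i iF.
by rewrite gipZl// (gipJ mD LS (Le i)) orthonormal_coef iF mulJ_normc.
Qed.

(** Pythagoras: the distance to the partial sum with coefficients [c]
    exceeds the least one, attained at the Fourier coefficients, by the
    squared distance of the coefficients. *)
Lemma orthonormal_dist f (c : I -> R[i]) (F : {fset I}) : gL2 mu D f ->
  sqn mu D (fun x => f x - \sum_(i <- F) c i * e i x) =
  sqn mu D f - \sum_(i <- F) Normc.normc (gip mu D f (e i)) ^+ 2 +
  \sum_(i <- F) Normc.normc (gip mu D f (e i) - c i) ^+ 2.
Proof.
move=> Lf; have LS : gL2 mu D (fun x => \sum_(i <- F) c i * e i x).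
  by apply: gL2_sum => // i; exact: gL2Z.
rewrite sqnB// orthonormal_sqn (gipJ mD LS Lf) ReJ gip_suml// => [|i]; last first.
  exact: gL2Z.
have -> : complex.Re (\sum_(i <- F) gip mu D (fun x => c i * e i x) f) =
    \sum_(i <- F) complex.Re (c i * conjc (gip mu D f (e i))).
  rewrite (big_morph _ (@ReD R) (erefl _ : complex.Re 0 = 0)).
  by apply: eq_bigr => i _; rewrite gipZl// (gipJ mD Lf (Le i)).
rewrite mulr_sumr -!addrA; congr (_ + _).
rewrite -!sumrN -!big_split; apply: eq_bigr => i _.
move: (gip mu D f (e i)) (c i) => z w.
by rewrite /= !normc_sqr !cE; ring.
Qed.

Lemma orthonormal_bessel : bessel_bound mu D 1 e.
Proof.
move=> F f Lf; have := orthonormal_dist (fun i => gip mu D f (e i)) F Lf.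
under [X in _ + X]eq_bigr do rewrite subrr Normc.normc0 expr0n.
rewrite [X in _ + X]big1// addr0 mul1r -subr_ge0 => <-.
exact: sqn_ge0.
Qed.

(** For a total orthonormal family the expansion converges: the identity holds
    on the family itself, where the partial sums are eventually constant. *)
Lemma orthonormal_parseval : total_family mu D e ->
  forall f k, gL2 mu D f -> gL2 mu D k -> weak_identity mu D e e f k.
Proof.
move=> te; apply: (weak_identity_total mD Le Le orthonormal_bessel
  orthonormal_bessel ler01 ler01 Le te) => p q.
move=> eps eps0; exists [fset p]%fset => F pF.
have {}pF : p \in F by apply: (fsubsetP pF); rewrite inE.
have -> : frame_sum mu D e e (e p) (e q) F = gip mu D (e p) (e q).
  rewrite /frame_sum (big_fsetD1 p)//= oe eqxx mul1r big_seq big1 ?addr0// => i.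
  by rewrite !inE oe eq_sym => /andP[/negbTE-> _]; rewrite mul0r.
by rewrite subrr Normc.normc0.
Qed.

End OrthonormalFamilies.

Section Scaling.
Context {R : realType} (c : R).
Hypothesis c0 : 0 < c.
Local Notation mu := (@lebesgue_measure R).
Local Notation sc := (fun x : measurableTypeR R => c * x : measurableTypeR R).

Lemma measurable_scale : measurable_fun setT sc.
Proof. exact: mulrl_measurable. Qed.

Let push : {measure set (measurableTypeR R) -> \bar R} :=
  measure_function_pushforward__canonical__measure_function_Measure mu
    measurable_scale.

(** Both measures agree on intervals. *)
Lemma lebesgue_measure_scale (E : set (measurableTypeR R)) : measurable E ->
  mu E = mscale (NngNum (ltW c0)) push E.
Proof.
move=> mE; apply: lebesgue_measure_unique mE => X [[s t] _ <-] /=.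
rewrite /mscale /= /pushforward.
have -> : sc @^-1` `]s, t] = `]s / c, t / c]%classic.
  apply/seteqP; split => x /=; rewrite !in_itv/= ltr_pdivrMr// ler_pdivlMr//;
    by rewrite mulrC.
rewrite !lebesgue_measure_itv /= !lte_fin ltr_pM2r ?invr_gt0//.
case: ifP => _; last by rewrite mule0.
by rewrite -!EFinD -EFinM -mulrBl mulrCA divff ?mulr1// gt_eqF.
Qed.

Lemma integral_scale (D : set (measurableTypeR R)) (f : R -> \bar R) :
  measurable D -> measurable_fun D f -> (forall x, D x -> (0 <= f x)%E) ->
  (\int[mu]_(x in D) f x)%E =
  (c%:E * \int[mu]_(x in sc @^-1` D) f (c * x)%R)%E.
Proof.
move=> mD mf f0.
rewrite (@eq_measure_integral _ _ _ _
  (mscale (NngNum (ltW c0)) push))%E; last first.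
  by move=> A mA _; exact: lebesgue_measure_scale.
rewrite ge0_integral_mscale//; congr (_ * _)%E.
rewrite (ge0_integral_pushforward measurable_scale)//.
by move=> x /set_mem; exact: f0.
Qed.

End Scaling.

(** * Dilation-modulation shifts and an orthonormal basis made of them *)

Section Atoms.
Context {R : realType} (a : R).
Hypothesis a1 : 1 < a.
Local Notation mu := (@lebesgue_measure R).
Local Notation D := (@Rplus R : set (measurableTypeR R)).
Local Notation L2 := (gL2 mu D).
Local Notation ip := (gip mu D).
Local Notation N := (sqn mu D).
Implicit Types (f g : R -> R[i]) (m n j k : int) (x : R) (p q r : int * int).

Let a0 : 0 < a. Proof. exact: lt_trans a1. Qed.
Let aN0 : a != 0. Proof. by rewrite gt_eqF. Qed.
Let b0 : 0 < a - 1. Proof. by rewrite subr_gt0. Qed.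

Lemma apow_gt0 j : 0 < a ^ j. Proof. exact: exprz_gt0. Qed.

Lemma RplusE x : D x = (0 < x). Proof. by rewrite /Rplus /= in_itv/= andbT. Qed.

(** The modulus of every [Lambda a m], as a complex number. *)
Definition lnorm : R[i] := ((Num.sqrt (a - 1))^-1)%:C%C.

Lemma lnormM : lnorm * lnorm = ((a - 1)^-1)%:C%C.
Proof. by rewrite -rmorphM/= -invfM -expr2 sqr_sqrtr// ltW. Qed.

Lemma lnorm_neq0 : lnorm != 0.
Proof.
apply/eqP => /(congr1 (fun z => z * lnorm)); rewrite lnormM mul0r => /eqP.
by rewrite eq_complex /= invr_eq0 gt_eqF.
Qed.

Lemma conjc_lnorm : conjc lnorm = lnorm. Proof. exact: conjcR. Qed.

(** The [Lambda] are a character divided by the square root of [a - 1], so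
    one such factor is left over in a product. *)
Lemma LambdaM m n x : Lambda a m x * Lambda a n x = lnorm * Lambda a (m + n) x.
Proof.
rewrite /Lambda -/lnorm mulrACA -mulrA; congr (_ * _); congr (_ * _).
move: (x * _) => y; rewrite -expiD intrD; congr expi.
by rewrite -!mulrDl -mulrDr.
Qed.

Lemma conjc_Lambda m x : conjc (Lambda a m x) = Lambda a (- m) x.
Proof.
rewrite /Lambda conjcM conjcR conjc_expi intrN; congr (_ * expi _).
by rewrite mulrN !mulNr.
Qed.

Lemma conjc_LambdaM m x z :
  conjc (Lambda a m x * z) = Lambda a (- m) x * conjc z.
Proof. by rewrite conjcM conjc_Lambda. Qed.

Lemma normc_Lambda_sqr m x : Normc.normc (Lambda a m x) ^+ 2 = (a - 1)^-1.
Proof.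
rewrite /Lambda Normc.normcM normc_expi mulr1 normcR real_normK ?num_real//.
by rewrite exprVn sqr_sqrtr// ltW.
Qed.

Lemma Lambda_dilationN (n : nat) m x : 0 < x -> Lambda a m (a ^+ n * x) = Lambda a m x.
Proof.
move=> x0; elim: n => [|n ih]; first by rewrite expr0 mul1r.
by rewrite exprS -mulrA Lambda_dilation ?ih// mulr_gt0// exprn_gt0.
Qed.

Lemma Lambda_dilationz j m x : 0 < x -> Lambda a m (a ^ j * x) = Lambda a m x.
Proof.
case: j => n x0; first exact: Lambda_dilationN.
rewrite NegzE; have y0 : 0 < a ^ (- n.+1%:Z) * x by rewrite mulr_gt0// exprz_gt0.
rewrite -(Lambda_dilationN n.+1 m y0) mulrA -[a ^+ n.+1]/(a ^ n.+1%:Z).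
by rewrite -expfzDr// subrr expr0z mul1r.
Qed.

(** The only discontinuous ingredient is the integer part, which is
    monotone. *)
Lemma measurable_Lambda m : cmeasurable D (Lambda a m).
Proof.
apply: cmeasurableZ; apply: cmeasurable_expi.
have mfl : measurable_fun setT (fun x : R => (Num.floor x)%:~R : R).
  apply: nondecreasing_measurable => // x y xy.
  by rewrite ler_int le_floor.
apply: measurable_funM => //; apply: measurable_funM => //.
apply: measurable_funM => //.
have -> : (fun x => a ^ (- dil_index a x)) = (fun x =>
    expR (- ln a * (Num.floor (ln x / ln a))%:~R)).
  apply/funext => x; rewrite /dil_index; move: (Num.floor _) => k.
  rewrite -powR_intmul ?(ltW a0)// /powR (negbTE aN0).
  by congr expR; rewrite intrN mulNr mulrC mulNr.
apply: measurable_funTS; apply: measurableT_comp => //.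
apply: measurable_funM => //.
have mln : measurable_fun setT (fun x : R => ln x / ln a).
  by apply: measurable_funM => //; exact: measurable_ln.
exact: (measurableT_comp mfl mln).
Qed.

Lemma dilation_preimage (c : R) : 0 < c ->
  (fun x : measurableTypeR R => c * x : measurableTypeR R) @^-1` D = D.
Proof.
move=> c0; apply/seteqP; split => x; rewrite /preimage /mkset !RplusE;
  by rewrite pmulr_rgt0.
Qed.

Lemma cmeasurable_scale (c : R) f : 0 < c -> cmeasurable D f ->
  cmeasurable D (fun x => f (c * x)).
Proof.
move=> c0 [f1 f2]; have ms := @measurable_scale R c.
have sub : (fun x => c * x) @` D `<=` D.
  by move=> _ [x Dx <-]; move: Dx; rewrite !RplusE => x0; rewrite mulr_gt0.
split.
  by apply: (measurable_comp (f := fun x => complex.Re (f x)) mRplus sub f1);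
    exact: measurable_funTS.
by apply: (measurable_comp (f := fun x => complex.Im (f x)) mRplus sub f2);
  exact: measurable_funTS.
Qed.

Lemma gsq_dilation (c : R) f : 0 < c -> cmeasurable D f ->
  gsq mu D (dilation c f) = gsq mu D f.
Proof.
move=> c0 mf; rewrite /gsq [in RHS](integral_scale c0 mRplus).
- rewrite dilation_preimage// -ge0_integralZl//.
  + apply: eq_integral => x _; rewrite -EFinM /dilation Normc.normcM exprMn.
    by rewrite normcR real_normK ?num_real// sqr_sqrtr// ltW.
  + exact: mRplus.
  + apply/measurable_EFinP.
    exact: (measurable_normc_sqr (cmeasurable_scale c0 mf)).
  + by move=> x _; rewrite lee_fin sqr_ge0.
  + by rewrite lee_fin ltW.
- by apply/measurable_EFinP; exact: measurable_normc_sqr.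
- by move=> x _; rewrite lee_fin sqr_ge0.
Qed.

Lemma gL2_dilation (c : R) f : 0 < c -> L2 f -> L2 (dilation c f).
Proof.
move=> c0 [mf fo]; split; last by rewrite gsq_dilation.
by apply: cmeasurableZ; exact: cmeasurable_scale.
Qed.

Lemma gip_dilation (c : R) f g : 0 < c -> L2 f -> L2 g ->
  ip (dilation c f) (dilation c g) = ip f g.
Proof.
move=> c0 Lf Lg; apply: (gip_polarization mRplus mRplus);
  try exact: gL2_dilation; try by [].
- move=> z; rewrite /sqn; congr fine.
  rewrite -[RHS](gsq_dilation c0); last first.
    exact: cmeasurableD (cmeasurableZ _ Lf.1) Lg.1.
  by apply: eq_gsq => x _; rewrite /dilation mulrDr !mulrA (mulrC z).
- by rewrite /sqn gsq_dilation//; exact: Lf.1.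
Qed.

Lemma dilationM (c e : R) f x : 0 < c -> 0 < e ->
  dilation c (dilation e f) x = dilation (e * c) f x.
Proof.
move=> c0 e0; rewrite /dilation mulrA -rmorphM/= sqrtrM ?ltW// [e * c]mulrC.
by rewrite mulrCA mulrA [Num.sqrt c * _]mulrC.
Qed.

Lemma dilation1 f x : dilation 1 f x = f x.
Proof. by rewrite /dilation sqrtr1 !mul1r. Qed.

Definition atom p f x : R[i] := Lambda a p.1 x * dilation (a ^ p.2) f x.

Lemma gL2_Lambda m f : L2 f -> L2 (fun x => Lambda a m x * f x).
Proof.
apply: (@gL2M _ _ _ _ _ mRplus _ (a - 1)^-1); first exact: measurable_Lambda.
by move=> x _; rewrite normc_Lambda_sqr.
Qed.

Lemma gL2_atom p f : L2 f -> L2 (atom p f).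
Proof. by move=> Lf; apply: gL2_Lambda; exact: gL2_dilation (apow_gt0 _) Lf. Qed.

(** Apply the unitary dilation by [a ^ j] to the right-hand side. It leaves
    [Lambda] unchanged and adds [j] to the dilation index, and the
    modulations combine because the [Lambda] multiply like characters. *)
Lemma gip_atom p q f g : L2 f -> L2 g ->
  ip (atom p f) (atom q g) = lnorm * ip f (atom (q - p) g).
Proof.
case: p q => [m j] [n k] Lf Lg.
have ja := apow_gt0 j.
rewrite -(gip_dilation ja Lf (gL2_atom _ Lg)) -gipZl//; last 3 first.
- exact: mRplus.
- exact: gL2_dilation.
- by apply: gL2_dilation => //; exact: gL2_atom.
apply: eq_cint => x; rewrite RplusE => x0.
have -> : dilation (a ^ j) (atom ((n, k) - (m, j)) g) x =
    Lambda a (n - m) x * dilation (a ^ k) g x.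
  rewrite {1}/dilation /atom /= Lambda_dilationz// mulrCA; congr (_ * _).
  rewrite -[_ * dilation _ _ _]/(dilation (a ^ j) (dilation (a ^ (k - j)) g) x).
  by rewrite dilationM ?apow_gt0// -expfzDr// subrK.
rewrite /atom /= !conjc_LambdaM mulrACA LambdaM opprB.
by rewrite mulrACA.
Qed.

Lemma gip_atom_l p q f g : L2 f -> L2 g ->
  ip (atom p f) (atom q g) = lnorm * ip (atom (p - q) f) g.
Proof.
move=> Lf Lg; rewrite (gipJ mRplus (gL2_atom q Lg) (gL2_atom p Lf)).
rewrite gip_atom// conjcM conjc_lnorm -gipJ//; first exact: mRplus.
exact: gL2_atom.
Qed.

Local Notation I1 := (`[1, a[%classic : set (measurableTypeR R)).

Definition chi x : R[i] := (\1_I1 x)%:C%C.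

Lemma I1E : I1 = `[1, 1 + (a - 1)[%classic.
Proof. by rewrite addrC subrK. Qed.

Lemma measure_I1 : mu I1 = (a - 1)%:E.
Proof. by rewrite I1E; exact: measure_period. Qed.

Lemma I1_Rplus : I1 `<=` D.
Proof.
by move=> x; rewrite RplusE /= in_itv/= => /andP[x1 _]; exact: lt_le_trans x1.
Qed.

Lemma cmeasurable_chi (E : set (measurableTypeR R)) : cmeasurable E chi.
Proof.
split => /=; last exact: measurable_cst.
have m1 : measurable I1 by exact: measurable_itv.
exact: (measurable_indic m1).
Qed.

Lemma cint_chi f : cint mu D (fun x => f x * chi x) = cint mu I1 f.
Proof.
have indE (h : R -> R) : Rintegral mu D (fun x => h x * \1_I1 x) = Rintegral mu I1 h.
  rewrite -[in RHS](setIidr I1_Rplus) Rintegral_mkcondr.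
  apply: eq_Rintegral => x _; rewrite patchE indicE.
  by case: (x \in I1); rewrite ?mulr1 ?mulr0.
apply: complex_eq => /=; rewrite -indE; apply: eq_Rintegral => x _.
  by rewrite ReM /= mulr0 subr0.
by rewrite ImM /= mulr0 add0r.
Qed.

Lemma conjc_chi x : conjc (chi x) = chi x. Proof. exact: conjcR. Qed.

Lemma chiM x : chi x * chi x = chi x.
Proof.
rewrite /chi -rmorphM/= indicE.
by case: (_ \in _); rewrite ?mulr1 ?mulr0.
Qed.

Lemma gL2_chi : L2 chi.
Proof.
split; first exact: cmeasurable_chi.
rewrite /gsq; under eq_integral => x _.
  rewrite normcR real_normK ?num_real//.
  have -> : \1_I1 x ^+ 2 = \1_I1 x :> R.
    by rewrite indicE; case: (_ \in _); rewrite ?expr1n ?expr0n.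
  over.
rewrite integral_indic//.
  rewrite setIidl; last exact: I1_Rplus.
  by rewrite [X in (X < _)%E]measure_I1 ltry.
exact: mRplus.
Qed.

(** The basis element with index (m, j) is supported on [a^(-j), a^(1-j));
    for different [j] these intervals tile the half line, and for fixed [j]
    the basis elements are the exponentials of that interval. *)
Definition batom p := atom p chi.

Lemma gL2_batom p : L2 (batom p).
Proof. exact/gL2_atom/gL2_chi. Qed.

Lemma batom_disjoint p x : D x -> p.2 != 0 -> batom p x * chi x = 0.
Proof.
case: p => m j /=; rewrite RplusE => x0 j0; rewrite /batom /atom /dilation /chi /=.
rewrite !indicE !mem_setE !in_itv/=.
case: (boolP (1 <= x < a)) => [/andP[x1 xa]|_]; last by rewrite mulr0.
suff -> : (1 <= a ^ j * x < a) = false by rewrite !mulr0 mul0r.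
apply/negbTE/negP => /andP[y1 ya].
have [jp|jn|/eqP j00] := ltgtP j 0; last by move: j0; rewrite j00.
  have : a ^ j <= a^-1 by rewrite -exprN1 ler_eXz2l//; lia.
  move=> h; have := ler_wpM2r (ltW x0) h; rewrite leNgt => /negP; apply.
  apply: lt_le_trans y1; rewrite mulrC ltr_pdivrMr// mul1r.
  exact: xa.
have : a <= a ^ j by rewrite -{1}(expr1z a) ler_eXz2l//; lia.
move=> h; have := ler_wpM2r (ltW x0) h; rewrite leNgt => /negP; apply.
by apply: (lt_le_trans ya); rewrite ler_peMr// ltW.
Qed.

Lemma gip_batom_chi r : lnorm * ip (batom r) chi = (r == 0)%:R.
Proof.
case: (boolP (r.2 == 0)) => [|r2].
  case: r => m j /= /eqP ->; rewrite xpair_eqE eqxx andbT.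
  have -> : ip (batom (m, 0)) chi = cint mu I1 (fun x => Lambda a m x).
    rewrite -cint_chi; apply: eq_cint => x _.
    by rewrite conjc_chi /batom /atom /= expr0z dilation1 -mulrA chiM.
  have -> : cint mu I1 (Lambda a m) =
      cint mu I1 (fun x => lnorm * fexp (a - 1) m x).
    apply: eq_cint => x /=; rewrite in_itv/= => /andP[x1 xa].
    by rewrite Lambda_base.
  rewrite cintZ; last 2 first.
  - exact: measurable_itv.
  - rewrite I1E; apply: (integrable_bounded_period b0 (K := 1)).
      exact: cmeasurable_fexp.
    by move=> x _; rewrite normc_fexp.
  rewrite mulrA lnormM I1E (fexp_integral 1 b0).
  case: eqP => // _; last by rewrite mulr0.
  by rewrite -rmorphM/= mulVf// gt_eqF.
rewrite (_ : ip _ _ = 0) ?mulr0.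
  by case: r r2 => m j /= /negbTE j0; rewrite xpair_eqE j0 andbF.
rewrite /gip (@eq_cint _ _ _ _ _ _ (fun=> 0)).
  by apply: complex_eq; rewrite /= Rintegral_cst ?mul0r//; exact: mRplus.
by move=> x Dx; rewrite conjc_chi batom_disjoint.
Qed.

(** Moving one shift to the other side leaves a single inner product with
    [chi], which is zero by disjointness of supports or is the integral of
    an exponential over its period. *)
Lemma batom_orthonormal p q : ip (batom p) (batom q) = (p == q)%:R.
Proof.
rewrite /batom gip_atom_l; try exact: gL2_chi.
by rewrite gip_batom_chi subr_eq0.
Qed.

(** Written as an exponential cut off to one of its periods, the form to
    which Fourier uniqueness applies. *)
Lemma batomE m j x : batom (m, j) x =
  (lnorm * (Num.sqrt (a ^ j))%:C%C) * (fexp (a ^ (- j) * (a - 1)) m x *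
   (\1_(`[a ^ (- j), a ^ (- j) + a ^ (- j) * (a - 1)[%classic : set R) x)%:C%C).
Proof.
have aj := apow_gt0 j; have ajn := apow_gt0 (- j).
have E : a ^ j * a ^ (- j) = 1 by rewrite -expfzDr// subrr expr0z.
rewrite /batom /atom /dilation /chi /= !indicE !mem_setE !in_itv/=.
have -> : (a ^ (- j) <= x < a ^ (- j) + a ^ (- j) * (a - 1)) =
    (1 <= a ^ j * x < a).
  congr (_ && _); first by rewrite -[LHS](ler_pM2l aj) E.
  rewrite -[LHS](ltr_pM2l aj) mulrDr mulrA E mul1r addrC subrK.
  by [].
case: (boolP (1 <= a ^ j * x < a)) => [/andP[y1 ya]|_]; last by rewrite !mulr0.
have x0 : 0 < x by have := lt_le_trans ltr01 y1; rewrite pmulr_rgt0.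
rewrite !mulr1 -(Lambda_dilationz j m x0) Lambda_base// -/lnorm /fexp.
rewrite mulrAC; congr (_ * _ * expi _).
have -> : a ^ (- j) = (a ^ j)^-1 by rewrite -invr_expz.
by field; rewrite !gt_eqF.
Qed.

(** Bernoulli's inequality. *)
Lemma apow_cover x : 0 < x -> exists n0 : nat, forall n : nat, (n0 <= n)%N ->
  (a ^+ n)^-1 <= x < a ^+ n.
Proof.
move=> x0; pose M := Num.max x x^-1.
have [n0 hn0] : exists n0 : nat, M / (a - 1) < n0%:R.
  by exists (Num.truncn (M / (a - 1))).+1; exact: truncnS_gt.
exists n0 => n n0n; have Mn : M < a ^+ n.
  have := @bernoulli_le R (a - 1) n (ltW b0); have -> : 1 + (a - 1) = a by rewrite addrC subrK.
  apply: lt_le_trans; rewrite ltr_wpDl// -ltr_pdivrMr//.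
  by rewrite (lt_le_trans hn0)// ler_nat.
move: Mn; rewrite /M gt_max => /andP[xn xVn]; rewrite xn andbT.
by rewrite -[leRHS]invrK lef_pV2 ?posrE ?exprn_gt0 ?invr_gt0// ltW.
Qed.

(** On each interval [a^j, a^(j+1)) the exponentials produce the indicators
    of all Borel subsets; finitely many of these intervals make up [a^(-n),
    a^n), and these exhaust the half line. *)
Lemma batom_total : total_family mu D batom.
Proof.
move=> V cV Vb f Lf; have [A Z _] := cV.
have Vj j (E : set (measurableTypeR R)) : measurable E ->
    V (fun x => (\1_(E `&` `[a ^ j, a ^ (j + 1)[%classic) x)%:C%C).
  move=> mE; have ajn := apow_gt0 j.
  have T0 : 0 < a ^ j * (a - 1) by rewrite mulr_gt0.
  have := @closed_subspace_period R D (a ^ j) _ T0 mRplus V cV _ E mE.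
  have -> : a ^ (j + 1) = a ^ j + a ^ j * (a - 1).
    by rewrite expfzDr// expr1z; ring.
  apply=> m; have := Vb (m, - j); set c := lnorm * (Num.sqrt (a ^ (- j)))%:C%C.
  have c0 : c != 0.
    rewrite mulf_neq0 ?lnorm_neq0// eq_complex /= negb_and.
    by rewrite gt_eqF// sqrtr_gt0 apow_gt0.
  move/(Z c^-1); congr V; apply/funext => x.
  by rewrite batomE -/c mulrA mulVf// mul1r opprK.
pose U (n : nat) : set (measurableTypeR R) := `[a ^ (- n%:Z), a ^ n%:Z[%classic.
have VU (n : nat) (E : set (measurableTypeR R)) : measurable E ->
    V (fun x => (\1_(E `&` U n) x)%:C%C).
  move=> mE; elim: n => [|n ih].
    have := Vj 0 set0 measurable0; rewrite set0I /U oppr0 !expr0z.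
    rewrite set_itvco0 ?setI0//.
  have Vn : V (fun x => (\1_(E `&` `[a ^ n%:Z, a ^ n.+1%:Z[%classic) x)%:C%C).
    have := Vj n%:Z E mE; have -> : n%:Z + 1 = n.+1%:Z by lia.
    exact.
  have Vm : V (fun x =>
      (\1_(E `&` `[a ^ (- n.+1%:Z), a ^ (- n%:Z)[%classic) x)%:C%C).
    have := Vj (- n.+1%:Z) E mE; have -> : - n.+1%:Z + 1 = - n%:Z by lia.
    exact.
  have := A _ _ (A _ _ Vm ih) Vn.
  congr V; apply/funext => x; rewrite -!rmorphD /=; congr (_%:C%C).
  rewrite !indicE !in_setI /U !mem_setE !in_itv/=.
  have h1 : a ^ (- n.+1%:Z) <= a ^ (- n%:Z) by rewrite ler_eXz2l//; lia.
  have h2 : a ^ (- n%:Z) <= a ^ n%:Z by rewrite ler_eXz2l//; lia.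
  have h3 : a ^ n%:Z <= a ^ n.+1%:Z by rewrite ler_eXz2l//; lia.
  case: (x \in E); rewrite /= ?addr0//.
  move: (a ^ (- n.+1%:Z)) (a ^ (- n%:Z)) (a ^ n%:Z) (a ^ n.+1%:Z) h1 h2 h3.
  move=> t1 t2 t3 t4 h1 h2 h3.
  case: (leP t1 x) => k1; case: (leP t2 x) => k2; case: (leP t3 x) => k3;
    case: (ltP x t4) => k4 //=; rewrite ?addr0 ?add0r //; lra.
apply: (@closed_subspace_full _ _ _ mu D mRplus V cV U) => //.
- by move=> n; exact: measurable_itv.
- move=> x; rewrite RplusE => /apow_cover[n0 hn0]; exists n0 => n /hn0.
  by rewrite /U /= in_itv/= -exprnN.
Qed.

End Atoms.

(** * Duality as a relation between shifts *)

Section NetReindex.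
Context {R : realType} {I : choiceType} {L : nat}.

(** A finite set of pairs that contains suitable finite subsets of all fibres
    suffices, because there are only finitely many fibres. The involution serves
    to reflect the index in the comparison with Parseval sums. *)
Lemma nlim_fibres (u : 'I_L -> I -> R[i]) (s : 'I_L -> R[i]) (sg : I -> I) :
  involutive sg ->
  (forall l, nlim (fun F : {fset I} => \sum_(i <- F) u l i) (s l)) ->
  nlim (fun F : {fset I * 'I_L} => \sum_(x <- F) u x.2 (sg x.1))
       (\sum_(l < L) s l).
Proof.
move=> sgK us e e0; have L0 : 0 < L%:R + 1 :> R by rewrite ltr_wpDl.
have /choice[F hF] : forall l, exists F : {fset I}, forall G : {fset I},
    (F `<=` G)%fset -> Normc.normc (s l - \sum_(i <- G) u l i) < e / (L%:R + 1).
  by move=> l; apply: us; exact: divr_gt0.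
exists (\bigcup_(l <- enum 'I_L) [fset (sg i, l) | i in F l])%fset => G FG.
pose Gl l := [fset sg x.1 | x in [fset y in G | y.2 == l]]%fset.
have -> : \sum_(x <- G) u x.2 (sg x.1) = \sum_(l < L) \sum_(i <- Gl l) u l i.
  rewrite [LHS](partition_big (fun x => x.2) xpredT)//=.
  apply: eq_bigr => l _; rewrite big_imfset /=; last first.
    move=> [x1 x2] [y1 y2]; rewrite !inE /= => /andP[_ /eqP->] /andP[_ /eqP->].
    by move=> /(inv_inj sgK) ->.
  by rewrite -big_fset_condE; apply: eq_bigr => x /eqP ->.
have FGl l : (F l `<=` Gl l)%fset.
  apply/fsubsetP => i iF; apply/imfsetP; exists (sg i, l) => /=; last by rewrite sgK.
  rewrite !inE eqxx andbT; apply: (fsubsetP FG); apply/bigfcupP; exists l.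
    by rewrite mem_enum.
  by apply/imfsetP; exists i.
rewrite -sumrB (le_lt_trans (normc_sum _ _))//.
apply: (@le_lt_trans _ _ (\sum_(l < L) e / (L%:R + 1))).
  by apply: ler_sum => l _; apply/ltW/hF.
rewrite sumr_const card_ord -(mulr_natl (e / _)) mulrA ltr_pdivrMr//.
by rewrite mulrC ltr_pM2l// ltrDl.
Qed.

End NetReindex.

Section DualityCriterion.
Context {R : realType} (a : R).
Hypothesis a1 : 1 < a.
Local Notation mu := (@lebesgue_measure R).
Local Notation D := (@Rplus R : set (measurableTypeR R)).
Local Notation L2 := (gL2 mu D).
Local Notation ip := (gip mu D).
Context {L : nat} (psi phi : 'I_L -> R -> R[i]).
Hypotheses (Lpsi : forall l, L2 (psi l)) (Lphi : forall l, L2 (phi l)).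

Lemma MDE (f : 'I_L -> R -> R[i]) i : MD f a i = atom a i.1 (f i.2).
Proof. by case: i => [[m j] l]. Qed.

Lemma gL2_MD (f : 'I_L -> R -> R[i]) : (forall l, L2 (f l)) ->
  forall i, L2 (MD f a i).
Proof. by move=> Lf i; rewrite MDE; exact: gL2_atom. Qed.

Lemma batom_parseval f k : L2 f -> L2 k ->
  weak_identity mu D (batom a) (batom a) f k.
Proof.
apply: (orthonormal_parseval mRplus).
- exact: gL2_batom.
- exact: batom_orthonormal.
- exact: batom_total.
Qed.

(** Since shifts move from one argument to the other, the mixed sums over the
    two systems are Parseval sums over the orthonormal basis, and depend only on
    the difference of the basis indices. *)
Lemma nlim_frame_sum_batom p q :
  nlim (frame_sum mu D (MD psi a) (MD phi a) (batom a p) (batom a q))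
       (lnorm a * \sum_(l < L) ip (atom a (p - q) (psi l)) (phi l)).
Proof.
rewrite mulr_sumr; pose u (l : 'I_L) (i : int * int) : R[i] :=
  lnorm a * (ip (atom a (p - q) (psi l)) (batom a i) * ip (batom a i) (phi l)).
have us l : nlim (fun F : {fset int * int} => \sum_(i <- F) u l i)
    (lnorm a * ip (atom a (p - q) (psi l)) (phi l)).
  apply: eq_nlim (nlimZ (lnorm a) (batom_parseval (gL2_atom a1 (p - q) (Lpsi l))
    (Lphi l))) => F.
  by rewrite /frame_sum mulr_sumr.
have inv : involutive (fun i : int * int => p - i) by move=> i; rewrite subKr.
apply: eq_nlim (nlim_fibres inv us) => F; apply: eq_bigr => -[i l] _ /=.
rewrite !MDE /= /u /batom.
rewrite (gip_atom_l a1 p i (gL2_chi a1) (Lphi l)).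
rewrite (gip_atom a1 i q (Lpsi l) (gL2_chi a1)).
rewrite (gip_atom a1 (p - q) (p - i) (Lpsi l) (gL2_chi a1)).
have -> : p - i - (p - q) = q - i by rewrite opprB addrC addrA subrK.
by move: (gip _ _ _ _) (gip _ _ _ _) => z w; ring.
Qed.

(** On a pair of basis elements the frame sums converge to the left-hand
    side at [r = p - q], while their inner product is 1 or 0 according to
    whether p = q; since the basis is total, equality for all [r] is the
    weak identity for all functions. *)
Lemma dual_frames_MD_iff : is_bessel (MD psi a) -> is_bessel (MD phi a) ->
  dual_frames (MD psi a) (MD phi a) <->
  forall r, lnorm a * \sum_(l < L) ip (atom a r (psi l)) (phi l) = (r == 0)%:R.
Proof.
move=> /is_bessel_bound[Cg Cg0 Bg] /is_bessel_bound[Ch Ch0 Bh].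
have LMpsi := gL2_MD Lpsi; have LMphi := gL2_MD Lphi.
split=> [[_ _ H] r|H].
  have W := weak_identity_of_L2_sum LMpsi H (gL2_batom a1 r) (gL2_batom a1 0).
  have := nlim_frame_sum_batom r 0; rewrite subr0 => W'.
  by rewrite (nlim_unique W' W) batom_orthonormal.
apply: (dual_frames_of_weak_identity LMpsi Bg Bh Cg0 Ch0) => f k Lf Lk.
apply: (weak_identity_total mRplus LMpsi LMphi Bg Bh Cg0 Ch0 (gL2_batom a1)
  (batom_total a1)) => // p q.
rewrite /weak_identity batom_orthonormal// -subr_eq0 -H.
exact: nlim_frame_sum_batom.
Qed.

End DualityCriterion.

(** * Limits of fast Cauchy sequences *)

Section ComplexLimits.
Context {R : realType}.
Implicit Types (g : nat -> R[i]).

(** A limit operator defined by upper limits, so that it preserves measurability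
    even where the sequence does not converge. *)
Definition climit g : R[i] :=
  (fine (limn_esup (fun j => (complex.Re (g j))%:E)) +i*
   fine (limn_esup (fun j => (complex.Im (g j))%:E)))%C.

Lemma cmeasurable_climit d (T : measurableType d) (D : set T)
    (g : nat -> T -> R[i]) :
  (forall j, cmeasurable D (g j)) -> cmeasurable D (fun x => climit (g^~ x)).
Proof.
move=> mg; have mf (h : nat -> T -> R) : (forall j, measurable_fun D (h j)) ->
    measurable_fun D (fun x => fine (limn_esup (fun j => (h j x)%:E))).
  move=> mh; apply: (measurableT_comp (fine_measurable measurableT)).
  by apply: measurable_fun_limn_esup => j; apply/measurable_EFinP; exact: mh.
by split; apply: mf => j; have [] := mg j.
Qed.

Lemma climitE g (l1 l2 : R) : complex.Re (g j) @[j --> \oo] --> l1 ->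
  complex.Im (g j) @[j --> \oo] --> l2 -> climit g = (l1 +i* l2)%C.
Proof.
have h (u : nat -> R) l : u j @[j --> \oo] --> l ->
    fine (limn_esup (fun j => (u j)%:E)) = l.
  move=> ul; have := @cvg_limn_einf_sup R (fun j => (u j)%:E) l%:E.
  by move=> [|_ ->//]; apply: cvg_EFin; [exact: nearW|exact: ul].
by move=> h1 h2; apply: complex_eq; [exact: h h1|exact: h h2].
Qed.

Lemma cvg_bounded_variation (u : nat -> R) (B : R) :
  (forall n, \sum_(0 <= j < n) `|u j.+1 - u j| <= B) -> cvgn u.
Proof.
move=> uB; have -> : u = (fun n => u 0%N + series (telescope u) n).
  by apply/funext => n; exact: eq_sum_telescope.
apply: is_cvgD; first exact: is_cvg_cst.
apply: normed_cvg; apply: nondecreasing_is_cvgn.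
  by apply: nondecreasing_series => n _ _; exact: normr_ge0.
by exists B => _ [n _ <-]; exact: uB.
Qed.

Lemma geometric_sum_le (r : R) (n : nat) : 0 <= r <= 1 / 2 ->
  \sum_(0 <= j < n) r ^+ j <= 2.
Proof.
move=> /andP[r0 r1].
have : \sum_(0 <= j < n) r ^+ j <= 2 - 2 * r ^+ n.
  elim: n => [|n ih]; first by rewrite big_nil expr0; lra.
  rewrite big_nat_recr//= exprS; have := exprn_ge0 n r0.
  by move: (r ^+ n) (\sum_(0 <= j < n) _) ih => t s; nra.
by move=> /le_trans; apply; rewrite gerBl mulr_ge0 ?exprn_ge0.
Qed.

(** By the inequality of arithmetic and geometric means t <= 2^(-j) + 2^j
    t^2, so a weighted square sum of the increments bounds their plain sum. *)
Lemma climit_fast g (B : R) :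
  (forall n, \sum_(0 <= j < n) 2 ^+ j * Normc.normc (g j.+1 - g j) ^+ 2 <= B) ->
  complex.Re (g j) @[j --> \oo] --> complex.Re (climit g) /\
  complex.Im (g j) @[j --> \oo] --> complex.Im (climit g).
Proof.
move=> gB; have vB n : \sum_(0 <= j < n) Normc.normc (g j.+1 - g j) <= 2 + B.
  apply: (@le_trans _ _ (\sum_(0 <= j < n) ((1 / 2) ^+ j +
      2 ^+ j * Normc.normc (g j.+1 - g j) ^+ 2))).
    apply: ler_sum => j _; set t := Normc.normc _.
    have p0 : 0 < 2 ^+ j :> R by rewrite exprn_gt0.
    have -> : (1 / 2) ^+ j = (2 ^+ j)^-1 :> R by rewrite div1r exprVn.
    rewrite -(ler_pM2l p0) mulrDr divff ?gt_eqF//.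
    by have := sqr_ge0 (2 ^+ j * t - 1 / 2); rewrite !expr2; nra.
  by rewrite big_split /= lerD// geometric_sum_le//; lra.
have c1 : cvgn (fun j => complex.Re (g j)).
  apply: (@cvg_bounded_variation _ (2 + B)) => n; apply: le_trans (vB n).
  by apply: ler_sum => j _; rewrite -ReN -ReD normc_Re.
have c2 : cvgn (fun j => complex.Im (g j)).
  apply: (@cvg_bounded_variation _ (2 + B)) => n; apply: le_trans (vB n).
  by apply: ler_sum => j _; rewrite -ImN -ImD normc_Im.
by rewrite (climitE c1 c2).
Qed.

Lemma cvg_normc_sqr (g : nat -> R[i]) (l z : R[i]) :
  complex.Re (g j) @[j --> \oo] --> complex.Re l ->
  complex.Im (g j) @[j --> \oo] --> complex.Im l ->
  Normc.normc (g j - z) ^+ 2 @[j --> \oo] --> Normc.normc (l - z) ^+ 2.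
Proof.
move=> h1 h2; have sq (u : nat -> R) (v w : R) : u j @[j --> \oo] --> v ->
    (u j - w) ^+ 2 @[j --> \oo] --> (v - w) ^+ 2.
  move=> uv; under eq_fun do rewrite expr2.
  have c : u j - w @[j --> \oo] --> v - w by apply: cvgB; [|exact: cvg_cst].
  by rewrite expr2; exact: cvgM.
under eq_fun do rewrite normc_sqr ReD ImD ReN ImN.
by rewrite normc_sqr ReD ImD ReN ImN; apply: cvgD; exact: sq.
Qed.

End ComplexLimits.

Section FastCauchy.
Context d (T : measurableType d) (R : realType).
Variables (mu : {measure set T -> \bar R}) (D : set T).
Hypothesis mD : measurable D.
Local Notation L2 := (gL2 mu D).
Local Notation N := (sqn mu D).

Lemma nneseries_le (u : nat -> \bar R) (B : \bar R) :
  (forall n, 0 <= u n)%E -> (forall n, \sum_(0 <= j < n) u j <= B)%E ->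
  (\sum_(0 <= j <oo) u j <= B)%E.
Proof.
move=> u0 uB; apply: lime_le; last exact: nearW.
by apply: is_cvg_nneseries => n _ _; exact: u0.
Qed.

(** The increments, squared and weighted by 2^j, have summable integrals, so
    the sequence converges almost everywhere; Fatou's lemma then bounds the
    distance of the limit to each term. *)
Lemma fast_cauchy (g : nat -> T -> R[i]) :
  (forall j, L2 (g j)) ->
  (forall j k, (j <= k)%N -> N (fun x => g k x - g j x) <= 8^-1 ^+ j) ->
  forall j, (gsq mu D (fun x => climit (g^~ x) - g j x)%R <= (8^-1 ^+ j)%:E)%E.
Proof.
move=> Lg Ng; pose F x := climit (g^~ x).
pose S (j : nat) x : \bar R := (2 ^+ j * Normc.normc (g j.+1 x - g j x) ^+ 2)%:E.
have S0 j x : (0 <= S j x)%E by rewrite lee_fin mulr_ge0 ?sqr_ge0// exprn_ge0.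
have mg j : cmeasurable D (fun x => g j.+1 x - g j x).
  by have [] := gL2B mD (Lg j.+1) (Lg j).
have mS j : measurable_fun D (S j).
  apply/measurable_EFinP/measurable_funM => //.
  exact: measurable_normc_sqr.
have iS : (\int[mu]_(x in D) (\sum_(0 <= j <oo) S j x) <= 2%:E)%E.
  rewrite integral_nneseries//; apply: nneseries_le => [n|n].
    by apply: integral_ge0 => x _.
  have -> : (\sum_(0 <= j < n) \int[mu]_(x in D) S j x)%E =
      (\sum_(0 <= j < n) 2 ^+ j * N (fun x => g j.+1 x - g j x))%:E.
    rewrite -sumEFin; apply: eq_bigr => j _; rewrite EFinM.
    rewrite -gsqE; last exact: gL2B.
    rewrite /gsq -ge0_integralZl//.
    - by apply/measurable_EFinP; exact: measurable_normc_sqr.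
    - by move=> x _; rewrite lee_fin sqr_ge0.
  rewrite lee_fin; apply: le_trans (geometric_sum_le (r := 4^-1) n _); last lra.
  apply: ler_sum => j _; apply: le_trans (ler_wpM2l _ (Ng j j.+1 (leqnSn j))) _.
    by rewrite exprn_ge0.
  rewrite -exprMn; have -> : 2 * 8^-1 = 4^-1 :> R by field.
  by [].
have aeS : {ae mu, forall x, D x -> (\sum_(0 <= j <oo) S j x)%E \is a fin_num}.
  apply: (integrable_ae mD); apply/integrableP; split.
    exact: ge0_emeasurable_sum.
  apply: le_lt_trans (ltry 2); apply: le_trans iS.
  rewrite le_eqVlt; apply/orP; left; apply/eqP; apply: eq_integral => x _ /=.
  by rewrite gee0_abs// nneseries_ge0.
have cvgF : {ae mu, forall x, D x ->
    complex.Re (g j x) @[j --> \oo] --> complex.Re (F x) /\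
    complex.Im (g j x) @[j --> \oo] --> complex.Im (F x)}.
  apply: (ae_imp _ aeS) => x Sx Dx.
  apply: (@climit_fast _ (g^~ x) (fine (\sum_(0 <= j <oo) S j x)%E)) => n.
  rewrite -lee_fin fineK; last exact: Sx.
  rewrite -sumEFin; have := @nneseries_lim_ge R (fun j => S j x) xpredT 0 n.
  by apply=> k _ _; exact: S0.
have mF : cmeasurable D F by apply: cmeasurable_climit => j; have [] := Lg j.
move=> j; pose f k x := (Normc.normc (g (j + k)%N x - g j x) ^+ 2)%:E.
have mf k : measurable_fun D (f k).
  apply/measurable_EFinP/measurable_normc_sqr.
  by have [] := gL2B mD (Lg (j + k)%N) (Lg j).
have f0 k x : D x -> (0 <= f k x)%E by move=> _; rewrite lee_fin sqr_ge0.
have mFg : measurable_fun D (fun x => (Normc.normc (F x - g j x) ^+ 2)%:E).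
  apply/measurable_EFinP/measurable_normc_sqr; apply: cmeasurableD => //.
  have := cmeasurableZ (-1) (Lg j).1; apply: eq_cmeasurable => x _.
  by rewrite mulN1r.
have mlf : measurable_fun D (fun x => limn_einf (f^~ x)).
  have -> : (fun x => limn_einf (f^~ x)) =
      (fun x => - limn_esup (fun k => - f k x))%E.
    by apply/funext => x; rewrite limn_esupN oppeK.
  apply: measurableT_comp => //; apply: measurable_fun_limn_esup => k.
  by apply: measurableT_comp => //.
rewrite /gsq (@ae_eq_integral _ _ _ _ _ (fun x => limn_einf (f^~ x)))//; last first.
  apply: (ae_imp _ cvgF) => x h Dx; have [h1 h2] := h Dx; apply/esym.
  apply: (@cvg_limn_einf_sup R (f^~ x) (Normc.normc (F x - g j x) ^+ 2)%:E _).1.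
  apply: cvg_EFin; first exact: nearW.
  rewrite /f /comp /=; apply: (@cvg_normc_sqr _ (fun k => g (j + k)%N x)).
    by have := h1; rewrite -(cvg_shiftn j); under eq_fun do rewrite addnC.
  by have := h2; rewrite -(cvg_shiftn j); under eq_fun do rewrite addnC.
apply: le_trans (fatou mu mD mf f0) _; rewrite limn_einf_lim.
apply: lime_le; first exact: is_cvg_einfs.
apply: nearW => n; apply: ge_ereal_inf.
exists (\int[mu]_(x in D) f n x)%E; first by exists n => //=.
rewrite -/(gsq mu D (fun x => g (j + n)%N x - g j x)) gsqE; last exact: gL2B.
by rewrite lee_fin Ng// leq_addr.
Qed.

End FastCauchy.

(** * Fourier series on the fibres *)

Section MeanSquareSums.
Context {R : realType} {I : choiceType}.
Variable D : set (measurableTypeR R).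
Hypothesis mD : measurable D.
Local Notation mu := (@lebesgue_measure R).
Local Notation L2 := (gL2 mu D).
Implicit Types (u v : I -> R -> R[i]) (F G : R -> R[i]) (S : {fset I}).

Lemma eq_L2_sum u v F G : (forall i x, D x -> u i x = v i x) ->
  (forall x, D x -> F x = G x) -> L2_sum D u F -> L2_sum D v G.
Proof.
move=> uv FG H e e0; have [S0 hS] := H e e0; exists S0 => S /hS.
rewrite [X in (X < _)%E -> _](_ : _ = sqnorm D (fun x => G x - \sum_(i <- S) v i x))//.
apply: eq_gsq => x Dx; rewrite FG//; congr (_ - _).
by apply: eq_bigr => i _; exact: uv.
Qed.

Lemma L2_sum_gL2 u F : (forall i, L2 (u i)) -> cmeasurable D F ->
  L2_sum D u F -> L2 F.
Proof.
move=> Lu mF /(_ 1 ltr01)[S /(_ S (fsubset_refl _)) h].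
have Ls : L2 (fun x => \sum_(i <- S) u i x) by exact: gL2_sum.
have L1 : L2 (fun x => F x - \sum_(i <- S) u i x).
  split; last by apply: lt_trans h _; rewrite ltry.
  apply: cmeasurableD => //; have := cmeasurableZ (-1) Ls.1.
  by apply: eq_cmeasurable => x _; rewrite mulN1r.
by apply: eq_gL2 (gL2D mD L1 Ls) => x _; rewrite subrK.
Qed.

(** The tolerance for the first sum is reduced by the factor |c| + 1, and
    squared norms of sums cost a factor 2. *)
Lemma L2_sum_linear (c : R[i]) u v F G :
  (forall i, L2 (u i)) -> (forall i, L2 (v i)) -> L2 F -> L2 G ->
  L2_sum D u F -> L2_sum D v G ->
  L2_sum D (fun i x => c * u i x + v i x) (fun x => c * F x + G x).
Proof.
move=> Lu Lv LF LG HF HG e e0; set B := Normc.normc c + 1.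
have B0 : 0 < B by rewrite ltr_wpDl ?normc_ge0.
pose e1 := e / (2 * B); have e10 : 0 < e1 by rewrite divr_gt0// mulr_gt0.
have e20 : 0 < e / 2 by rewrite divr_gt0.
have [SF hF] := HF _ e10; have [SG hG] := HG _ e20.
exists (SF `|` SG)%fset => S hS.
have {}hF := hF S (fsubset_trans (fsubsetUl _ _) hS).
have {}hG := hG S (fsubset_trans (fsubsetUr _ _) hS).
pose r x := F x - \sum_(i <- S) u i x; pose s x := G x - \sum_(i <- S) v i x.
have Lr : L2 r by apply: gL2B => //; exact: gL2_sum.
have Ls : L2 s by apply: gL2B => //; exact: gL2_sum.
have Lcr : L2 (fun x => c * r x) by exact: gL2Z.
have -> : sqnorm D (fun x => c * F x + G x - \sum_(i <- S) (c * u i x + v i x)) =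
    gsq mu D (fun x => c * r x + s x).
  by apply: eq_gsq => x _; rewrite /r /s big_split/= -mulr_sumr; ring.
have {}hF : sqn mu D r < e1 ^+ 2 by rewrite -lte_fin -gsqE.
have {}hG : sqn mu D s < (e / 2) ^+ 2 by rewrite -lte_fin -gsqE.
rewrite gsqE; last exact: gL2D.
rewrite lte_fin; apply: le_lt_trans (sqnD_le mD Lcr Ls) _.
rewrite sqnZ//.
have e1E : (e1 * B) ^+ 2 = (e / 2) ^+ 2.
  by congr (_ ^+ 2); rewrite /e1; field; rewrite gt_eqF.
have : Normc.normc c ^+ 2 * sqn mu D r <= (e / 2) ^+ 2.
  rewrite -e1E exprMn [leRHS]mulrC; apply: ler_pM.
  - exact: sqr_ge0.
  - exact: sqn_ge0.
  - by rewrite ler_sqr ?nnegrE ?normc_ge0 ?(ltW B0)// lerDl.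
  - exact: ltW.
have -> : e ^+ 2 = 4 * (e / 2) ^+ 2 by field.
by move: hG; lra.
Qed.

Lemma gsq_mul_modulus (b h : R -> R[i]) (K : R) : 0 <= K ->
  (forall x, D x -> Normc.normc (b x) ^+ 2 = K) -> cmeasurable D h ->
  gsq mu D (fun x => b x * h x) = (K%:E * gsq mu D h)%E.
Proof.
move=> K0 bK mh; rewrite /gsq -ge0_integralZl//.
- apply: eq_integral => x /set_mem Dx.
  by rewrite -EFinM Normc.normcM exprMn bK.
- by apply/measurable_EFinP; exact: measurable_normc_sqr.
- by move=> x _; rewrite lee_fin sqr_ge0.
Qed.

End MeanSquareSums.

Section MeanSquareShift.
Context {R : realType}.
Variable D : set (measurableTypeR R).
Hypothesis mD : measurable D.

(** Multiplication by a function of constant modulus scales all distances,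
    and a shift of the index permutes the finite subsets. *)
Lemma L2_sum_mul_shift (j : int) (b : R -> R[i]) (K : R) (u : int -> R -> R[i]) F :
  (forall x, D x -> Normc.normc (b x) ^+ 2 = K) ->
  (forall l, cmeasurable D (u l)) -> cmeasurable D F -> L2_sum D u F ->
  L2_sum D (fun l x => b x * u (l + j) x) (fun x => b x * F x).
Proof.
have [->|/set0P[x0 Dx0]] := eqVneq D set0.
  move=> _ _ _ _ e e0; exists fset0 => S _.
  by rewrite /sqnorm integral_set0 lte_fin exprn_gt0.
move=> bK mu_ mF H e e0.
have K0 : 0 <= K by rewrite -(bK _ Dx0) sqr_ge0.
have e10 : 0 < e / (K + 1) by rewrite divr_gt0// ltr_wpDl.
have [S0 hS] := H _ e10.
exists [fset (k - j)%R | k in S0]%fset => S S0S.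
pose S1 := [fset (l + j)%R | l in S]%fset.
have S01 : (S0 `<=` S1)%fset.
  apply/fsubsetP => k kS; apply/imfsetP; exists (k - j); last by rewrite subrK.
  by apply: (fsubsetP S0S); apply/imfsetP; exists k.
have mr : cmeasurable D (fun x => F x - \sum_(k <- S1) u k x).
  apply: cmeasurableD => //.
  have := cmeasurableZ (-1) (cmeasurable_sum S1 mu_).
  by apply: eq_cmeasurable => x _; rewrite mulN1r.
have -> : sqnorm D (fun x => b x * F x - \sum_(l <- S) b x * u (l + j) x) =
    gsq lebesgue_measure D (fun x => b x * (F x - \sum_(k <- S1) u k x)).
  apply: eq_gsq => x _; rewrite -mulr_sumr mulrBr /S1 big_imfset//=.
  by move=> l l' _ _ /addIr.
rewrite (gsq_mul_modulus mD K0 bK mr).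
apply: (@le_lt_trans _ _ (K%:E * ((e / (K + 1)) ^+ 2)%:E)%E).
  by rewrite lee_wpmul2l ?lee_fin// ltW// hS.
rewrite -EFinM lte_fin exprMn mulrCA -[ltRHS]mulr1 ltr_pM2l ?exprn_gt0//.
rewrite exprVn ltr_pdivrMr ?mul1r ?exprn_gt0 ?ltr_wpDl//; nra.
Qed.

End MeanSquareShift.

Section FourierFibre.
Context {R : realType}.
Local Notation mu := (@lebesgue_measure R).
Local Notation J := (`[0, 1[%classic : set (measurableTypeR R)).
Local Notation L2 := (gL2 mu J).
Local Notation N := (sqn mu J).
Implicit Types (c : int -> R[i]) (F : R -> R[i]) (S : {fset int}).

(** The sign is that of the Theta series. *)
Definition eJ (l : int) (xi : R) : R[i] := fexp 1 (- l) xi.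

Lemma mJ : measurable J. Proof. exact: measurable_itv. Qed.

Lemma measure_J : mu J = 1%:E.
Proof. by have := @measure_period R 0 1 ltr01; rewrite add0r. Qed.

Lemma gL2_eJ l : L2 (eJ l).
Proof.
split; first exact: cmeasurable_fexp.
rewrite /gsq (@eq_integral _ _ _ _ _ (cst 1%:E)); last first.
  by move=> x _; rewrite normc_fexp expr1n.
by rewrite integral_cst ?mul1e ?[X in (X < _)%E]measure_J ?ltry//; exact: mJ.
Qed.

Lemma eJ_orthonormal i j : gip mu J (eJ i) (eJ j) = (i == j)%:R.
Proof.
have -> : gip mu J (eJ i) (eJ j) = cint mu J (fexp 1 (j - i)).
  by apply: eq_cint => x _; rewrite /eJ -fexpN opprK addrC fexpD.
have := @fexp_integral R 0 1 ltr01 (j - i); rewrite add0r => ->.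
by rewrite subr_eq0 eq_sym; case: eqP.
Qed.

Lemma eJ_periodic l xi : eJ l (xi + 1) = eJ l xi.
Proof.
have := @fexp_periodic R 1 (- l) 1 xi (oner_neq0 R).
by rewrite mulr1.
Qed.

Definition fourier_sum c S : R -> R[i] := fun xi => \sum_(l <- S) c l * eJ l xi.

Lemma gL2_fourier_sum c S : L2 (fourier_sum c S).
Proof. by apply: gL2_sum => [|l]; [exact: mJ|apply: gL2Z; [exact: mJ|exact: gL2_eJ]]. Qed.

(** Parseval for a mean-square sum: the defect [N F - sum |c|^2] is the squared
    distance to the partial sum. *)
Lemma fibre_norm c F : cmeasurable J F ->
  L2_sum J (fun l xi => c l * eJ l xi) F ->
  gsq mu J F = (\esum_(l in [set: int]) (Normc.normc (c l) ^+ 2)%:E)%E.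
Proof.
move=> mF H.
have LF : L2 F.
  by apply: (L2_sum_gL2 mJ _ mF H) => l; apply: gL2Z; [exact: mJ|exact: gL2_eJ].
have dist e : 0 < e -> exists S0, forall S, (S0 `<=` S)%fset ->
    N (fun xi => F xi - fourier_sum c S xi) < e ^+ 2.
  move=> /H[S0 hS]; exists S0 => S /hS; rewrite -lte_fin -gsqE//.
  by apply: gL2B; [exact: mJ|exact: LF|exact: gL2_fourier_sum].
have cE l : gip mu J F (eJ l) = c l.
  apply/eqP; rewrite -subr_eq0; apply/eqP/normc_eq0P/le_anti.
  rewrite normc_ge0 andbT; apply/ler_addgt0Pr => e e0; rewrite add0r.
  have [S0 /(_ (l |` S0)%fset (fsubsetU1 _ _)) h] := dist e e0.
  have : gip mu J (fourier_sum c (l |` S0)%fset) (eJ l) = c l.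
    rewrite (orthonormal_coef mJ gL2_eJ eJ_orthonormal).
    by rewrite in_fset1U eqxx.
  move=> <-; rewrite -(gipBl mJ LF (gL2_fourier_sum c _) (gL2_eJ l)).
  rewrite -ler_sqr ?nnegrE ?normc_ge0 ?(ltW e0)//.
  have LD : L2 (fun xi => F xi - fourier_sum c (l |` S0)%fset xi).
    by apply: gL2B; [exact: mJ|exact: LF|exact: gL2_fourier_sum].
  apply: le_trans (gip_cauchy_schwarz mJ LD (gL2_eJ l)) _.
  have -> : N (eJ l) = 1.
    apply: complexI; rewrite -gip_sqn; [|exact: mJ|exact: gL2_eJ].
    by rewrite eJ_orthonormal eqxx.
  by rewrite mulr1 ltW.
rewrite gsqE//; apply/eqP; rewrite eq_le; apply/andP; split.
  apply/lee_addgt0Pr => e e0.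
  have [S0 /(_ S0 (fsubset_refl _))] := dist (Num.sqrt e) (ltac:(by rewrite sqrtr_gt0)).
  rewrite (orthonormal_dist mJ gL2_eJ eJ_orthonormal)// sqr_sqrtr ?(ltW e0)//.
  under [X in _ + X]eq_bigr do rewrite cE subrr Normc.normc0 expr0n.
  rewrite [X in _ + X]big1// addr0 ltrBlDr => h.
  apply: (@le_trans _ _ (e + \sum_(i <- S0) Normc.normc (c i) ^+ 2)%:E).
    rewrite lee_fin ltW// (lt_le_trans h)// lerD2l.
    by apply: ler_sum => i _; rewrite cE.
  by rewrite EFinD addeC leeD2r// esum_fset_ge.
apply: esum_le_fset => S; rewrite lee_fin.
have := orthonormal_bessel mJ gL2_eJ eJ_orthonormal S LF; rewrite mul1r.
by under eq_bigr do rewrite cE.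
Qed.

(** Once a finite set captures almost all of the energy of the coefficients,
    every larger partial sum is close to the one over that set; so it
    suffices that [F] is close to some partial sums of this kind. *)
Lemma fibre_L2_sum c F (E : R) :
  (\esum_(l in [set: int]) (Normc.normc (c l) ^+ 2)%:E)%E = E%:E ->
  cmeasurable J F ->
  (forall e : R, 0 < e -> exists S, E - \sum_(l <- S) Normc.normc (c l) ^+ 2 <= e /\
     (gsq mu J (fun xi => F xi - fourier_sum c S xi)%R <= e%:E)%E) ->
  L2_sum J (fun l xi => c l * eJ l xi) F.
Proof.
move=> cE mF H e e0; pose e' := e ^+ 2 / 8.
have e'0 : 0 < e' by rewrite divr_gt0// exprn_gt0.
have [S0 [hE hF]] := H _ e'0; exists S0 => S S0S.
have L1 : L2 (fun xi => F xi - fourier_sum c S0 xi).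
  split; last by apply: le_lt_trans hF _; rewrite ltry.
  apply: cmeasurableD => //.
  have := cmeasurableZ (-1) (gL2_fourier_sum c S0).1.
  by apply: eq_cmeasurable => x _; rewrite mulN1r.
pose r : R -> R[i] := fun xi => - 1 * fourier_sum c (S `\` S0)%fset xi.
have L3 : L2 (fourier_sum c (S `\` S0)%fset) by exact: gL2_fourier_sum.
have L2' : L2 r by apply: gL2Z; [exact: mJ|exact: L3].
have -> : sqnorm J (fun xi => F xi - \sum_(i <- S) c i * eJ i xi) =
    gsq mu J (fun xi => (F xi - fourier_sum c S0 xi) + r xi)%R.
  apply: eq_gsq => xi _; rewrite /r /fourier_sum (fset_sum_split _ S0S).
  by rewrite mulN1r opprD addrA.
rewrite gsqE; last by apply: gL2D => //; exact: mJ.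
rewrite lte_fin; apply: le_lt_trans (sqnD_le mJ L1 L2') _.
have n1 : N (fun xi => F xi - fourier_sum c S0 xi) <= e'.
  by rewrite -lee_fin -gsqE.
have n2 : N r <= e'.
  rewrite /r sqnZ; [|exact: mJ|exact: L3].
  rewrite normcNE Normc.normc1 expr1n mul1r.
  rewrite (orthonormal_sqn mJ gL2_eJ eJ_orthonormal).
  have := esum_fset_ge (fun l => Normc.normc (c l) ^+ 2) S.
  rewrite cE lee_fin (fset_sum_split _ S0S); lra.
have e'E : e' * 8 = e ^+ 2 by rewrite /e' divfK.
have := exprn_gt0 2 e0; lra.
Qed.

End FourierFibre.

Section IntegerEnumeration.

(** An explicit enumeration of the integers, whose initial segments [zset]
    exhaust them: the choice of a finite set of indices then reduces to the
    choice of a natural number, which can be made measurably. *)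
Definition zenum (n : nat) : int := if odd n then Negz n./2 else Posz n./2.

Definition zrank (l : int) : nat :=
  match l with Posz m => m.*2 | Negz m => m.*2.+1 end.

Lemma zenumK : cancel zenum zrank.
Proof.
move=> n; rewrite /zenum /zrank -[RHS]odd_double_half.
by case: (odd n).
Qed.

Lemma zrankK : cancel zrank zenum.
Proof.
case=> m; rewrite /zenum /zrank /=; first by rewrite odd_double doubleK.
by rewrite odd_double /= uphalf_double.
Qed.

Lemma zenum_bij : set_bij [set: nat] [set: int] zenum.
Proof.
split => //; first by move=> x y _ _; exact: (can_inj zenumK).
by move=> l _; exists (zrank l) => //; exact: zrankK.
Qed.

Fixpoint zset (n : nat) : {fset int} :=
  if n is k.+1 then (zenum k |` zset k)%fset else fset0.

Lemma in_zset n l : (l \in zset n) = (zrank l < n)%N.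
Proof.
elim: n => [|n ih]; first by rewrite inE.
rewrite /= in_fset1U ih ltnS [in RHS]leq_eqVlt; congr (_ || _).
by apply/eqP/eqP => [->|<-]; rewrite ?zenumK ?zrankK.
Qed.

Lemma zset_sub m n : (m <= n)%N -> (zset m `<=` zset n)%fset.
Proof.
by move=> mn; apply/fsubsetP => l; rewrite !in_zset => /leq_trans; apply.
Qed.

Lemma sum_zset (V : nmodType) (u : int -> V) n :
  \sum_(l <- zset n) u l = \sum_(0 <= k < n) u (zenum k).
Proof.
elim: n => [|n ih]; first by rewrite big_nil big_seq_fset0.
rewrite big_nat_recr//= -ih big_fsetU1/=; first by rewrite addrC.
by rewrite in_zset zenumK ltnn.
Qed.

End IntegerEnumeration.

Section Energy.
Context {R : realType} (a : R).
Hypothesis a1 : 1 < a.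
Local Notation mu := (@lebesgue_measure R).
Local Notation D := (@Rplus R : set (measurableTypeR R)).
Local Notation L2 := (gL2 mu D).
Implicit Types (f : R -> R[i]) (k l : int) (x : R).

Definition fibre_coef f x (l : int) : R[i] := dilation (a ^ l) f x.

Definition energy f x : \bar R :=
  (\esum_(l in [set: int]) (Normc.normc (fibre_coef f x l) ^+ 2)%:E)%E.

Lemma energy_series f x : energy f x =
  (\sum_(0 <= n <oo) (Normc.normc (fibre_coef f x (zenum n)) ^+ 2)%:E)%E.
Proof.
rewrite /energy (reindex_esum [set: nat] _ zenum)//; last exact: zenum_bij.
rewrite nneseries_esum//; last by move=> n _; rewrite lee_fin sqr_ge0.
by congr esum; apply/seteqP; split.
Qed.

Definition aint k : set (measurableTypeR R) := `[a ^ k, a ^ (k + 1)[%classic.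

Lemma aint_Rplus k : aint k `<=` D.
Proof.
move=> x; rewrite RplusE /aint /= in_itv/= => /andP[h _].
by apply: lt_le_trans h; exact: apow_gt0.
Qed.

Lemma aint_dil_index x : 0 < x -> aint (dil_index a x) x.
Proof.
move=> x0; have la : 0 < ln a by rewrite ln_gt0.
rewrite /aint /dil_index /= in_itv/=.
have /andP[h1 h2] := floor_itv (ln x / ln a).
move: h1 h2; rewrite ler_pdivlMr// ltr_pdivrMr//.
move: (Num.floor _) => k h1 h2.
have ak j : a ^ j = expR (j%:~R * ln a).
  by rewrite -powR_intmul ?(ltW (lt_trans ltr01 a1))// /powR gt_eqF// (lt_trans _ a1).
by rewrite !ak -{1 2}(lnK x0) ler_expR ltr_expR h1.
Qed.

Lemma aint_disj j k x : aint j x -> aint k x -> j = k.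
Proof.
rewrite /aint /= !in_itv/= => /andP[h1 h2] /andP[h3 h4].
have H i i' : a ^ i <= x -> x < a ^ (i' + 1) -> i <= i'.
  move=> p q; have := le_lt_trans p q.
  rewrite ltr_eXz2l//.
  lia.
by apply/eqP; rewrite eq_le (H j k)// (H k j).
Qed.

Lemma maint k : measurable (aint k). Proof. exact: measurable_itv. Qed.

Lemma cmeasurable_fibre_coef f l : L2 f -> cmeasurable D (fun x => fibre_coef f x l).
Proof.
by move=> Lf; have [] := gL2_dilation (apow_gt0 a1 l) Lf.
Qed.

(** Dilation by [a ^ l] maps the interval with index [k] onto the one with
    index [k + l]. *)
Lemma aint_scale k l :
  (fun x : measurableTypeR R => a ^ l * x : measurableTypeR R) @^-1` aint (k + l)
  = aint k.
Proof.
have al := apow_gt0 a1 l; have a0 : a != 0 by rewrite gt_eqF// (lt_trans _ a1).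
have e1 : a ^ (k + l) = a ^ l * a ^ k by rewrite expfzDr// mulrC.
have e2 : a ^ (k + l + 1) = a ^ l * a ^ (k + 1).
  by rewrite -expfzDr//; congr (a ^ _); ring.
by apply/seteqP; split => x; rewrite /aint /preimage /mkset /= !in_itv/=;
  rewrite e1 e2 ler_pM2l// ltr_pM2l.
Qed.

(** Substituting a^l x in the l-th term moves the integral to another of the
    intervals [a^k, a^(k+1)), and as l varies these intervals tile the half
    line. *)
Lemma integral_energy k f : L2 f ->
  (\int[mu]_(x in aint k) energy f x)%E = gsq mu D f.
Proof.
move=> Lf; under eq_integral do rewrite energy_series.
have mE n : measurable_fun (aint k)
    (fun x => (Normc.normc (fibre_coef f x (zenum n)) ^+ 2)%:E).
  apply/measurable_EFinP/measurable_normc_sqr.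
  apply: cmeasurableS (cmeasurable_fibre_coef _ Lf); first exact: mRplus.
  exact: aint_Rplus.
rewrite integral_nneseries//; last 2 first.
- exact: maint.
- by move=> n x _; rewrite lee_fin sqr_ge0.
have blk n : (\int[mu]_(x in aint k)
      (Normc.normc (fibre_coef f x (zenum n)) ^+ 2)%:E)%E =
    (\int[mu]_(x in aint (k + zenum n)) (Normc.normc (f x) ^+ 2)%:E)%E.
  have al := apow_gt0 a1 (zenum n).
  have mf : measurable_fun (aint (k + zenum n))
      (fun x => (Normc.normc (f x) ^+ 2)%:E).
    apply/measurable_EFinP/measurable_normc_sqr.
    apply: cmeasurableS Lf.1; first exact: mRplus.
    exact: aint_Rplus.
  rewrite [RHS](integral_scale al (maint _) mf); last first.
    by move=> x _; rewrite lee_fin sqr_ge0.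
  rewrite aint_scale -ge0_integralZl//.
  - apply: eq_integral => x _; rewrite -EFinM /fibre_coef /dilation.
    by rewrite Normc.normcM exprMn normcR real_normK ?num_real// sqr_sqrtr// ltW.
  - exact: maint.
  - apply/measurable_EFinP; apply: (measurable_normc_sqr (f := fun x => f (a ^ _ * x))).
    apply: cmeasurableS (cmeasurable_scale al Lf.1); first exact: mRplus.
    exact: aint_Rplus.
  - by move=> x _; rewrite lee_fin sqr_ge0.
  - by rewrite lee_fin ltW.
under eq_eseriesr do rewrite blk.
have cover : D = \bigcup_n aint (k + zenum n).
  apply/seteqP; split => [x Dx|x [n _ /aint_Rplus//]].
  have x0 : 0 < x by move: Dx; rewrite RplusE.
  exists (zrank (dil_index a x - k)) => //.
  by rewrite zrankK addrC subrK; exact: aint_dil_index.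
rewrite /gsq [in RHS]cover ge0_integral_bigcup//.
- by move=> n; exact: maint.
- by rewrite -cover; apply/measurable_EFinP/measurable_normc_sqr; exact: Lf.1.
- by move=> x _; rewrite lee_fin sqr_ge0.
- move=> i j _ _ [x [/aint_disj h1 /h1 /addrI]].
  by move=> /(can_inj zenumK).
Qed.

Lemma measurable_energy f : L2 f -> measurable_fun D (energy f).
Proof.
move=> Lf; have -> : energy f = (fun x =>
    \sum_(0 <= n <oo) (Normc.normc (fibre_coef f x (zenum n)) ^+ 2)%:E)%E.
  by apply/funext => x; exact: energy_series.
apply: (@ge0_emeasurable_sum _ _ _ D _ xpredT) => [k x _ _|k _].
  by rewrite lee_fin sqr_ge0.
by apply/measurable_EFinP/measurable_normc_sqr; exact: cmeasurable_fibre_coef.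
Qed.

Lemma energy_ge0 f x : (0 <= energy f x)%E.
Proof. by apply: esum_ge0 => l _; rewrite lee_fin sqr_ge0. Qed.

(** The energy is integrable over each interval of the tiling. *)
Lemma energy_ae f : L2 f ->
  {ae mu, forall x, D x -> energy f x \is a fin_num}.
Proof.
move=> Lf; have ak k : {ae mu, forall x, aint k x -> energy f x \is a fin_num}.
  apply: (integrable_ae (maint k)); apply/integrableP; split.
    apply: measurable_funS (measurable_energy Lf); first exact: mRplus.
    exact: aint_Rplus.
  under eq_integral do rewrite gee0_abs ?energy_ge0//.
  by rewrite integral_energy//; have [] := Lf.
have := ae_foralln (fun n => ak (zenum n)).
apply: ae_imp => x h Dx; have x0 : 0 < x by move: Dx; rewrite RplusE.
apply: (h (zrank (dil_index a x))); rewrite zrankK.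
exact: aint_dil_index.
Qed.

End Energy.

(** * Existence of the Theta transform *)

Section ThetaTransform.
Context {R : realType} (a : R).
Hypothesis a1 : 1 < a.
Local Notation mu := (@lebesgue_measure R).
Local Notation D := (@Rplus R : set (measurableTypeR R)).
Local Notation J := (`[0, 1[%classic : set (measurableTypeR R)).
Local Notation L2 := (gL2 mu D).
Local Notation DT := (D `*` [set: measurableTypeR R]).
Implicit Types (f g : R -> R[i]) (F G : R * R -> R[i]).

Lemma Theta_termE f x l xi : Theta_term a f x l xi = fibre_coef a f x l * eJ l xi.
Proof.
have a0 : 0 < a by exact: lt_trans a1.
rewrite /Theta_term /fibre_coef /dilation /eJ /fexp.
rewrite powRrM powR_intmul ?(ltW a0)// powR12_sqrt ?ltW ?exprz_gt0//.
by congr (_ * expi _); rewrite intrN mulrN mulNr divr1.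
Qed.

Lemma mDT : measurable (DT : set (measurableTypeR R * measurableTypeR R)).
Proof. by apply: measurableX => //; exact: mRplus. Qed.

Lemma cmeasurable_fst (E : set (measurableTypeR R)) (h : R -> R[i]) :
  measurable E -> cmeasurable E h ->
  cmeasurable (E `*` [set: measurableTypeR R]) (fun z : R * R => h z.1).
Proof.
move=> mE [h1 h2]; have mX : measurable (E `*` [set: measurableTypeR R]).
  exact: measurableX.
have sub : fst @` (E `*` [set: measurableTypeR R]) `<=` E by move=> _ [z [] ? _ <-].
by split; [apply: (measurable_comp mE sub h1)|apply: (measurable_comp mE sub h2)];
  apply: measurable_funTS; exact: measurable_fst.
Qed.

Lemma cmeasurable_snd (E : set (measurableTypeR R * measurableTypeR R))
    (h : R -> R[i]) : measurable E -> cmeasurable setT h ->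
  cmeasurable E (fun z : R * R => h z.2).
Proof.
move=> mE [h1 h2]; split; apply: measurable_funTS.
  exact: (measurableT_comp h1 measurable_snd).
exact: (measurableT_comp h2 measurable_snd).
Qed.

Lemma cmeasurable_section (E : set (measurableTypeR R)) F x :
  measurable E -> E x -> cmeasurable (E `*` [set: measurableTypeR R]) F ->
  cmeasurable setT (fun xi => F (x, xi)).
Proof.
move=> mE Ex [F1 F2].
have mX : measurable (E `*` [set: measurableTypeR R]) by exact: measurableX.
have mp : measurable_fun setT (fun xi : measurableTypeR R => (x, xi)).
  exact: measurable_pair1.
have sub : (fun xi => (x, xi)) @` [set: measurableTypeR R] `<=`
  E `*` [set: measurableTypeR R] by move=> _ [xi _ <-].
by split; [apply: (measurable_comp mX sub F1)|apply: (measurable_comp mX sub F2)].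
Qed.

Lemma cmeasurable_eventually d (T : measurableType d) (E : set T)
    (p : nat -> T -> R[i]) (q : T -> R[i]) :
  (forall n, cmeasurable E (p n)) ->
  (forall z, E z -> exists n0, forall n, (n0 <= n)%N -> p n z = q z) ->
  cmeasurable E q.
Proof.
move=> mp pq; split.
  apply: (measurable_fun_cvg (fun n => (mp n).1)) => z /pq[n0 h].
  by apply: cvg_near_cst; exists n0 => // n /= /h ->.
apply: (measurable_fun_cvg (fun n => (mp n).2)) => z /pq[n0 h].
by apply: cvg_near_cst; exists n0 => // n /= /h ->.
Qed.

Section Existence.
Variable f : R -> R[i].
Hypothesis Lf : L2 f.

(** The energy of the coefficients outside the first [k] indices. *)
Let tail (k : nat) (x : R) : R := fine (energy a f x) -
  \sum_(l <- zset k) Normc.normc (fibre_coef a f x l) ^+ 2.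

(** Points at which the first [k] indices do not yet capture the energy
    up to 8^(-j). *)
Let uncaptured (j k : nat) : set (measurableTypeR R) :=
  (D `&` [set x | energy a f x < +oo]%E) `&`
  (D `&` tail k @^-1` `]8^-1 ^+ j, +oo[%classic).

Lemma measurable_tail k : measurable_fun D (tail k).
Proof.
apply: measurable_funB.
  apply: (measurableT_comp (fine_measurable measurableT)).
  exact: measurable_energy.
apply: measurable_sum => l.
exact: (measurable_normc_sqr (cmeasurable_fibre_coef a1 l Lf)).
Qed.

Lemma measurable_uncaptured j k : measurable (uncaptured j k).
Proof.
apply: measurableI.
  by apply: emeasurable_fun_infty_o; [exact: mRplus|exact: measurable_energy].
by apply: (measurable_tail k mRplus); exact: measurable_itv.
Qed.

Lemma energy_fineK x : (energy a f x < +oo)%E ->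
  energy a f x = (fine (energy a f x))%:E.
Proof. by move=> h; rewrite fineK// ge0_fin_numE// energy_ge0. Qed.

Lemma tail_ge0 k x : (energy a f x < +oo)%E -> 0 <= tail k x.
Proof.
move=> h; rewrite subr_ge0 -lee_fin -energy_fineK//.
exact: esum_fset_ge.
Qed.

Lemma tail_le j k x : (j <= k)%N -> tail k x <= tail j x.
Proof.
move=> jk; rewrite /tail lerD2l lerN2 (fset_sum_split _ (zset_sub jk)) lerDl.
by apply: sumr_ge0 => l _; exact: sqr_ge0.
Qed.

Lemma tail_small (e : R) x : 0 < e -> (energy a f x < +oo)%E ->
  exists k, tail k x <= e.
Proof.
move=> e0 h; have [S hS] := esum_adherent e0 (energy_fineK h).
have [k Sk] : exists k, (S `<=` zset k)%fset.
  exists (\max_(l <- S) (zrank l).+1)%N; apply/fsubsetP => l lS.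
  by rewrite in_zset; exact: (@leq_bigmax_seq _ _ _ (fun l => (zrank l).+1)).
exists k; rewrite /tail (fset_sum_split _ Sk).
have : 0 <= \sum_(l <- (zset k `\` S)%fset) Normc.normc (fibre_coef a f x l) ^+ 2.
  by apply: sumr_ge0 => l _; exact: sqr_ge0.
by move: hS; lra.
Qed.

(** The length of the partial sum used at [x], chosen so that the discarded
    coefficients have energy at most [8 ^ - j]; the dependence on [x] avoids any
    uniform choice of subsequence. *)
Lemma cutoff_exists j x : exists n, forall k, (k < n)%N <-> uncaptured j k x.
Proof.
have [gx|ngx] := pselect (D x /\ (energy a f x < +oo)%E); last first.
  by exists 0%N => k; split => // -[[Dx ex] _]; exfalso; exact: ngx.
have [Dx ex] := gx.
have e0 : 0 < 8^-1 ^+ j :> R by rewrite exprn_gt0.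
have ex_small : exists k, tail k x <= 8^-1 ^+ j by exact: tail_small.
exists (ex_minn ex_small); case: ex_minnP => n hn nmin k; split.
  move=> kn; do 2 split => //=; rewrite in_itv/= andbT ltNge; apply/negP => h.
  by have := nmin _ h; rewrite leqNgt kn.
move=> [_ [_]] /=; rewrite in_itv/= andbT; rewrite ltnNge => h; apply/negP => nk.
by move: h; rewrite ltNge (le_trans (tail_le x nk) hn).
Qed.

Let cutoff (j : nat) (x : R) : nat := projT1 (cid (cutoff_exists j x)).

Let cutoffP j x k : (k < cutoff j x)%N <-> uncaptured j k x.
Proof. exact: (projT2 (cid (cutoff_exists j x))). Qed.

Let partial (j : nat) (z : R * R) : R[i] :=
  fourier_sum (fibre_coef a f z.1) (zset (cutoff j z.1)) z.2.

(** The length of the sum depends on the point; with indicators of the sets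
    [uncaptured] as coefficients it is a limit of sums of constant length, which
    is attained after finitely many steps. *)
Lemma cmeasurable_partial j : cmeasurable DT (partial j).
Proof.
pose p n (z : R * R) : R[i] := \sum_(0 <= k < n) ((\1_(uncaptured j k) z.1)%:C%C *
  fibre_coef a f z.1 (zenum k)) * eJ (zenum k) z.2.
apply: (@cmeasurable_eventually _ _ _ p) => [n|[x xi] [Dx _]].
  apply: cmeasurable_sum => k; apply: cmeasurableM; last first.
    by apply: cmeasurable_snd; [exact: mDT|exact: cmeasurable_fexp].
  apply: (cmeasurable_fst (h := fun x => (\1_(uncaptured j k) x)%:C%C *
    fibre_coef a f x (zenum k))); first exact: mRplus.
  apply: cmeasurableM; last exact: cmeasurable_fibre_coef.
  split => /=; last exact: measurable_cst.
  exact: (measurable_indic (measurable_uncaptured j k)).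
exists (cutoff j x) => n hn; rewrite /p /partial /fourier_sum sum_zset /=.
rewrite (@big_cat_nat _ _ _ (cutoff j x))//= [X in _ + X](_ : _ = 0).
  rewrite addr0 !big_nat; apply: eq_bigr => k /= hk.
  by rewrite indicE mem_set ?mul1r//; exact/cutoffP.
rewrite big_nat_cond big1// => k; rewrite andbT => /andP[hk _].
rewrite indicE memNset ?mul0r//.
by move/cutoffP; rewrite ltnNge hk.
Qed.

Lemma partial_fast x j k : (energy a f x < +oo)%E -> D x -> (j <= k)%N ->
  sqn mu J (fun xi => partial k (x, xi) - partial j (x, xi)) <= 8^-1 ^+ j.
Proof.
move=> ex Dx jk; have cjk : (cutoff j x <= cutoff k x)%N.
  rewrite leqNgt; apply/negP => /cutoffP[_ [_]] /=; rewrite in_itv/= andbT => h1.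
  have : uncaptured k (cutoff k x) x.
    do 2 split => //=; rewrite in_itv/= andbT; apply: le_lt_trans h1.
    by apply: ler_wiXn2l => //; lra.
  by move/cutoffP; rewrite ltnn.
have -> : sqn mu J (fun xi => partial k (x, xi) - partial j (x, xi)) =
    sqn mu J (fourier_sum (fibre_coef a f x)
      (zset (cutoff k x) `\` zset (cutoff j x))%fset).
  apply: eq_sqn => xi _; rewrite /partial /fourier_sum /=.
  by rewrite (fset_sum_split _ (zset_sub cjk)) addrC addKr.
rewrite (orthonormal_sqn mJ gL2_eJ eJ_orthonormal).
have hj : tail (cutoff j x) x <= 8^-1 ^+ j.
  rewrite leNgt; apply/negP => h.
  have : uncaptured j (cutoff j x) x by do 2 split => //=; rewrite in_itv/= andbT.
  by move/cutoffP; rewrite ltnn.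
apply: le_trans hj; have := tail_ge0 (cutoff k x) ex.
by rewrite /tail (fset_sum_split _ (zset_sub cjk)); lra.
Qed.

(** The adaptively truncated sums converge at a geometric rate in mean
    square on almost every fibre. Their limit is jointly measurable and
    periodic because every partial sum is. *)
Lemma is_Theta_exists : exists F, is_Theta a f F.
Proof.
exists (fun z => climit (fun j => partial j z)); split.
- by apply: cmeasurable_climit => j; exact: cmeasurable_partial.
- move=> x xi x0; congr climit; apply/funext => j.
  rewrite /partial /fourier_sum /=; apply: eq_bigr => l _.
  by rewrite eJ_periodic.
- apply: (ae_imp _ (energy_ae a1 Lf)) => x ef x0.
  have Dx : D x by rewrite RplusE.
  have ex : (energy a f x < +oo)%E by rewrite -ge0_fin_numE ?ef// energy_ge0.
  have -> : Theta_term a f x = (fun l xi => fibre_coef a f x l * eJ l xi).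
    by apply/funext => l; apply/funext => xi; exact: Theta_termE.
  have Lp j : gL2 mu J (fun xi => partial j (x, xi)).
    exact: (gL2_fourier_sum (fibre_coef a f x) (zset (cutoff j x))).
  have mp j : cmeasurable J (fun xi => partial j (x, xi)) by have [] := Lp j.
  apply: (fibre_L2_sum (energy_fineK ex)).
    by apply: (cmeasurable_climit (g := fun j xi => partial j (x, xi))).
  move=> e e0.
  have [j hj] : exists j, 8^-1 ^+ j <= e :> R.
    have : (8^-1 : R) ^+ n @[n --> \oo] --> (0 : R).
      by apply: cvg_expr; rewrite ger0_norm//; lra.
    move=> /cvgr0Pnorm_lt/(_ _ e0)[n _ /(_ n (leqnn n))].
    by rewrite /= ger0_norm ?exprn_ge0// => h; exists n; exact: ltW.
  exists (zset (cutoff j x)); split.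
    rewrite leNgt; apply/negP => h.
    have : uncaptured j (cutoff j x) x.
      by do 2 split => //=; rewrite in_itv/= andbT (le_lt_trans hj).
    by move/cutoffP; rewrite ltnn.
  have := @fast_cauchy _ _ R mu J mJ (fun j xi => partial j (x, xi)) Lp
    (fun j k jk => partial_fast ex Dx jk) j.
  by move=> /le_trans; apply; rewrite lee_fin.
Qed.

Lemma Theta_is_Theta : is_Theta a f (Theta a f).
Proof. by have [F hF] := is_Theta_exists; exact: (xgetPex _ (ex_intro _ F hF)). Qed.

End Existence.
End ThetaTransform.

(** * The Fubini theorem on rectangles *)

Section Rectangles.
Context d1 d2 (T1 : measurableType d1) (T2 : measurableType d2) (R : realType).
Variables (m1 : {sigma_finite_measure set T1 -> \bar R}).
Variables (m2 : {sigma_finite_measure set T2 -> \bar R}).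
Variables (A : set T1) (B : set T2).
Hypotheses (mA : measurable A) (mB : measurable B).
Local Notation Q := (A `*` B).
Local Notation m12 := ((m1 \x m2)%E : {measure set (T1 * T2) -> \bar R}).

Let mQ : measurable Q. Proof. exact: measurableX. Qed.

(** Extension by zero reduces integrals over a rectangle to integrals over
    the whole product space. *)
Lemma fubini_F_rect (h : T1 * T2 -> \bar R) :
  fubini_F m2 (h \_ Q) = (fun x => \int[m2]_(y in B) h (x, y))%E \_ A.
Proof.
apply/funext => x; rewrite /fubini_F [in RHS]patchE; case: ifPn => xA.
  rewrite [RHS]integral_mkcond; apply: eq_integral => y _.
  by rewrite !patchE in_setX /= xA.
rewrite integral0_eq// => y _.
by rewrite patchE in_setX /= (negbTE xA).
Qed.

Lemma tonelli_rect (h : T1 * T2 -> \bar R) : measurable_fun Q h ->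
  (forall z, Q z -> (0 <= h z)%E) ->
  measurable_fun A (fun x => \int[m2]_(y in B) h (x, y))%E /\
  (\int[m12]_(z in Q) h z = \int[m1]_(x in A) \int[m2]_(y in B) h (x, y))%E.
Proof.
move=> mh h0; have mh' : measurable_fun setT (h \_ Q).
  by apply/(measurable_restrictT _ mQ).
have h0' z : (0 <= (h \_ Q) z)%E.
  by rewrite patchE; case: ifPn => // /set_mem/h0.
split.
  apply/(measurable_restrictT _ mA); rewrite -fubini_F_rect.
  exact: measurable_fun_fubini_tonelli_F.
rewrite [LHS]integral_mkcond [RHS]integral_mkcond fubini_tonelli1//.
by rewrite fubini_F_rect.
Qed.

Lemma fubini_rect (h : T1 * T2 -> R) : m12.-integrable Q (EFin \o h) ->
  [/\ {ae m1, forall x, A x -> m2.-integrable B (EFin \o (fun y => h (x, y)))},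
      m1.-integrable A (EFin \o (fun x => Rintegral m2 B (fun y => h (x, y)))) &
      Rintegral m12 Q h =
      Rintegral m1 A (fun x => Rintegral m2 B (fun y => h (x, y)))].
Proof.
move=> ih; have ih' : m12.-integrable setT ((EFin \o h) \_ Q).
  by apply/(integrable_mkcond _ mQ).
have F_ : fubini_F m2 ((EFin \o h) \_ Q) =
    (fun x => \int[m2]_(y in B) (h (x, y))%:E)%E \_ A by exact: fubini_F_rect.
have iF : m1.-integrable A (fun x => \int[m2]_(y in B) (h (x, y))%:E)%E.
  apply/(integrable_mkcond _ mA); rewrite -F_.
  exact: integrable_fubini_F.
have finF := integrable_ae mA iF.
have mF : measurable_fun A (fun x => \int[m2]_(y in B) (h (x, y))%:E)%E.
  exact: measurable_int iF.
have mfF : measurable_fun A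
    (EFin \o (fun x => Rintegral m2 B (fun y => h (x, y)))).
  apply/measurable_EFinP.
  exact: (measurableT_comp (fine_measurable measurableT) mF).
split.
- apply: (ae_imp _ (ae_integrable1 ih')) => x ix Ax.
  apply/(integrable_mkcond _ mB); apply: eq_integrable ix => // y _.
  by rewrite !patchE in_setX /= mem_set.
- apply: (le_integrable mA mfF _ iF) => x Ax /=.
  rewrite /Rintegral; case: (integral _ _ _) => [r| |] //=.
    by rewrite normr0 leey.
  by rewrite normr0 leey.
- rewrite /Rintegral; congr fine.
  rewrite [LHS]integral_mkcond -integral12_prod_meas1// F_ -integral_mkcond.
  apply: ae_eq_integral => //; apply: (ae_imp _ finF) => x fx Ax.
  by rewrite fineK// fx.
Qed.

Lemma cint_fubini (h : T1 * T2 -> R[i]) : cintegrable m12 Q h ->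
  [/\ {ae m1, forall x, A x -> cintegrable m2 B (fun y => h (x, y))},
      cintegrable m1 A (fun x => cint m2 B (fun y => h (x, y))) &
      cint m12 Q h = cint m1 A (fun x => cint m2 B (fun y => h (x, y)))].
Proof.
move=> [/fubini_rect[a1 i1 e1] /fubini_rect[a2 i2 e2]]; split => //.
  by apply: (ae_imp2 _ a1 a2) => x h1 h2 Ax; split; [exact: h1|exact: h2].
exact: complex_eq.
Qed.

End Rectangles.

Section AlmostEverywhereIntegral.
Context d (T : measurableType d) (R : realType).
Variables (mu : {measure set T -> \bar R}) (D : set T).
Hypothesis mD : measurable D.

Lemma ae_eq_cint (f g : T -> R[i]) : cmeasurable D f -> cmeasurable D g ->
  {ae mu, forall x, D x -> f x = g x} -> cint mu D f = cint mu D g.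
Proof.
move=> [f1 f2] [g1 g2] fg; apply: complex_eq; rewrite /= /Rintegral; congr fine;
  apply: ae_eq_integral => //; try exact/measurable_EFinP;
  by apply: (ae_imp _ fg) => x h /h ->.
Qed.

Lemma normc_integral0 (f : T -> R[i]) : cmeasurable D f ->
  (\int[mu]_(x in D) (Normc.normc (f x))%:E = 0)%E <->
  {ae mu, forall x, D x -> f x = 0}.
Proof.
move=> mf; have mn : measurable_fun D (fun x => (Normc.normc (f x))%:E).
  exact/measurable_EFinP/measurable_normc.
have := ae_eq_integral_abs mu mD mn.
under eq_integral do rewrite gee0_abs ?lee_fin ?normc_ge0//.
move=> ->; split => H; apply: (ae_imp _ H) => x h Dx.
  by have [/normc_eq0P] := h Dx.
by rewrite h// Normc.normc0.
Qed.

End AlmostEverywhereIntegral.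

(** * The Theta transform as an isometry *)

Section ThetaIsometry.
Context {R : realType} (a : R).
Hypothesis a1 : 1 < a.
Local Notation mu := (@lebesgue_measure R).
Local Notation mu2 := ((mu \x mu)%E).
Local Notation D := (@Rplus R : set (measurableTypeR R)).
Local Notation I1 := (`[1, a[%classic : set (measurableTypeR R)).
Local Notation J := (`[0, 1[%classic : set (measurableTypeR R)).
Local Notation L2 := (gL2 mu D).
Local Notation Q := (I1 `*` J).
Implicit Types (f g : R -> R[i]) (F G : R * R -> R[i]).

Lemma mI1 : measurable I1. Proof. exact: measurable_itv. Qed.

Lemma mQ : measurable (Q : set (measurableTypeR R * measurableTypeR R)).
Proof. by apply: measurableX; [exact: mI1|exact: mJ]. Qed.

Lemma is_Theta_section f F : is_Theta a f F ->
  {ae mu, forall x, D x -> gL2 mu J (fun xi => F (x, xi)) /\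
     L2_sum J (fun l xi => fibre_coef a f x l * eJ l xi) (fun xi => F (x, xi))}.
Proof.
move=> [mF _ hF]; apply: (ae_imp _ hF) => x h Dx.
have x0 : 0 < x by move: Dx; rewrite RplusE.
have mFx : cmeasurable J (fun xi => F (x, xi)).
  by apply: cmeasurableS (cmeasurable_section mRplus Dx mF).
have h' : L2_sum J (fun l xi => fibre_coef a f x l * eJ l xi) (fun xi => F (x, xi)).
  by apply: eq_L2_sum (h x0) => // l xi _; exact: Theta_termE.
split => //; apply: (L2_sum_gL2 _ _ mFx h'); first exact: mJ.
by move=> l; apply: gL2Z; [exact: mJ|exact: gL2_eJ].
Qed.

Lemma is_Theta_measurable f F : is_Theta a f F -> cmeasurable Q F.
Proof.
move=> [mF _ _]; apply: cmeasurableS mF; first exact: mDT.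
by move=> [x xi] [/I1_Rplus].
Qed.

(** By Parseval on each fibre the integral over the rectangle becomes the
    integral of the fibre energies, which is the squared norm of [f]. *)
Lemma gsq_Theta f F : L2 f -> is_Theta a f F -> gsq mu2 Q F = gsq mu D f.
Proof.
move=> Lf TF; have mF := is_Theta_measurable TF.
have mh : measurable_fun Q (fun z => (Normc.normc (F z) ^+ 2)%:E).
  by apply/measurable_EFinP; exact: measurable_normc_sqr.
have h0 z : Q z -> (0 <= (Normc.normc (F z) ^+ 2)%:E)%E.
  by rewrite lee_fin sqr_ge0.
have [mI e] := @tonelli_rect _ _ _ _ R mu mu _ _ mI1 mJ _ mh h0.
rewrite -(integral_energy a1 0 Lf) /gsq e.
have -> : aint a 0 = I1 by rewrite /aint expr0z add0r expr1z.
apply: ae_eq_integral => //.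
  by apply: measurable_funS (measurable_energy a1 Lf); [exact: mRplus|exact: I1_Rplus].
apply: (ae_imp _ (is_Theta_section TF)) => x h /I1_Rplus Dx.
have [[mFx _] /fibre_norm] := h Dx.
by move=> /(_ mFx).
Qed.

Lemma gL2_Theta f F : L2 f -> is_Theta a f F -> gL2 mu2 Q F.
Proof.
move=> Lf TF; split; first exact: is_Theta_measurable TF.
by rewrite (gsq_Theta Lf TF); have [] := Lf.
Qed.

Lemma is_Theta_linear (c : R[i]) f g F G : is_Theta a f F -> is_Theta a g G ->
  is_Theta a (fun x => c * f x + g x) (fun z => c * F z + G z).
Proof.
move=> TF TG; have [mF pF _] := TF; have [mG pG _] := TG; split.
- by apply: cmeasurableD => //; exact: cmeasurableZ.
- by move=> x xi x0; rewrite pF// pG.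
apply: (ae_imp2 _ (is_Theta_section TF) (is_Theta_section TG)) => x hF hG x0.
have Dx : D x by rewrite RplusE.
have [LF sF] := hF Dx; have [LG sG] := hG Dx.
have Lu h l : gL2 mu J (fun xi => fibre_coef a h x l * eJ l xi).
  by apply: gL2Z; [exact: mJ|exact: gL2_eJ].
have := L2_sum_linear mJ c (Lu f) (Lu g) LF LG sF sG.
apply: eq_L2_sum => // l xi _; rewrite Theta_termE// /fibre_coef /dilation.
by rewrite mulrDr mulrDl (mulrCA _ c) !mulrA.
Qed.

(** Modulation acts on the fibres as a scalar, while dilation by [a ^ j] shifts
    the coefficient sequence and hence multiplies its Fourier series by a
    character. *)
Lemma is_Theta_atom p f F : is_Theta a f F ->
  is_Theta a (atom a p f) (fun z => Lambda a p.1 z.1 * fexp 1 p.2 z.2 * F z).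
Proof.
move=> TF; have [mF pF _] := TF; split.
- apply: cmeasurableM => //; apply: cmeasurableM.
    by apply: cmeasurable_fst; [exact: mRplus|exact: measurable_Lambda].
  by apply: cmeasurable_snd; [exact: mDT|exact: cmeasurable_fexp].
- move=> x xi x0; rewrite pF//=.
  by have := @fexp_periodic R 1 p.2 1 xi (oner_neq0 R); rewrite mulr1 => ->.
apply: (ae_imp _ (is_Theta_section TF)) => x hF x0.
have Dx : D x by rewrite RplusE.
have [[mFx _] sF] := hF Dx.
pose b xi := Lambda a p.1 x * fexp 1 p.2 xi.
have bK xi : J xi -> Normc.normc (b xi) ^+ 2 = (a - 1)^-1.
  by move=> _; rewrite /b Normc.normcM normc_fexp mulr1 normc_Lambda_sqr.
have mu_ l : cmeasurable J (fun xi => fibre_coef a f x l * eJ l xi).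
  by apply: cmeasurableZ; exact: cmeasurable_fexp.
have := L2_sum_mul_shift mJ p.2 bK mu_ mFx sF.
apply: eq_L2_sum => // l xi _; rewrite Theta_termE//.
have -> : fibre_coef a (atom a p f) x l = Lambda a p.1 x * fibre_coef a f x (l + p.2).
  rewrite /fibre_coef /atom /dilation Lambda_dilationz//.
  have -> : a ^ (l + p.2) = a ^ p.2 * a ^ l.
    by rewrite expfzDr ?gt_eqF ?(lt_trans ltr01 a1)// mulrC.
  rewrite sqrtrM ?ltW ?apow_gt0// rmorphM/= -(mulrA _ (a ^ l) x).
  move: (Lambda _ _ _) => L0; move: (f _) => f0.
  by ring.
have -> : eJ l xi = fexp 1 p.2 xi * eJ (l + p.2) xi.
  by rewrite /eJ -fexpD; congr (fexp _ _ _); ring.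
by rewrite /b; ring.
Qed.

Lemma gip_Theta f g F G : L2 f -> L2 g -> is_Theta a f F -> is_Theta a g G ->
  gip mu D f g = gip mu2 Q F G.
Proof.
move=> Lf Lg TF TG; have LF := gL2_Theta Lf TF; have LG := gL2_Theta Lg TG.
apply: (gip_polarization mRplus mQ) => //; last by rewrite /sqn (gsq_Theta Lf TF).
move=> c; rewrite /sqn (gsq_Theta _ (is_Theta_linear c TF TG))//.
by apply: gL2D; [exact: mRplus|apply: gL2Z; [exact: mRplus|]|].
Qed.

End ThetaIsometry.

(** * Fourier uniqueness on rectangles *)

Section RectangleUniqueness.
Context {R : realType} (u0 T v0 S : R).
Hypotheses (T0 : 0 < T) (S0 : 0 < S).
Local Notation mu := (@lebesgue_measure R).
Local Notation mu2 := ((mu \x mu)%E).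
Local Notation I := (`[u0, u0 + T[%classic : set (measurableTypeR R)).
Local Notation J := (`[v0, v0 + S[%classic : set (measurableTypeR R)).
Local Notation Q := (I `*` J).

Let mI : measurable I. Proof. exact: measurable_itv. Qed.
Let mJ : measurable J. Proof. exact: measurable_itv. Qed.
Let mQ : measurable Q. Proof. exact: measurableX. Qed.

Definition fexp2 (r : int * int) (z : R * R) : R[i] :=
  fexp T r.1 z.1 * fexp S r.2 z.2.

Lemma normc_fexp2 r z : Normc.normc (fexp2 r z) = 1.
Proof. by rewrite /fexp2 Normc.normcM !normc_fexp mulr1. Qed.

Lemma cmeasurable_fexp2 r (E : set (measurableTypeR R * measurableTypeR R)) :
  measurable E -> cmeasurable E (fexp2 r).
Proof.
move=> mE; apply: cmeasurableM; last first.
  by apply: cmeasurable_snd => //; exact: cmeasurable_fexp.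
apply: (cmeasurableS measurableT) => //.
rewrite -setXTT; apply: cmeasurable_fst => //; exact: cmeasurable_fexp.
Qed.

Lemma cintegrable_fexp2M r (K : R * R -> R[i]) : cintegrable mu2 Q K ->
  cintegrable mu2 Q (fun z => fexp2 r z * K z).
Proof.
move=> iK; apply: (cintegrable_le mQ _ (cintegrable_normc mQ iK)).
  apply: cmeasurableM; first exact: cmeasurable_fexp2.
  exact: cintegrable_measurable iK.
by move=> z _; rewrite Normc.normcM normc_fexp2 mul1r.
Qed.

Lemma cintegrable_cst_rect (c : R[i]) : cintegrable mu2 Q (fun=> c).
Proof.
have iC : mu2.-integrable Q (EFin \o cst (Normc.normc c)).
  apply/integrableP; split; first exact/measurable_EFinP/measurable_cst.
  under eq_integral do rewrite /=.
  rewrite integral_cst//= product_measure1E//.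
  rewrite [X in (_ * (X * _))%E]measure_period// [X in (_ * (_ * X))%E]measure_period//.
  by rewrite -!EFinM ltry.
by apply: (cintegrable_le mQ _ iC).
Qed.

Lemma fexp2_integral r :
  cint mu2 Q (fexp2 r) = if r == 0 then (T * S)%:C%C else 0.
Proof.
have iE : cintegrable mu2 Q (fexp2 r).
  apply: eq_cintegrable (cintegrable_fexp2M r (cintegrable_cst_rect 1)) => // z _.
  by rewrite mulr1.
have [_ _ ->] := cint_fubini mI mJ iE.
have iS : cintegrable mu J (fexp S r.2).
  apply: (integrable_bounded_period S0 (K := 1)); first exact: cmeasurable_fexp.
  by move=> x _; rewrite normc_fexp.
have iT : cintegrable mu I (fexp T r.1).
  apply: (integrable_bounded_period T0 (K := 1)); first exact: cmeasurable_fexp.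
  by move=> x _; rewrite normc_fexp.
have -> : cint mu I (fun x => cint mu J (fun y => fexp2 r (x, y))) =
    cint mu I (fun x => cint mu J (fexp S r.2) * fexp T r.1 x).
  by apply: eq_cint => x _; rewrite /fexp2 /= cintZ// mulrC.
rewrite cintZ// !fexp_integral// -[r == 0]/((r.1 == 0) && (r.2 == 0)).
case: (r.1 == 0); last by rewrite mulr0.
by case: (r.2 == 0); rewrite ?mul0r// mulrC rmorphM.
Qed.

(** Fourier uniqueness in each variable in turn: the coefficients of the
    sections are integrable functions of the first variable with vanishing
    coefficients, so each of these countably many functions vanishes almost
    everywhere, and then almost every section has vanishing coefficients. *)
Lemma fourier_uniqueness2 (K : R * R -> R[i]) : cintegrable mu2 Q K ->
  (forall r, cint mu2 Q (fun z => fexp2 r z * K z) = 0) ->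
  {ae mu2, forall z, Q z -> K z = 0}.
Proof.
move=> iK K0; pose g j x := cint mu J (fun y => K (x, y) * fexp S j y).
have iKj j : cintegrable mu2 Q (fun z => K z * fexp S j z.2).
  apply: eq_cintegrable (cintegrable_fexp2M (0, j) iK) => // z _.
  by rewrite /fexp2 /= fexp0 mul1r mulrC.
have g0 j : {ae mu, forall x, I x -> g j x = 0}.
  have [aej ij _] := cint_fubini mI mJ (iKj j).
  apply: (fourier_uniqueness T0 ij) => m.
  have [_ im] := cint_fubini mI mJ (cintegrable_fexp2M (m, j) iK).
  rewrite K0 => ->; apply: ae_eq_cint => //.
  - apply: cmeasurableM; first exact: cintegrable_measurable ij.
    exact: cmeasurable_fexp.
  - exact: cintegrable_measurable im.
  apply: (ae_imp _ aej) => x h Ix; rewrite [LHS]mulrC -cintZ//; last exact: h.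
  by apply: eq_cint => y _; rewrite /fexp2 /=; ring.
have [aeK _ _] := cint_fubini mI mJ iK.
have gz := ae_foralln (fun n => g0 (zenum n)).
have mK := cintegrable_measurable iK.
apply/normc_integral0 => //.
have mn : measurable_fun Q (fun z => (Normc.normc (K z))%:E).
  exact/measurable_EFinP/measurable_normc.
have n0 z : Q z -> (0 <= (Normc.normc (K z))%:E)%E by rewrite lee_fin normc_ge0.
have [mi ->] := @tonelli_rect _ _ _ _ R mu mu _ _ mI mJ _ mn n0.
rewrite (ae_eq_integral (cst 0%E))//; first by rewrite integral0.
apply: (ae_imp2 _ aeK gz) => x iKx gx Ix.
have mKx := cintegrable_measurable (iKx Ix).
apply/normc_integral0 => //; apply: (fourier_uniqueness S0 (iKx Ix)) => j.
by have := gx (zrank j) Ix; rewrite zrankK.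
Qed.

End RectangleUniqueness.

(** * The fibre criterion *)

Section FibreCriterion.
Context {R : realType} (a : R).
Hypothesis a1 : 1 < a.
Local Notation mu := (@lebesgue_measure R).
Local Notation mu2 := ((mu \x mu)%E).
Local Notation D := (@Rplus R : set (measurableTypeR R)).
Local Notation I1 := (`[1, a[%classic : set (measurableTypeR R)).
Local Notation J := (`[0, 1[%classic : set (measurableTypeR R)).
Local Notation L2 := (gL2 mu D).
Local Notation Q := (I1 `*` J).
Context (L : nat) (psi phi : 'I_L -> R -> R[i]).
Hypotheses (Lpsi : forall l, L2 (psi l)) (Lphi : forall l, L2 (phi l)).

Definition fibre_gram (z : R * R) : R[i] :=
  \sum_(l < L) Theta a (phi l) z * conjc (Theta a (psi l) z).

Let ThetaL f : L2 f -> gL2 mu2 Q (Theta a f).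
Proof. by move=> Lf; exact: gL2_Theta Lf (Theta_is_Theta a1 Lf). Qed.

Lemma cintegrable_fibre_gram : cintegrable mu2 Q fibre_gram.
Proof.
apply: cintegrable_sum => [|l]; first exact: mQ.
by apply: cintegrable_mulJ; [exact: mQ|exact: ThetaL|exact: ThetaL].
Qed.

Let rectE : Q = `[1, 1 + (a - 1)[%classic `*` `[0, 0 + 1[%classic.
Proof. by rewrite -I1E add0r. Qed.

Let b0 : 0 < a - 1. Proof. by rewrite subr_gt0. Qed.

Let cintegrable_character r k : cintegrable mu2 Q k ->
  cintegrable mu2 Q (fun z => fexp2 (a - 1) 1 r z * k z).
Proof. by rewrite rectE; exact: cintegrable_fexp2M. Qed.

(** The transform preserves inner products and turns the shift by [r] into
    multiplication by [lnorm a] times an exponential of the rectangle. *)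
Lemma sum_gip_atom r : \sum_(l < L) gip mu D (atom a r (psi l)) (phi l) =
  lnorm a * cint mu2 Q (fun z => fexp2 (a - 1) 1 r z * conjc (fibre_gram z)).
Proof.
have iM := cintegrableJ (mQ a) cintegrable_fibre_gram.
rewrite -cintZ; [|exact: mQ|exact: cintegrable_character].
pose u l z := Lambda a r.1 z.1 * fexp 1 r.2 z.2 * Theta a (psi l) z *
  conjc (Theta a (phi l) z).
have iu l : cintegrable mu2 Q (u l).
  apply: cintegrable_mulJ; [exact: mQ| |exact: ThetaL].
  apply: (gL2_Theta a1 (gL2_atom a1 r (Lpsi l))).
  by apply: is_Theta_atom => //; exact: Theta_is_Theta.
transitivity (cint mu2 Q (fun z => \sum_(l < L) u l z)).
  rewrite cint_sum//; last exact: mQ.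
  apply: eq_bigr => l _; rewrite (gip_Theta a1 (gL2_atom a1 r (Lpsi l)) (Lphi l)
    (is_Theta_atom a1 r (Theta_is_Theta a1 (Lpsi l))) (Theta_is_Theta a1 (Lphi l))).
  by [].
apply: eq_cint => z [/= zI _]; move: zI; rewrite in_itv/= => /andP[z1 za].
rewrite /fibre_gram conjc_sum !mulr_sumr; apply: eq_bigr => l _.
rewrite /u Lambda_base// /fexp2 /lnorm conjcM conjcK -/(fexp (a - 1) r.1 z.1).
by move: (fexp _ _ _) => e1; ring.
Qed.

(** By the criterion on shifts, duality says that the conjugate of
    [fibre_gram] has the same Fourier coefficients as the constant 1. *)
Lemma dual_frames_iff_fibre_gram : is_bessel (MD psi a) -> is_bessel (MD phi a) ->
  dual_frames (MD psi a) (MD phi a) <->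
  {ae mu2, forall z, Q z -> fibre_gram z = 1}.
Proof.
move=> Bpsi Bphi; pose K z := conjc (fibre_gram z) - 1.
have iM := cintegrableJ (mQ a) cintegrable_fibre_gram.
have iC c : cintegrable mu2 Q (fun=> c) by rewrite rectE; exact: cintegrable_cst_rect.
have iK : cintegrable mu2 Q K by apply: cintegrableD => //; exact: mQ.
have iE r : cintegrable mu2 Q (fexp2 (a - 1) 1 r).
  apply: eq_cintegrable (cintegrable_character r (iC 1)); [exact: mQ|].
  by move=> z _; rewrite mulr1.
have coefK r : cint mu2 Q (fun z => fexp2 (a - 1) 1 r z * K z) =
    cint mu2 Q (fun z => fexp2 (a - 1) 1 r z * conjc (fibre_gram z)) -
    cint mu2 Q (fexp2 (a - 1) 1 r).
  apply/eqP; rewrite eq_sym subr_eq; apply/eqP.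
  rewrite -cintD; [|exact: mQ|exact: cintegrable_character|exact: iE].
  by apply: eq_cint => z _; rewrite /K mulrBr mulr1 subrK.
have norm1 r : lnorm a * (lnorm a * cint mu2 Q (fexp2 (a - 1) 1 r)) = (r == 0)%:R.
  rewrite mulrA lnormM// rectE fexp2_integral//.
  case: eqP => _; last by rewrite mulr0.
  by rewrite mulr1 -rmorphM/= mulVf// gt_eqF.
rewrite (dual_frames_MD_iff a1 Lpsi Lphi Bpsi Bphi).
transitivity (forall r, cint mu2 Q (fun z => fexp2 (a - 1) 1 r z * K z) = 0).
  split => H r.
    apply/eqP; rewrite coefK subr_eq0; apply/eqP.
    apply: (mulfI (lnorm_neq0 a1)); apply: (mulfI (lnorm_neq0 a1)).
    by rewrite [RHS]norm1 -sum_gip_atom H.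
  have /eqP := H r; rewrite coefK subr_eq0 => /eqP e.
  by rewrite sum_gip_atom e norm1.
have conjK z : fibre_gram z = 1 <-> K z = 0.
  split=> [e|/eqP]; first by rewrite /K e conjcR subrr.
  by rewrite subr_eq0 => /eqP/(congr1 conjc); rewrite conjcK conjcR.
split => H.
  have aeK : {ae mu2, forall z, Q z -> K z = 0}.
    by rewrite rectE in iK H *; exact: fourier_uniqueness2 H.
  by apply: (ae_imp _ aeK) => z h /h /conjK.
move=> r; transitivity (cint mu2 Q (fun z => 0 * fexp2 (a - 1) 1 r z)).
  apply: ae_eq_cint; [exact: mQ| | |].
  - exact: cintegrable_measurable (cintegrable_character r iK).
  - by apply: cmeasurableZ; apply: cmeasurable_fexp2; exact: mQ.
  by apply: (ae_imp _ H) => z h /h /conjK ->; rewrite mulr0 mul0r.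
rewrite cintZ ?mul0r//; first exact: mQ.

Qed.

End FibreCriterion.

Theorem theorem3p1 (R : realType) (a : R) (L : nat)
    (psi phi : 'I_L -> R -> R[i])
    (ha : 1 < a)
    (hpsi : forall l : 'I_L, inL2 Rplus (psi l))
    (hpsi_distinct : forall l l' : 'I_L, l != l' ->
       ~ {ae lebesgue_measure, forall x : R, 0 < x -> psi l x = psi l' x})
    (hphi : forall l : 'I_L, inL2 Rplus (phi l))
    (hbpsi : is_bessel (MD psi a))
    (hbphi : is_bessel (MD phi a)) :
  dual_frames (MD psi a) (MD phi a) <->
  {ae (lebesgue_measure \x lebesgue_measure)%E, forall z : R * R,
     1 <= z.1 < a -> 0 <= z.2 < 1 ->
     \sum_(l < L) Theta a (phi l) z * conjc (Theta a (psi l) z) = 1}.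
Proof.
rewrite (dual_frames_iff_fibre_gram ha hpsi hphi hbpsi hbphi).
split; apply: ae_imp => z h.
  by move=> z1 z2; apply: h; split; rewrite /= in_itv/=.
by move=> [/=]; rewrite !in_itv/=; exact: h.
Qed.
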